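(* Let $\mathfrak{G}$ be the set of weighted graphs $G$ such that: - $G=K_{4p}$ is the complete graph on $4p$ vertices $v_1,\dots,v_{4p}$, for some integer $p\ge1$; - $G$ is weighted by $w:E(G)\to\{1,\dots,4p-1\}$ and the assignment of labels given by $w$ is an edge-coloring of $G$; - the second smallest eigenvalue $\lambda_G$ of the (non-normalized) Laplacian of $G$ satisfies $\lambda_G \ge \frac{4p(4p-1)}{2}$. Let $G\in\mathfrak{G}$ with $|V(G)|=4p$. Then there is a set of points $\{\xi_i\}_{i=1}^{4p}\subset\mathbb{R}^{4p-1}$ associated to $G$, meaning that $$|\xi_i|=\sqrt{\tfrac{4p-1}{4p}}\quad\text{and}\quad |\xi_i-\xi_j| = 2\sqrt{w(\{v_i,v_j\})}\,\sqrt{\tfrac{1}{4p}}\quad\text{for all } i\neq j.$$ For such points, set $c_i=(0,0,0,\xi_i)\in\mathbb{R}^{4p+2}$ for $i=1,\dots,4p$, let $V=\mathbb{R}^3\times\{0\}\subset \mathbb{R}^{4p+2}$, and let $S_i=(V+c_i)\cap\mathbb{S}^{4p+1}$, which is the 2-sphere in $V+c_i$ of radius $\sqrt{\frac{1}{4p}}$ centered at $c_i$. Set $\Omega=\bigcup_{i=1}^{4p}S_i$, $$\Sigma=\left\{x\in\mathbb{R}^{4p+2}\setminus\{0\} : \frac{x}{|x|}\in\Omega\right\}\cup\{0\},$$ and $\nu=\mathcal{H}^3|_{\Sigma}$. Then for all $x\in\Sigma$ and $r>0$, $$\nu(B(x,r))=\frac{4\pi}{3}r^3.$$ In particular, $\nu$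 is 3-uniform.
   Context: An edge-coloring assigns distinct labels to any two distinct edges sharing a vertex. For a weighted complete graph with weights $w$, the (non-normalized) Laplacian is the matrix $L$ with $L_{ij}=-w(\{v_i,v_j\})$ for $i\ne j$ and $L_{ii}=\sum_{j\neq i}w(\{v_i,v_j\})$; eigenvalues are counted with multiplicity. $\mathbb{S}^{4p+1}$ is the unit sphere in $\mathbb{R}^{4p+2}$. $\mathcal{H}^3|_\Sigma$ is 3-dimensional Hausdorff measure restricted to $\Sigma$. $B(x,r)$ is the Euclidean ball. A Radon measure $\nu$ is 3-uniform if there is $c>0$ with $\nu(B(x,r))=cr^3$ for all $x\in\operatorname{supp}(\nu)$ and $r>0$. *)

(* Defs.v *)
From HB Require Import structures.
From mathcomp Require Import all_boot all_order all_algebra.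
From mathcomp Require Import polyrcf.
From mathcomp Require Import all_classical all_reals all_analysis.

Set Implicit Arguments.
Unset Strict Implicit.
Unset Printing Implicit Defensive.

Import Order.TTheory GRing.Theory Num.Theory.
Import numFieldNormedType.Exports.

Local Open Scope classical_set_scope.
Local Open Scope ring_scope.

(* The edges of the complete graph on 'I_n are the two-element subsets of
   'I_n; weights are functions on {set 'I_n} whose values away from the edges
   are never used. *)
Definition edge (n : nat) (e : {set 'I_n}) : bool := #|e| == 2%N.

Definition edge_coloring (n : nat) (w : {set 'I_n} -> nat) : Prop :=
  forall e f : {set 'I_n}, edge e -> edge f ->
    e != f -> forall v : 'I_n, v \in e -> v \in f -> w e != w f.

Definition laplacian (R : realType) (n : nat) (w : {set 'I_n} -> nat) :
    'M[R]_n :=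
  \matrix_(i, j)
    if i == j then \sum_(k | k != i) (w [set i; k]%SET)%:R
    else - (w [set i; j]%SET)%:R.

(* The real eigenvalues in nondecreasing order, repeated according to algebraic
   multiplicity ([rootsR p] is the increasing list of the roots of [p]). *)
Definition spectrum (R : realType) (n : nat) (A : 'M[R]_n) : seq R :=
  flatten [seq nseq (mup x (char_poly A)) x | x <- rootsR (char_poly A)].

Definition second_smallest_eigenvalue (R : realType) (n : nat)
    (A : 'M[R]_n) : R := nth 0 (spectrum A) 1%N.

Definition frakG (R : realType) (p : nat) (w : {set 'I_(4 * p)} -> nat) :
    Prop :=
  [/\ (1 <= p)%N,
      forall e, edge e -> (1 <= w e <= 4 * p - 1)%N,
      edge_coloring w &
      ((4 * p) * (4 * p - 1))%:R / 2
        <= second_smallest_eigenvalue (laplacian R w)].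

(* The library norm on 'rV[R]_n is the sup norm, hence a separate Euclidean
   norm; both define the same topology. *)
Definition enorm (R : realType) (n : nat) (x : 'rV[R]_n) : R :=
  Num.sqrt (\sum_i x 0 i ^+ 2).

(* B(x, r) is taken to be the closed ball. *)
Definition eball (R : realType) (n : nat) (x : 'rV[R]_n) (r : R) :
    set 'rV[R]_n := [set y | enorm (y - x) <= r].

Definition usphere (R : realType) (n : nat) : set 'rV[R]_n :=
  [set x | enorm x = 1].

(* The point 0 is added so that the diameter of the empty set is 0. *)
Definition ediam (R : realType) (n : nat) (A : set 'rV[R]_n) : \bar R :=
  ereal_sup ([set 0%E] `|`
             [set (enorm (z.1 - z.2))%:E | z in A `*` A]).

(* Three-dimensional Hausdorff measure, as an outer measure on all subsets,
   with the standard normalization: a set of diameter d contributes the volume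
   4 pi / 3 * (d / 2) ^ 3 of a ball of diameter d in R^3. *)
Definition hausdorff3_pre (R : realType) (n : nat) (delta : R)
    (A : set 'rV[R]_n) : \bar R :=
  ereal_inf
    [set (\sum_(0 <= k <oo) (4 * pi / 3 * (fine (ediam (F k)) / 2) ^+ 3)%:E)%E
    | F in [set F : (set 'rV[R]_n)^nat |
             (forall k, (ediam (F k) <= delta%:E)%E) /\
             A `<=` \bigcup_k F k]].

Definition hausdorff3 (R : realType) (n : nat) (A : set 'rV[R]_n) : \bar R :=
  ereal_sup [set hausdorff3_pre delta A | delta in [set d : R | 0 < d]].

Definition restriction (R : realType) (n : nat)
    (mu : set 'rV[R]_n -> \bar R) (D : set 'rV[R]_n) :
    set 'rV[R]_n -> \bar R := fun A => mu (A `&` D).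

Definition borel_space (R : realType) (n : nat) :=
  g_sigma_algebraType (@open 'rV[R]_n).

(* A set function on all subsets of R^n is Radon if it restricts to a Radon
   measure on the Borel sets. *)
Definition radon (R : realType) (n : nat) (nu : set 'rV[R]_n -> \bar R) :
    Prop :=
  [/\ exists m : {measure set (borel_space R n) -> \bar R},
        forall A : set (borel_space R n), measurable A -> m A = nu A,
      forall K : set 'rV[R]_n, compact K -> (nu K < +oo)%E,
      forall A : set (borel_space R n), measurable A ->
        nu A = ereal_inf [set nu U | U in [set U | open U /\ A `<=` U]] &
      forall U : set 'rV[R]_n, open U ->
        nu U = ereal_sup [set nu K | K in [set K | compact K /\ K `<=` U]]].

Definition msupport (R : realType) (n : nat) (nu : set 'rV[R]_n -> \bar R) :
    set 'rV[R]_n :=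
  [set x | forall r : R, 0 < r -> (0 < nu (eball x r))%E].

Definition uniform3 (R : realType) (n : nat) (nu : set 'rV[R]_n -> \bar R) :
    Prop :=
  radon nu /\
  exists2 c : R, 0 < c &
    forall (x : 'rV[R]_n) (r : R), msupport nu x -> 0 < r ->
      nu (eball x r) = (c * r ^+ 3)%:E.

Definition associated_points (R : realType) (p : nat)
    (w : {set 'I_(4 * p)} -> nat) (xi : 'I_(4 * p) -> 'rV[R]_(4 * p - 1)) :
    Prop :=
  (forall i, enorm (xi i) = Num.sqrt ((4 * p - 1)%:R / (4 * p)%:R)) /\
  (forall i j, i != j ->
     enorm (xi i - xi j)
       = 2 * Num.sqrt (w [set i; j]%SET)%:R * Num.sqrt (1 / (4 * p)%:R)).

Section Cone.
Variables (R : realType) (p : nat) (xi : 'I_(4 * p) -> 'rV[R]_(4 * p - 1)).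

(* For p >= 1 the ambient dimension 3 + (4 * p - 1) is 4 * p + 2; in this form
   (u, v) with u in R^3 is [row_mx u v]. *)
Definition ambient := 'rV[R]_(3 + (4 * p - 1)).

Definition sphere_center (i : 'I_(4 * p)) : ambient := row_mx 0 (xi i).

Definition Vspace : set ambient := [set row_mx u 0 | u in [set: 'rV[R]_3]].

Definition Vtranslate (i : 'I_(4 * p)) : set ambient :=
  [set v + sphere_center i | v in Vspace].

Definition Ssphere (i : 'I_(4 * p)) : set ambient :=
  Vtranslate i `&` @usphere R _.

Definition Omega : set ambient := \bigcup_i Ssphere i.

Definition Sigma : set ambient :=
  [set x | x != 0 /\ Omega ((enorm x)^-1 *: x)] `|` [set 0].

Definition cone_measure : set ambient -> \bar R :=
  restriction (@hausdorff3 R _) Sigma.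

End Cone.

(* Main.v *)
Require Import Defs.
From HB Require Import structures.
From mathcomp Require Import all_boot all_order all_algebra.
From mathcomp Require Import ring lra zify.
From mathcomp Require Import all_classical all_reals all_analysis.
From mathcomp Require Import measurable_realfun polyrcf.

Set Implicit Arguments.
Unset Strict Implicit.
Unset Printing Implicit Defensive.

Import Order.TTheory GRing.Theory Num.Theory.
Import numFieldNormedType.Exports.

Local Open Scope classical_set_scope.
Local Open Scope ring_scope.

(* Put n = 4p. The cone over S_j is the graph f_j(z) = (z, sqrt n |z| xi_j) over R^3,
   and |f_i z - f_j z'|^2 = |z - z'|^2 + (n - 1) (|z| - |z'|)^2 + 4 w_ij |z| |z'|, with
   w_ii = 0. In the volume-preserving polar coordinates (|z|^3, cosine of the
   colatitude, azimuth) every f_j has a diagonal metric with constant Jacobian, so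
   the area formula reads the Hausdorff measure of a Borel subset of the cone as a
   sum over j of volumes of coordinate sets. For a ball centred at a point of the
   sheet i, the axis of the coordinates being taken through that point, the j-th
   set is mapped affinely onto the slice of one fixed Euclidean ball of R^3 where
   the cosine lies in the w_ij-th of n equal subintervals of ]-1, 1[. The edge
   coloring makes j |-> w_ij a bijection onto {0, ..., n - 1}, so the slices
   reassemble the ball.

   The points xi_j exist because their Gram matrix is
   (n - 1) / n J + 2 / n (L - n (n - 1) / 2), which kills the ones vector and is positive
   semidefinite on its complement by the spectral hypothesis. *)

(** * Regularity of Borel measures *)

(** No derivative of a chart is ever taken. Differentiability is replaced by an exact identity: in
    the polar coordinates the squared distance of two points of a sheet is A1 dx^2 + A2 dy^2 + A3
    dz^2, where A1, A2, A3 are continuous in the pair of points. Diagonal linear maps are therefore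
    the only linear maps whose effect on volume matters, and for a product of Lebesgue measures this
    is scaling factor by factor. The obstacle is the sharp constant: upper and lower bounds for the
    Hausdorff measure must both carry the constant of R^3. The upper bound comes from filling open
    sets with balls, the lower one from the isodiametric inequality, proved by Steiner
    symmetrization. The constant itself stays symbolic, because the Hausdorff measure of one
    Euclidean ball of R^3, read in the flat and in the polar chart, already gives the number that
    the theorem asks for. The area formula also yields countable additivity on Borel sets, since
    Hausdorff measure is otherwise handled only as an outer measure. *)

Lemma ecvg_ex_lt (R : realType) (u : nat -> \bar R) (l b : \bar R) :
  u @ \oo --> l -> (l < b)%E -> exists n, (u n < b)%E.
Proof.
move=> ul lb.
have /ul[n _ /(_ n (leqnn n))] : nbhs l [set y | (y < b)%E].
  by apply: open_nbhs_nbhs; split => //; exact: open_ereal_lt_ereal.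
by exists n.
Qed.

Lemma ecvg_ex_gt (R : realType) (u : nat -> \bar R) (l b : \bar R) :
  u @ \oo --> l -> (b < l)%E -> exists n, (b < u n)%E.
Proof.
move=> ul lb.
have /ul[n _ /(_ n (leqnn n))] : nbhs l [set y | (b < y)%E].
  by apply: open_nbhs_nbhs; split => //; exact: open_ereal_gt_ereal.
by exists n.
Qed.

HB.instance Definition _ (R : numDomainType) (A B : pseudoPMetricType R) :=
  Pointed.on (A * B)%type.

(** The construction of [borel_space] for an arbitrary space, so that the product [R * R * R] and
    the ambient row vectors share one theory of Borel sets. *)
Definition bor (T : ptopologicalType) := g_sigma_algebraType (@open T).

Lemma open_bor (T : ptopologicalType) (A : set (bor T)) : open A -> measurable A.
Proof. by move=> oA; apply: sub_sigma_algebra. Qed.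

Lemma closed_bor (T : ptopologicalType) (A : set (bor T)) :
  closed A -> measurable A.
Proof.
by move=> cA; rewrite -(setCK A); apply: measurableC; apply: open_bor; rewrite openC.
Qed.

Section outer_regularity.
Variables (R : realType) (T : pseudoPMetricType R).
Variables (mu : {measure set (bor T) -> \bar R}) (V : nat -> set (bor T)).
Hypothesis oV : forall m, open (V m).
Hypothesis VT : \bigcup_m V m = setT.
Hypothesis Vfin : forall m, (mu (V m) < +oo)%E.

Definition outer_regular (A : set (bor T)) := measurable A /\
  forall e : R, 0 < e -> exists U : set (bor T),
    [/\ open U, A `<=` U & (mu (U `\` A) <= e%:E)%E].

Lemma open_outer_regular (A : set (bor T)) : open A -> outer_regular A.
Proof.
move=> oA; split; first exact: open_bor.
by move=> e e0; exists A; split => //; rewrite setDv measure0 lee_fin ltW.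
Qed.

Lemma bigcup_outer_regular (A : nat -> set (bor T)) :
  (forall k, outer_regular (A k)) -> outer_regular (\bigcup_k A k).
Proof.
move=> rA; have mA k : measurable (A k) by case: (rA k).
split; first exact: bigcup_measurable.
move=> e e0.
have /choice[U HU] : forall k, exists U : set (bor T),
    [/\ open U, A k `<=` U & (mu (U `\` A k) <= (e / (2 ^ k.+1)%:R)%:E)%E].
  move=> k; by apply: (rA k).2; apply: divr_gt0.
exists (\bigcup_k U k); split.
- by apply: bigcup_open => k _; case: (HU k).
- by apply: subset_bigcup => k _; case: (HU k).
have mU k : measurable (U k) by apply: open_bor; case: (HU k).
apply: (@le_trans _ _ (\sum_(0 <= k <oo) mu (U k `\` A k))%E).
  apply: measure_sigma_subadditive.
  - by move=> k; apply: measurableD.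
  - by apply: measurableD; apply: bigcup_measurable.
  - move=> x [[k _ Ukx] nA]; exists k => //; split => // Akx.
    by apply: nA; exists k.
apply: le_trans (epsilon_trick0 xpredT (ltW e0)).
by apply: lee_nneseries => // k _; case: (HU k).
Qed.

(** An infinite intersection of open sets need not be open. Inside each [V m], of finite measure,
    continuity from above allows the intersection to be cut after [N m] factors at a small cost; the
    open set is the union over m of these finite intersections. *)
Lemma bigcap_outer_regular (A : nat -> set (bor T)) :
  (forall k, outer_regular (A k)) -> outer_regular (\bigcap_k A k).
Proof.
move=> rA; have mA k : measurable (A k) by case: (rA k).
have mcA : measurable (\bigcap_k A k) by exact: bigcapT_measurable.
split => // e e0.
have e20 : 0 < e / 2 by rewrite divr_gt0.
have /choice[U HU] : forall k, exists U : set (bor T),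
    [/\ open U, A k `<=` U & (mu (U `\` A k) <= (e / 2 / (2 ^ k.+1)%:R)%:E)%E].
  move=> k; by apply: (rA k).2; apply: divr_gt0.
have mU k : measurable (U k) by apply: open_bor; case: (HU k).
have mcU : measurable (\bigcap_k U k) by exact: bigcapT_measurable.
pose W m N : set (bor T) := V m `&` \bigcap_(k < N) U k.
have oW m N : open (W m N).
  apply: openI => //; elim: N => [|N IH].
    rewrite (_ : \bigcap_(k < 0) U k = setT); first exact: openT.
    by apply/seteqP; split => // x _ k.
  rewrite (_ : \bigcap_(k < N.+1) U k = U N `&` \bigcap_(k < N) U k).
    by apply: openI => //; case: (HU N).
  apply/seteqP; split => x /=.
    by move=> H; split => [|k kN]; apply: H => //=; rewrite ltnS ltnW.
  by move=> [H1 H2] k /=; rewrite ltnS leq_eqVlt => /orP[/eqP->//|]; exact: H2.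
have mW m N : measurable (W m N) by exact: open_bor.
have /choice[N HN] : forall m, exists N,
    (mu (W m N `\` \bigcap_k U k) <= (e / 2 / (2 ^ m.+1)%:R)%:E)%E.
  move=> m.
  have := @nonincreasing_cvg_mu _ _ _ mu (fun N => W m N `\` \bigcap_k U k).
  rewrite (_ : \bigcap_n (W m n `\` \bigcap_k U k) = set0); last first.
    rewrite -subset0 => x H.
    have [_ +] := H 0%N Logic.I; apply=> k _.
    by have [[_ +] _] := H k.+1 Logic.I; apply => /=.
  rewrite measure0 => H.
  have d0 : (0 < (e / 2 / (2 ^ m.+1)%:R)%:E)%E.
    by rewrite lte_fin divr_gt0.
  have [||||N HN] := ecvg_ex_lt (H _ _ _ _) d0.
  - apply: le_lt_trans (Vfin m); apply: le_measure; rewrite ?inE//.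
    + exact: measurableD.
    + exact: open_bor.
    + by move=> x [[]].
  - by move=> i; apply: measurableD.
  - by [].
  - move=> i j ij; apply/subsetPset => x [[Vx Hx] nx]; split => //; split => //.
    by move=> k /= ki; apply: Hx => /=; exact: leq_trans ij.
  - by exists N; exact: ltW.
exists (\bigcup_m W m (N m)); split.
- by apply: bigcup_open => m _.
- move=> x Ax; have : [set: T] x by [].
  rewrite -VT => -[m _ Vmx]; exists m => //; split => // k _.
  by case: (HU k) => _ + _; apply; exact: Ax.
rewrite [in leRHS](splitr e) EFinD.
apply: (@le_trans _ _ (mu ((\bigcup_m (W m (N m) `\` \bigcap_k U k)) `|`
                        (\bigcup_k (U k `\` A k))))).
  apply: le_measure; rewrite ?inE//.
  - by apply: measurableD => //; apply: bigcup_measurable.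
  - apply: measurableU; apply: bigcup_measurable => k _; exact: measurableD.
  - move=> x [[m _ Wx] nA]; have [Ux|Ux] := pselect ((\bigcap_k U k) x).
      right; apply: contrapT => H; apply: nA => k _; apply: contrapT => nAk.
      by apply: H; exists k => //; split => //; exact: Ux.
    by left; exists m.
apply: le_trans (measureU2 _ _ _) _.
- by apply: bigcup_measurable => k _; exact: measurableD.
- by apply: bigcup_measurable => k _; exact: measurableD.
apply: leeD.
- apply: le_trans (epsilon_trick0 xpredT (ltW e20)).
  apply: le_trans (generalized_Boole_inequality _ _ _) _.
  + by move=> k; exact: measurableD.
  + by apply: bigcup_measurable => k _; exact: measurableD.
  + exact: lee_nneseries.
- apply: le_trans (epsilon_trick0 xpredT (ltW e20)).
  apply: le_trans (generalized_Boole_inequality _ _ _) _.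
  + by move=> k; exact: measurableD.
  + by apply: bigcup_measurable => k _; exact: measurableD.
  + by apply: lee_nneseries => // k _; case: (HU k).
Qed.

(** In a pseudometric space a closed set is the intersection of its neighbourhoods of radii 1 / (k +
    1). *)
Lemma closed_outer_regular (A : set (bor T)) : closed A -> outer_regular A.
Proof.
move=> cA.
rewrite (_ : A = \bigcap_k \bigcup_(y in A) (ball y k.+1%:R^-1)^°).
  by apply: bigcap_outer_regular => k; apply: open_outer_regular;
    apply: bigcup_open => y _; exact: open_interior.
apply/seteqP; split => [x Ax k _|x H].
  by exists x => //; apply: nbhsx_ballx; rewrite invr_gt0 ltr0n.
apply: cA => B /nbhs_ballP[e /= e0 eB].
have [k ke] := ltr_add_invr e0.
rewrite add0r in ke.
have [y Ay /interior_subset xy] := H k Logic.I.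
exists y; split => //; apply: eB.
by apply: le_ball (ball_sym xy); exact: ltW.
Qed.

(** Outer regularity of A alone does not pass to the complement; the sets such that both A and its
    complement are outer regular form a sigma-algebra. *)
Lemma borel_outer_regular (A : set (bor T)) : measurable A -> outer_regular A.
Proof.
suff : <<s @open T >> `<=` [set A | outer_regular A /\ outer_regular (~` A)].
  by move=> + mA => /(_ A mA)[].
apply: smallest_sub; last first.
  move=> U oU; split; first exact: open_outer_regular.
  by apply: closed_outer_regular; rewrite closedC.
split => /=.
- by split; rewrite ?setC0; apply: open_outer_regular; [exact: open0|exact: openT].
- by move=> B [rB rcB]; rewrite setTD setCK.
- move=> B rB; split; first by apply: bigcup_outer_regular => k; exact: (rB k).1.
  by rewrite setC_bigcup; apply: bigcap_outer_regular => k; exact: (rB k).2.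
Qed.

Lemma borel_closed_approx (A : set (bor T)) (e : R) : measurable A -> 0 < e ->
  exists F : set (bor T), [/\ closed F, F `<=` A & (mu (A `\` F) <= e%:E)%E].
Proof.
move=> mA e0; have [_ /(_ _ e0)[U [oU AU Ue]]] := borel_outer_regular (measurableC mA).
exists (~` U); split; first by rewrite closedC.
- by rewrite -(setCK A); apply: subsetC.
- by rewrite setDE setCK setIC -(setCK A) -setDE.
Qed.

End outer_regularity.

Lemma mule_inv_scale (R : realType) (c1 c2 : R) (x y : \bar R) :
  0 < c1 -> 0 < c2 ->
  (((c1 * c2)^-1)%:E * ((c1%:E * x) * (c2%:E * y)) = x * y)%E.
Proof.
move=> c10 c20; rewrite muleACA.
have K : (c1 * c2)^-1 * (c1 * c2) = 1 by rewrite mulVf// mulf_neq0// gt_eqF.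
have -> : (c1%:E * c2%:E = (c1 * c2)%:E)%E by [].
by rewrite (muleA ((c1 * c2)^-1)%:E) -EFinM K mul1e.
Qed.

(** * Products of Lebesgue measures and Steiner symmetrization *)

Section product_maps.
Context d1 d2 (T1 : measurableType d1) (T2 : measurableType d2) (R : realType).

(** Uniqueness of the product measure: the pushforward divided by c1 c2 agrees with it on
    rectangles. *)
Lemma product_measure_map (m1 : {sigma_finite_measure set T1 -> \bar R})
    (m2 : {sigma_finite_measure set T2 -> \bar R})
    (f1 : T1 -> T1) (f2 : T2 -> T2) (c1 c2 : R) :
  measurable_fun setT f1 -> measurable_fun setT f2 -> 0 < c1 -> 0 < c2 ->
  (forall A, measurable A -> m1 (f1 @^-1` A) = (c1%:E * m1 A)%E) ->
  (forall A, measurable A -> m2 (f2 @^-1` A) = (c2%:E * m2 A)%E) ->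
  measurable_fun setT (fun p : T1 * T2 => (f1 p.1, f2 p.2)) /\
  forall A, measurable A ->
    (m1 \x m2)%E ((fun p => (f1 p.1, f2 p.2)) @^-1` A) =
    ((c1 * c2)%:E * (m1 \x m2) A)%E.
Proof.
move=> mf1 mf2 c10 c20 H1 H2.
have mf : measurable_fun setT (fun p : T1 * T2 => (f1 p.1, f2 p.2)).
  apply: measurable_fun_pair.
  - by apply: (measurableT_comp mf1); exact: measurable_fst.
  - by apply: (measurableT_comp mf2); exact: measurable_snd.
split => // A mA.
have ci0 : 0 <= (c1 * c2)^-1 by rewrite invr_ge0 mulr_ge0// ltW.
pose m' := mscale (NngNum ci0)
  (measure_function_pushforward__canonical__measure_function_Measure
    (m1 \x m2)%E mf).
rewrite [in RHS](@product_measure_unique _ _ _ _ _ m1 m2 m')//.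
  rewrite /m' /mscale/= /pushforward muleA -EFinM divff ?mul1e//.
  by rewrite mulf_neq0// gt_eqF.
move=> B C mB mC.
apply: (@etrans _ _ (((c1 * c2)^-1)%:E *
    (m1 \x m2)%E ((f1 @^-1` B) `*` (f2 @^-1` C)))%E); first by [].
rewrite product_measure1E; last 2 first.
- by rewrite -[X in measurable X]setTI; exact: mf1.
- by rewrite -[X in measurable X]setTI; exact: mf2.
apply: (@etrans _ _ (((c1 * c2)^-1)%:E *
    ((c1%:E * m1 B) * (c2%:E * m2 C))))%E.
  by congr (_ * (_ * _))%E; [exact: H1|exact: H2].
exact: mule_inv_scale.
Qed.

End product_maps.

(* The library's own instance is shadowed by the one for subprobabilities. *)
Lemma product_measure_sigma_finite d1 d2 (T1 : measurableType d1)
    (T2 : measurableType d2) (R : realType)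
    (m1 : {sigma_finite_measure set T1 -> \bar R})
    (m2 : {sigma_finite_measure set T2 -> \bar R}) :
  sigma_finite setT (m1 \x m2)%E.
Proof.
have /sigma_finiteP[F [FT Fmono Ffin]] := sigma_finiteT m1.
have /sigma_finiteP[G [GT Gmono Gfin]] := sigma_finiteT m2.
exists (fun n => F n `*` G n) => [|n]; last first.
  have [mF F1] := Ffin n; have [mG G1] := Gfin n.
  split; first exact: measurableX.
  by rewrite product_measure1E// lte_mul_pinfty// ge0_fin_numE.
apply/seteqP; split => // -[x y] _.
have : setT x by []; rewrite FT => -[i _ Fx].
have : setT y by []; rewrite GT => -[j _ Gy].
exists (maxn i j) => //; split.
- by move: x Fx; exact/subsetPset/Fmono/leq_maxl.
- by move: y Gy; exact/subsetPset/Gmono/leq_maxr.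
Qed.

Lemma product3_measure_map d1 d2 d3 (T1 : measurableType d1)
    (T2 : measurableType d2) (T3 : measurableType d3) (R : realType)
    (m1 : {sigma_finite_measure set T1 -> \bar R})
    (m2 : {sigma_finite_measure set T2 -> \bar R})
    (m3 : {sigma_finite_measure set T3 -> \bar R})
    (f1 : T1 -> T1) (f2 : T2 -> T2) (f3 : T3 -> T3) (c1 c2 c3 : R) :
  measurable_fun setT f1 -> measurable_fun setT f2 -> measurable_fun setT f3 ->
  0 < c1 -> 0 < c2 -> 0 < c3 ->
  (forall A, measurable A -> m1 (f1 @^-1` A) = (c1%:E * m1 A)%E) ->
  (forall A, measurable A -> m2 (f2 @^-1` A) = (c2%:E * m2 A)%E) ->
  (forall A, measurable A -> m3 (f3 @^-1` A) = (c3%:E * m3 A)%E) ->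
  forall A, measurable A ->
    (m1 \x m2 \x m3)%E
      ((fun p : T1 * T2 * T3 => ((f1 p.1.1, f2 p.1.2), f3 p.2)) @^-1` A) =
    ((c1 * c2 * c3)%:E * (m1 \x m2 \x m3) A)%E.
Proof.
move=> mf1 mf2 mf3 c10 c20 c30 H1 H2 H3 A mA.
have [m12 H12] := product_measure_map mf1 mf2 c10 c20 H1 H2.
pose m' : {sigma_finite_measure set (T1 * T2)%type -> \bar R} :=
  HB.pack (product_measure1 m1 m2) (Measure_isSigmaFinite.Build _ _ _
    (product_measure1 m1 m2) (product_measure_sigma_finite m1 m2)).
exact: (product_measure_map (m1 := m') m12 mf3 (mulr_gt0 c10 c20) c30 H12 H3).2.
Qed.

Lemma product_measure_swap d (T : measurableType d) (R : realType)
    (m : {sigma_finite_measure set T -> \bar R}) (A : set (T * T)) :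
  measurable A -> (m \x m)%E (unstable.swap @^-1` A) = (m \x m)%E A.
Proof.
move=> mA; apply/esym.
pose m' := measure_function_pushforward__canonical__measure_function_Measure
    (m \x m)%E (@measurable_swap _ _ T T).
rewrite [LHS](@product_measure_unique _ _ _ _ _ m m m')//.
move=> B C mB mC; rewrite /m'/= /pushforward.
rewrite (_ : _ @^-1` _ = C `*` B); last by apply/seteqP; split => -[x y] [].
by rewrite product_measure1E// muleC.
Qed.

(** [steiner] acts on the last coordinate; [swap23] and [swap12] serve to bring the other axes
    there. *)
Definition swap23 T (p : T * T * T) : T * T * T := ((p.1.1, p.2), p.1.2).

Section product_swap_last.
Context d (T : measurableType d) (R : realType).
Variable m : {sigma_finite_measure set T -> \bar R}.

Lemma measurable_swap23 : measurable_fun setT (@swap23 T).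
Proof.
apply: measurable_fun_pair => /=; last first.
  exact: (measurableT_comp measurable_snd measurable_fst).
apply: measurable_fun_pair => /=; last exact: measurable_snd.
exact: (measurableT_comp measurable_fst measurable_fst).
Qed.

Let slice (A : set (T * T * T)) x : set (T * T) := [set q | A ((x, q.1), q.2)].

Let measurable_slice A x : measurable A -> measurable (slice A x).
Proof.
move=> mA.
have mf : measurable_fun setT (fun q : T * T => ((x, q.1), q.2)).
  apply: measurable_fun_pair => /=; last exact: measurable_snd.
  by apply: measurable_fun_pair => //; exact: measurable_fst.
by rewrite -[X in measurable X]setTI; exact: mf.
Qed.

Let product_measure_slice A : measurable A ->
  (m \x m \x m)%E A = (\int[m]_x (m \x m)%E (slice A x))%E.
Proof.
move=> mA; rewrite {1}/product_measure1 fubini_tonelli1//=.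
exact: measurable_fun_xsection.
Qed.

(** The triple product is nested to the left, so the last two factors do not form a product by
    themselves. Tonelli integrates over the first coordinate the areas of two-dimensional slices,
    where the ordinary swap applies. *)
Lemma product_measure_swap23 A : measurable A ->
  (m \x m \x m)%E (@swap23 T @^-1` A) = (m \x m \x m)%E A.
Proof.
move=> mA.
have mA' : measurable (@swap23 T @^-1` A).
  by rewrite -[X in measurable X]setTI; exact: measurable_swap23.
rewrite (product_measure_slice mA) (product_measure_slice mA').
apply: eq_integral => x _.
exact: (product_measure_swap m (measurable_slice x mA)).
Qed.

End product_swap_last.

Definition swap12 T (p : T * T * T) : T * T * T := ((p.1.2, p.1.1), p.2).

Lemma measurable_swap12 d (T : measurableType d) :
  measurable_fun setT (@swap12 T).
Proof.
apply: measurable_fun_pair => /=; last exact: measurable_snd.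
apply: measurable_fun_pair => /=; last first.
  exact: (measurableT_comp measurable_fst measurable_fst).
exact: (measurableT_comp measurable_snd measurable_fst).
Qed.

Lemma product_measure_swap12 d (T : measurableType d) (R : realType)
    (m : {sigma_finite_measure set T -> \bar R}) A : measurable A ->
  (m \x m \x m)%E (@swap12 T @^-1` A) = (m \x m \x m)%E A.
Proof.
move=> mA.
pose m' : {sigma_finite_measure set (T * T)%type -> \bar R} :=
  HB.pack (product_measure1 m m) (Measure_isSigmaFinite.Build _ _ _
    (product_measure1 m m) (product_measure_sigma_finite m m)).
have mid : measurable_fun setT (@id T) by [].
have hs (B : set (T * T)) : measurable B ->
    m' (unstable.swap @^-1` B) = (1%:E * m' B)%E.
  by move=> mB; rewrite mul1e; exact: product_measure_swap.
have hi (B : set T) : measurable B -> m (id @^-1` B) = (1%:E * m B)%E.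
  by rewrite mul1e.
have := (product_measure_map (m1 := m') (@measurable_swap _ _ T T) mid
  ltr01 ltr01 hs hi).2 A mA.
by rewrite mulr1 mul1e.
Qed.

Section steiner.
Context d (T : measurableType d) (R : realType).
Notation mR := (measurableTypeR R).
Notation leb := (@lebesgue_measure R).
Variable m : {measure set T -> \bar R}.

(** Each fibre becomes the open interval centred at 0 of the same length. By strictness a null fibre
    becomes empty, so a point over x always comes from a nonempty fibre of A. *)
Definition steiner (A : set (T * mR)) : set (T * mR) :=
  [set p | ((2 * `|p.2 : R|)%:E < leb (xsection A p.1))%E].

Lemma measurable_steiner A : measurable A -> measurable (steiner A).
Proof.
move=> mA; rewrite -[X in measurable X]setTI; apply: measurable_lte => //.
- apply/measurable_EFinP; apply: measurable_funM => //.
  apply: measurableT_comp => //; exact: measurable_snd.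
- apply: (measurableT_comp (measurable_fun_xsection _ mA)).
  exact: measurable_fst.
Qed.

Lemma lebesgue_measure_sym_itv (g : \bar R) : (0 <= g)%E ->
  leb [set z | ((2 * `|z|)%:E < g)%E] = g.
Proof.
case: g => [r|_|//]; last first.
  rewrite (_ : [set _ | _] = [set` Interval -oo%O +oo%O] :> set R).
    by rewrite lebesgue_measure_itv.
  by apply/seteqP; split => z //= _; rewrite ltry.
rewrite lee_fin => r0.
rewrite (_ : [set _ | _] = ball (0 : R) (r / 2)).
  rewrite lebesgue_measure_ball ?divr_ge0//; congr EFin.
  by rewrite mulr2n -splitr.
apply/seteqP; split => z; rewrite /ball/= sub0r normrN lte_fin.
  by rewrite mulrC ltr_pdivlMr.
by rewrite ltr_pdivlMr// mulrC.
Qed.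

Lemma steiner_measure A : measurable A ->
  (m \x leb)%E (steiner A) = (m \x leb)%E A.
Proof.
move=> mA; apply: eq_integral => x _ /=.
rewrite -[RHS]lebesgue_measure_sym_itv; last exact: measure_ge0.
by congr leb; apply/seteqP; split => z; rewrite /xsection/= inE.
Qed.

(** Otherwise sup B - inf C and sup C - inf B are both at most s + t; their sum is the total length
    of the convex hulls of B and C, which exceeds 2 s + 2 t. *)
Lemma lebesgue_far_points (B C : set R) (s t : R) :
  measurable B -> measurable C -> 0 <= s -> 0 <= t ->
  ((2 * s)%:E < leb B)%E -> ((2 * t)%:E < leb C)%E ->
  exists u v, [/\ B u, C v & s + t <= `|u - v|].
Proof.
move=> mB mC s0 t0 sB tC; apply: contrapT => H.
have near u v : B u -> C v -> `|u - v| < s + t.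
  move=> Bu Cv; rewrite ltNge; apply/negP => h; apply: H.
  by exists u, v.
have ne (D : set R) (r : R) : 0 <= r -> (r%:E < leb D)%E -> D !=set0.
  move=> r0 rD; apply/set0P/negP => /eqP D0; move: rD.
  by rewrite D0 measure0 lte_fin ltNge r0.
have [b Bb] := ne _ _ (mulr_ge0 (ler0n _ 2) s0) sB.
have [c Cc] := ne _ _ (mulr_ge0 (ler0n _ 2) t0) tC.
have bounds (D : set R) y : D !=set0 -> (forall x, D x -> `|x - y| < s + t) ->
    has_inf D /\ has_sup D.
  move=> D0 Dy; split; split => //.
    exists (y - (s + t)) => x /Dy; rewrite ltr_distl => /andP[/ltW + _] //.
  exists (y + (s + t)) => x /Dy; rewrite ltr_distl => /andP[_ /ltW].
  by rewrite addrC.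
have [iB sB'] : has_inf B /\ has_sup B.
  by apply: (bounds _ c); [exists b|move=> x Bx; exact: near].
have [iC sC'] : has_inf C /\ has_sup C.
  by apply: (bounds _ b); [exists c|move=> x Cx; rewrite distrC; exact: near].
have len (D : set R) : measurable D -> has_inf D -> has_sup D ->
    (leb D <= (sup D - inf D)%:E)%E.
  move=> mD iD sD.
  have DI : D `<=` `[inf D, sup D]%classic.
    move=> x Dx /=; rewrite in_itv/=; apply/andP; split.
    - by apply: inf_lbound => //; case: iD.
    - by apply: sup_ubound => //; case: sD.
  apply: (@le_trans _ _ (lebesgue_measure (`[inf D, sup D]%classic : set R))).
    by apply: le_measure; rewrite ?inE.
  rewrite lebesgue_measure_itv/= lte_fin; case: ifPn => //.
  rewrite -leNgt lee_fin => _; rewrite subr_ge0.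
  case: iD => -[x Dx] _; have := DI _ Dx.
  by rewrite /= in_itv/= => /andP[]; exact: le_trans.
have h1 : sup B - inf C <= s + t.
  rewrite lerBlDr; apply: ge_sup; first by exists b.
  move=> x Bx; rewrite addrC -lerBlDr; apply: lb_le_inf; first by exists c.
  move=> y Cy; have := near _ _ Bx Cy; rewrite ltr_distl => /andP[_ ].
  lra.
have h2 : sup C - inf B <= s + t.
  rewrite lerBlDr; apply: ge_sup; first by exists c.
  move=> x Cx; rewrite addrC -lerBlDr; apply: lb_le_inf; first by exists b.
  move=> y By; have := near _ _ By Cx; rewrite ltr_distl => /andP[+ _].
  lra.
have := lt_le_trans sB (len _ mB iB sB'); have := lt_le_trans tC (len _ mC iC sC').
by rewrite !lte_fin; lra.
Qed.

(** For points z and t of the new fibres, |z - t| <= |z| + |t|, and [lebesgue_far_points] finds two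
    points of the old fibres at least |z| + |t| apart. N stays arbitrary because only the last
    coordinate moves. *)
Lemma steiner_dist (N : T -> T -> R) (A : set (T * mR)) (D : R) :
  measurable A ->
  (forall p q, A p -> A q -> N p.1 q.1 + ((p.2 : R) - q.2) ^+ 2 <= D) ->
  forall p q, steiner A p -> steiner A q ->
    N p.1 q.1 + ((p.2 : R) - q.2) ^+ 2 <= D.
Proof.
move=> mA AD [x z] [y t] /= Sp Sq.
have [u [v [Au Av uv]]] := lebesgue_far_points (measurable_xsection x mA)
  (measurable_xsection y mA) (normr_ge0 _) (normr_ge0 _) Sp Sq.
move: Au Av; rewrite /xsection/= !inE => Au Av.
apply: le_trans (AD _ _ Au Av) => /=; rewrite lerD2l.
rewrite -(ger0_norm (sqr_ge0 (u - v))) -(ger0_norm (sqr_ge0 (z - t :> R))).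
rewrite !normrX lerXn2r ?nnegrE//.
by apply: le_trans uv; rewrite -(normrN t); exact: ler_normD.
Qed.

(** A symmetry gained along one axis survives the symmetrization along the next: it can only enlarge
    the fibre, hence its length. *)
Lemma steiner_invariant A (tau : T -> T) : measurable A ->
  (forall x z, A (x, z) -> A (tau x, z)) ->
  forall x z, steiner A (x, z) -> steiner A (tau x, z).
Proof.
move=> mA At x z /= H; apply: lt_le_trans H _; apply: le_measure.
- by rewrite inE; exact: measurable_xsection.
- by rewrite inE; exact: measurable_xsection.
- by move=> y; rewrite /xsection/= !inE; exact: At.
Qed.

Lemma steiner_opp A x z : steiner A (x, z) -> steiner A (x, - (z : R)).
Proof. by rewrite /steiner/= normrN. Qed.

End steiner.

(** Continuity is required on an open D only, as polar coordinates are continuous on [pdom] but not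
    everywhere. *)
Lemma bor_preimage (T U : ptopologicalType) (D : set (bor T)) (f : T -> U)
    (A : set (bor U)) :
  open D -> (forall x, D x -> {for x, continuous f}) ->
  measurable A -> measurable (D `&` f @^-1` A).
Proof.
move=> oD fD mA.
suff : <<s @open U >> `<=` [set B | measurable (D `&` f @^-1` B : set (bor T))].
  exact.
apply: smallest_sub => [|B oB].
  split => /=.
  - by rewrite preimage_set0 setI0; exact: measurable0.
  - move=> B mB; rewrite (_ : _ `&` _ = D `\` (D `&` f @^-1` B)).
      by apply: measurableD => //; exact: open_bor.
    apply/seteqP; split => x /=; first by move=> [Dx [_ nB]]; split => // -[].
    by move=> [Dx nB]; split => //; split => // Bx; apply: nB.
  - by move=> F mF; rewrite preimage_bigcup setI_bigcupr; exact: bigcup_measurable.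
apply: open_bor; rewrite openE => x [Dx Bx]; apply: filterI.
  by apply: open_nbhs_nbhs; split.
by apply: fD => //; apply: open_nbhs_nbhs; split.
Qed.

Lemma bor_preimageT (T U : ptopologicalType) (f : T -> U) (A : set (bor U)) :
  continuous f -> measurable A -> measurable (f @^-1` A : set (bor T)).
Proof.
move=> cf mA; rewrite -[X in measurable X]setTI.
by apply: (bor_preimage openT) => // x _; exact: cf.
Qed.

(** * Lebesgue measure on the Borel sets of R^3 *)

Section space.
Variable R : realType.
Notation mR := (measurableTypeR R).
Notation leb := (@lebesgue_measure R).

Local Notation E3 := (R * R * R)%type.
Definition prod_leb : set (mR * mR * mR)%type -> \bar R := (leb \x leb \x leb)%E.

Lemma lebesgue_affine (a b : R) (A : set mR) : 0 < a -> measurable A ->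
  leb ((fun x : mR => (a * x + b : mR)) @^-1` A) = ((a^-1)%:E * leb A)%E.
Proof.
move=> a0 mA; have mf : measurable_fun setT (fun x : mR => (a * x + b : mR)).
  by apply: measurable_funD => //; exact: measurable_funM.
have a0' : 0 <= a by exact: ltW.
pose m' := mscale (NngNum a0')
  (measure_function_pushforward__canonical__measure_function_Measure leb mf).
have -> : leb A = m' A.
  apply: (lebesgue_measure_unique (mu := m')) => // _ [[u v] _ <-].
  pose I : set R := `](u - b) / a, (v - b) / a]%classic.
  apply: (@etrans _ _ (a%:E * leb I)%E); last first.
    have -> : I = (fun x => a * x + b) @^-1` `]u, v]%classic; last by [].
    by apply/seteqP; split => x; rewrite /I /= !in_itv/= ltr_pdivrMr//
      ler_pdivlMr// ltrBlDr lerBrDr (mulrC x).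
  rewrite !lebesgue_measure_itv/= !lte_fin ltr_pM2r ?invr_gt0// ltrD2r.
  case: ifPn => _; last by rewrite mule0.
  by rewrite -EFinB -EFinM; congr EFin; field; rewrite gt_eqF.
by rewrite /m' /mscale/= muleA -EFinM mulVf ?mul1e// gt_eqF.
Qed.

Definition affine3 (a b : R * R * R) (p : E3) : E3 :=
  ((a.1.1 * p.1.1 + b.1.1, a.1.2 * p.1.2 + b.1.2), a.2 * p.2 + b.2).

Lemma prod_leb_affine (a b : R * R * R) (A : set (mR * mR * mR)) :
  0 < a.1.1 -> 0 < a.1.2 -> 0 < a.2 -> measurable A ->
  prod_leb (affine3 a b @^-1` A) =
    (((a.1.1 * a.1.2 * a.2)^-1)%:E * prod_leb A)%E.
Proof.
move=> a1 a2 a3 mA.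
have mf (c d : R) : measurable_fun setT (fun x : mR => (c * x + d : mR)).
  by apply: measurable_funD => //; exact: measurable_funM.
have i0 (c : R) : 0 < c -> 0 < c^-1 by rewrite invr_gt0.
have H (c d : R) : 0 < c -> forall A : set mR, measurable A ->
    leb ((fun x : mR => (c * x + d : mR)) @^-1` A) = ((c^-1)%:E * leb A)%E.
  by move=> c0 B mB; exact: lebesgue_affine.
have := product3_measure_map (mf a.1.1 b.1.1) (mf a.1.2 b.1.2) (mf a.2 b.2)
  (i0 _ a1) (i0 _ a2) (i0 _ a3) (H _ b.1.1 a1) (H _ b.1.2 a2) (H _ b.2 a3) mA.
by rewrite !invfM.
Qed.

(** * Grids of half-open cubes *)

Definition cell (s : R) (p : E3) : int * int * int :=
  ((Num.floor (p.1.1 / s), Num.floor (p.1.2 / s)), Num.floor (p.2 / s)).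

Definition cube (s : R) c : set E3 := [set p | cell s p = c].

Let slab (s : R) (k : int) : set mR := [set x | Num.floor (x / s) = k].

Let slabE s k : 0 < s -> slab s k = `[k%:~R * s, (k + 1)%:~R * s[%classic.
Proof.
move=> s0; apply/seteqP; split => x /=; rewrite in_itv/= -ler_pdivlMr// -ltr_pdivrMr//.
  by move=> <-; exact: floor_itv.
by move=> H; exact/floor_def.
Qed.

Let measurable_slab s k : 0 < s -> measurable (slab s k).
Proof. by move=> s0; rewrite slabE//; exact: measurable_itv. Qed.

Let lebesgue_slab s k : 0 < s -> leb (slab s k) = s%:E.
Proof.
move=> s0; rewrite slabE// lebesgue_measure_itv/= lte_fin ltr_pM2r// ltr_int.
rewrite ltzD1 lexx -EFinB; congr EFin.
by rewrite -mulrBl -intrB addrAC subrr add0r mul1r.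
Qed.

Let cubeE s c : cube s c = slab s c.1.1 `*` slab s c.1.2 `*` slab s c.2.
Proof.
case: c => -[i j] k; apply/seteqP; split => -[[x y] z] /=; first by case=> <- <- <-.
by rewrite /slab/cube/cell/= => -[[-> ->] ->].
Qed.

Lemma measurable_cube s c : 0 < s ->
  measurable (cube s c : set (mR * mR * mR)%type).
Proof.
move=> s0; rewrite cubeE; apply: measurableX; last exact: measurable_slab.
by apply: measurableX; exact: measurable_slab.
Qed.

Lemma prod_leb_box (A B C : set mR) :
  measurable A -> measurable B -> measurable C ->
  prod_leb (A `*` B `*` C) = (leb A * leb B * leb C)%E.
Proof.
move=> mA mB mC; rewrite /prod_leb product_measure1E//; last exact: measurableX.
by congr (_ * _)%E; exact: product_measure1E.
Qed.

Lemma prod_leb_cube s c : 0 < s -> prod_leb (cube s c) = (s ^+ 3)%:E.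
Proof.
move=> s0; rewrite cubeE prod_leb_box; try exact: measurable_slab.
by rewrite !lebesgue_slab// -!EFinM; congr EFin; rewrite !exprS expr0 mulr1 mulrA.
Qed.

Lemma cell_near s p q : 0 < s -> cell s p = cell s q ->
  [/\ `|p.1.1 - q.1.1| < s, `|p.1.2 - q.1.2| < s & `|p.2 - q.2| < s].
Proof.
move=> s0.
have H (x y : R) : Num.floor (x / s) = Num.floor (y / s) -> `|x - y| < s.
  move=> xy; have := floor_itv (x / s); have := floor_itv (y / s); rewrite xy.
  move: (Num.floor _) => k.
  rewrite intrD !ler_pdivlMr// !ltr_pdivrMr// mulrDl mul1r.
  by move=> /andP[h1 h2] /andP[h3 h4]; rewrite ltr_distl; apply/andP; split; lra.
by case=> h1 h2 h3; split; exact: H.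
Qed.

Definition grid_part (s : R) (W : set E3) : set E3 :=
  [set p | cube s (cell s p) `<=` W].

(** Enumerates the cubes of the grid inside W through the codes of their cells; a number that codes
    no such cube gives the empty set. *)
Definition nth_cube (s : R) (W : set E3) (k : nat) : set E3 :=
  [set p | pickle (cell s p) = k /\ grid_part s W p].

Lemma nth_cubeE s W k : nth_cube s W k = set0 \/
  exists2 c, nth_cube s W k = cube s c & nth_cube s W k `<=` W.
Proof.
have [[p [pk Wp]]|H] := pselect (exists p, nth_cube s W k p); last first.
  by left; rewrite -subset0 => p Hp; apply: H; exists p.
right; exists (cell s p).
  apply/seteqP; split => q /=.
    by move=> [qk _]; apply: (pcan_inj pickleK); rewrite qk pk.
  by move=> e; split; rewrite ?e// /grid_part/= e.
by move=> q [_ +]; apply.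
Qed.

Lemma grid_partE s W : grid_part s W = \bigcup_k nth_cube s W k.
Proof.
apply/seteqP; split => [p Wp|p [k _ []]//].
by exists (pickle (cell s p)).
Qed.

Lemma trivIset_nth_cube s W : trivIset setT (nth_cube s W).
Proof. by move=> i j _ _ [p [[<- _] [<- _]]]. Qed.

Lemma grid_part_sub s W : grid_part s W `<=` W.
Proof. by move=> p; exact. Qed.

Lemma measurable_nth_cube s W k : 0 < s ->
  measurable (nth_cube s W k : set (mR * mR * mR)%type).
Proof.
move=> s0; have [->|[c -> _]] := nth_cubeE s W k; first exact: measurable0.
exact: measurable_cube.
Qed.

Lemma measurable_grid_part s W : 0 < s ->
  measurable (grid_part s W : set (mR * mR * mR)%type).
Proof.
move=> s0; rewrite grid_partE; apply: bigcup_measurable => k _.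
exact: measurable_nth_cube.
Qed.

Definition dyad (m : nat) : R := (2 ^+ m)^-1.

Lemma dyad_gt0 m : 0 < dyad m.
Proof. by rewrite invr_gt0 exprn_gt0. Qed.

Lemma dyad_lt e : 0 < e -> exists m, dyad m < e.
Proof.
move=> e0; have [k ke] := ltr_add_invr e0; exists k.+1.
rewrite add0r in ke; apply: le_lt_trans ke.
rewrite /dyad lef_pV2 ?posrE ?exprn_gt0 ?ltr0n//.
by rewrite -natrX ler_nat ltnW// ltn_expl.
Qed.

Lemma dyad_le m n : (m <= n)%N -> dyad n <= dyad m.
Proof.
move=> mn; rewrite lef_pV2 ?posrE ?exprn_gt0//.
by apply: ler_weXn2l => //; rewrite ler1n.
Qed.

(** The dyadic grids are nested: the floor of z 2^m is the integer quotient by 2 of the floor of z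
    2^(m + 1). *)
Lemma cell_dyadS m p q : cell (dyad m.+1) p = cell (dyad m.+1) q ->
  cell (dyad m) p = cell (dyad m) q.
Proof.
have H (x y : R) : Num.floor (x / dyad m.+1) = Num.floor (y / dyad m.+1) ->
    Num.floor (x / dyad m) = Num.floor (y / dyad m).
  rewrite /dyad !invrK exprS => xy.
  have half (z : R) : Num.floor (z * 2 ^+ m) =
      (Num.floor (z * (2 * 2 ^+ m)) %/ 2)%Z.
    set k := Num.floor (z * (2 * 2 ^+ m)).
    have := floor_itv (z * (2 * 2 ^+ m)); rewrite -/k => /andP[k1 k2].
    have e : k = ((k %/ 2)%Z * 2 + (k %% 2)%Z)%R by exact: divz_eq.
    have e0 : (0 <= (k %% 2)%Z)%R by exact: modz_ge0.
    have e2 : ((k %% 2)%Z < 2)%R by exact: ltz_pmod.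
    have ek : (k%:~R : R) = (k %/ 2)%Z%:~R * 2 + (k %% 2)%Z%:~R.
      by rewrite {1}e intrD intrM.
    apply/floor_def; move: k1 k2; rewrite !intrD ek.
    have : (((k %% 2)%Z)%:~R : R) <= 1 by rewrite -[1]/(1%:~R) ler_int; lia.
    have : 0 <= (((k %% 2)%Z)%:~R : R) by rewrite -[0]/(0%:~R) ler_int.
    rewrite (_ : 1%:~R = 1 :> R)//.
    move: ((k %% 2)%Z%:~R) ((k %/ 2)%Z%:~R) (2 ^+ m) => r d t h1 h2 h3 h4.
    by apply/andP; split; lra.
  by rewrite !half xy.
by rewrite /cell; case=> /H -> /H -> /H ->.
Qed.

Lemma grid_part_dyad_mono W m n : (m <= n)%N ->
  grid_part (dyad m) W `<=` grid_part (dyad n) W.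
Proof.
move=> mn p Wp q qp; apply: Wp; move: qp; rewrite /cube/=.
rewrite -(subnK mn); elim: (n - m)%N => [//|k IH] h; apply: IH.
exact: cell_dyadS.
Qed.

Lemma ball_E3 (p q : E3) e : ball p e q <->
  [/\ `|p.1.1 - q.1.1| < e, `|p.1.2 - q.1.2| < e & `|p.2 - q.2| < e].
Proof. by split => [[[? ?] ?]|[? ? ?]]; do !split. Qed.

Lemma open_grid_part (W : set E3) p : open W -> W p ->
  exists m, grid_part (dyad m) W p.
Proof.
move=> oW Wp; have /nbhs_ballP[e /= e0 eW] : nbhs p W.
  by apply: open_nbhs_nbhs; split.
have [m me] := dyad_lt e0; exists m => q /= qp; apply: eW.
have [h1 h2 h3] := cell_near (dyad_gt0 m) (esym qp).
by apply/ball_E3; split; apply: lt_trans me.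
Qed.

(** Starting at generation n makes every cube as small as desired, as covers by sets of diameter at
    most delta require. *)
Lemma open_grid_partE (W : set E3) n : open W ->
  W = \bigcup_m grid_part (dyad (n + m)) W.
Proof.
move=> oW; apply/seteqP; split => [p Wp|p [m _]]; last exact: grid_part_sub.
have [m Hm] := open_grid_part oW Wp; exists m => //.
by apply: grid_part_dyad_mono Hm; rewrite leq_addl.
Qed.

Lemma open_prod_measurable (W : set E3) : open W ->
  measurable (W : set (mR * mR * mR)%type).
Proof.
move=> oW; rewrite (open_grid_partE 0 oW); apply: bigcup_measurable => m _.
exact: measurable_grid_part (dyad_gt0 _).
Qed.

(** Every open set is a countable union of cubes, and cubes are measurable rectangles. *)
Lemma borel_prod_measurable (W : set (bor E3)) : measurable W ->
  measurable (W : set (mR * mR * mR)%type).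
Proof.
have : <<s @open E3 >> `<=` [set W | measurable (W : set (mR * mR * mR)%type)].
  apply: smallest_sub; last by move=> U; exact: open_prod_measurable.
  split => /=; first exact: measurable0.
  - by move=> A; rewrite setTD; exact: measurableC.
  - by move=> F mF; apply: bigcup_measurable => k _; exact: mF.
exact.
Qed.

(** The product measure is transported to the sigma-algebra generated by the open sets, where
    preimages under continuous maps are measurable and the regularity results apply. *)
Definition lam (A : set (bor E3)) : \bar R := prod_leb A.

Let lam0 : lam set0 = 0%E. Proof. exact: measure0. Qed.
Let lam_ge0 A : (0 <= lam A)%E. Proof. exact: measure_ge0. Qed.
Let lam_sigma_additive : semi_sigma_additive lam.
Proof.
move=> F mF tF mUF; apply: measure_semi_sigma_additive => //.
- by move=> k; exact: borel_prod_measurable.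
- exact: borel_prod_measurable.
Qed.

HB.instance Definition _ :=
  isMeasure.Build _ _ _ lam lam0 lam_ge0 lam_sigma_additive.

End space.

Section volume.
Variable R : realType.
Notation mR := (measurableTypeR R).
Notation leb := (@lebesgue_measure R).
Local Notation E3 := (R * R * R)%type.
Local Notation lam := (@lam R).
Implicit Types p q : E3.

Lemma continuous_coord1 : continuous (fun p : E3 => p.1.1).
Proof. by move=> p; apply: cvg_comp; exact: cvg_fst. Qed.

Lemma continuous_coord2 : continuous (fun p : E3 => p.1.2).
Proof. by move=> p; apply: (@cvg_comp _ _ _ fst snd); [exact: cvg_fst|exact: cvg_snd]. Qed.

Lemma continuous_coord3 : continuous (fun p : E3 => p.2).
Proof. by move=> p; exact: cvg_snd. Qed.

Lemma continuous_triple (T : topologicalType) (f g h : T -> R) :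
  continuous f -> continuous g -> continuous h ->
  continuous (fun x => ((f x, g x), h x) : E3).
Proof.
move=> cf cg ch x.
apply: (@cvg_pair _ _ _ (nbhs x) (nbhs (f x, g x)) (nbhs (h x))); last exact: ch.
by apply: (@cvg_pair _ _ _ (nbhs x) (nbhs (f x)) (nbhs (g x))); [exact: cf|exact: cg].
Qed.

Lemma continuous_affine3 (a b : E3) : continuous (affine3 a b).
Proof.
by apply: continuous_triple => p; apply: cvgD; try exact: cvg_cst;
  apply: cvgMr; [exact: continuous_coord1|exact: continuous_coord2|
                 exact: continuous_coord3].
Qed.

Lemma lam_affine (a b : E3) (A : set (bor E3)) :
  0 < a.1.1 -> 0 < a.1.2 -> 0 < a.2 -> measurable A ->
  lam (affine3 a b @^-1` A) = (((a.1.1 * a.1.2 * a.2)^-1)%:E * lam A)%E.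
Proof.
by move=> a1 a2 a3 mA; apply: prod_leb_affine => //; exact: borel_prod_measurable.
Qed.

Definition normsq p := p.1.1 ^+ 2 + p.1.2 ^+ 2 + p.2 ^+ 2.

Definition distsq p q :=
  (p.1.1 - q.1.1) ^+ 2 + (p.1.2 - q.1.2) ^+ 2 + (p.2 - q.2) ^+ 2.

Definition cball (D : R) : set E3 := [set p | normsq p <= D].

Lemma continuous_normsq : continuous normsq.
Proof.
move=> p; apply: cvgD; [apply: cvgD|]; rewrite expr2.
- by under eq_fun do rewrite expr2; apply: cvgM; exact: continuous_coord1.
- by under eq_fun do rewrite expr2; apply: cvgM; exact: continuous_coord2.
- by under eq_fun do rewrite expr2; apply: cvgM; exact: continuous_coord3.
Qed.

Lemma closed_cball D : closed (cball D).
Proof.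
rewrite (_ : cball D = normsq @^-1` [set x | x <= D])//.
by apply: closed_comp; [move=> p _; exact: continuous_normsq|exact: closed_le].
Qed.

Lemma measurable_cball D : measurable (cball D : set (bor E3)).
Proof. by apply: closed_bor; exact: closed_cball. Qed.

Lemma cball_bound D p : 0 <= D -> cball (D ^+ 2) p ->
  [/\ `|p.1.1| <= D, `|p.1.2| <= D & `|p.2| <= D].
Proof.
move=> D0; rewrite /cball/= /normsq => h.
by split; rewrite -(ler_pXn2r (n := 2)) ?nnegrE// -normrX ger0_norm ?sqr_ge0//;
  apply: le_trans h; rewrite ?lerDr ?addr_ge0 ?sqr_ge0// -addrA ?lerDl
    ?addr_ge0 ?sqr_ge0// addrCA lerDl addr_ge0 ?sqr_ge0.
Qed.

Lemma lam_box (A B C : set mR) :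
  measurable A -> measurable B -> measurable C ->
  lam (A `*` B `*` C : set E3) = (leb A * leb B * leb C)%E.
Proof. exact: prod_leb_box. Qed.

Lemma lam_cball_fin D : (lam (cball D) < +oo)%E.
Proof.
have [K K0 DK] : exists2 K : R, 0 <= K & D <= K ^+ 2.
  exists (`|D| + 1) => //.
  rewrite sqrrD mulr1 expr1n; apply: (le_trans (ler_norm D)).
  have := sqr_ge0 `|D|; have := normr_ge0 D; rewrite mulr2n; lra.
have mI : measurable (`[- K, K]%classic : set mR) by exact: measurable_itv.
apply: (@le_lt_trans _ _ (prod_leb (`[- K, K]%classic `*` `[- K, K]%classic
    `*` `[- K, K]%classic))).
  rewrite /lam /prod_leb; apply: (le_measure (leb \x leb \x leb)%E); rewrite ?inE.
  - by apply: (@borel_prod_measurable R); exact: measurable_cball.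
  - by apply: measurableX => //; exact: measurableX.
  - move=> p pD; have [] := @cball_bound K p K0; first exact: le_trans DK.
    by rewrite !ler_norml => h1 h2 h3; do !split; rewrite /= in_itv.
rewrite prod_leb_box//.
have -> : leb `[- K, K]%classic = (K + K)%:E.
  rewrite lebesgue_measure_itv/= lte_fin; case: ifPn => h.
    by rewrite -EFinB opprK.
  by congr EFin; lra.
by rewrite -!EFinM ltry.
Qed.

(* Volume of the unit ball; its value 4 pi / 3 is never needed, since Hausdorff
   measure only enters through the ratio [hratio]. *)
Definition vball : R := fine (lam (cball 1)).

Lemma lam_cball1 : lam (cball 1) = vball%:E.
Proof. by rewrite fineK// ge0_fin_numE// lam_cball_fin. Qed.

Lemma lam_cube s c : 0 < s -> lam (cube s c) = (s ^+ 3)%:E.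
Proof. exact: prod_leb_cube. Qed.

Lemma measurable_bor_cube s c : 0 < s -> measurable (cube s c : set (bor E3)).
Proof.
move=> s0.
have itvE (k : int) (x : R) : Num.floor (x / s) = k <->
    (k%:~R * s <= x) /\ (x < (k + 1)%:~R * s).
  rewrite -ler_pdivlMr// -ltr_pdivrMr//; split.
    by move=> <-; have /andP[] := floor_itv (x / s).
  by move=> [h1 h2]; apply/floor_def/andP.
have mc (f : E3 -> R) (k : int) : continuous f ->
    measurable ([set p | Num.floor (f p / s) = k] : set (bor E3)).
  move=> cf; rewrite (_ : [set _ | _] =
      ([set p | k%:~R * s <= f p] `&` ~` [set p | (k + 1)%:~R * s <= f p])).
    apply: measurableI; last apply: measurableC.
    - apply: closed_bor; apply: (@closed_comp _ _ f [set x | _ <= x]);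
        [by move=> p _; exact: cf|exact: closed_ge].
    - apply: closed_bor; apply: (@closed_comp _ _ f [set x | _ <= x]);
        [by move=> p _; exact: cf|exact: closed_ge].
  apply/seteqP; split => p /=.
    by move/itvE => [h1 h2]; split => //; apply/negP; rewrite -ltNge.
  by move=> [h1 /negP]; rewrite -ltNge => h2; apply/itvE.
rewrite (_ : cube s c = [set p | Num.floor (p.1.1 / s) = c.1.1] `&`
    [set p | Num.floor (p.1.2 / s) = c.1.2] `&`
    [set p | Num.floor (p.2 / s) = c.2]).
  apply: measurableI; [apply: measurableI|]; apply: mc.
  - exact: continuous_coord1.
  - exact: continuous_coord2.
  - exact: continuous_coord3.
case: c => -[i j] k; apply/seteqP; split => p /=; first by case=> <- <- <-.
by rewrite /cube/cell/= => -[[-> ->] ->].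
Qed.

Lemma vball_gt0 : 0 < vball.
Proof.
rewrite -lte_fin -lam_cball1.
apply: (@lt_le_trans _ _ (lam (cube 2^-1 (0, 0, 0)))).
  by rewrite lam_cube ?invr_gt0// lte_fin exprn_gt0// invr_gt0.
apply: le_measure; rewrite ?inE.
- by apply: measurable_bor_cube; rewrite invr_gt0.
- exact: measurable_cball.
- move=> p pc; have i20 : (0 : R) < 2^-1 by rewrite invr_gt0.
  have : cell 2^-1 p = cell 2^-1 (((0, 0), 0) : E3).
    rewrite [LHS]pc /cell/= !mul0r; congr ((_, _), _); apply/esym/floor_def; lra.
  move=> /(cell_near i20)[]; rewrite !subr0 /cball/= /normsq.
  rewrite !ltr_norml => /andP[h1 h2] /andP[h3 h4] /andP[h5 h6].
  by nra.
Qed.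

Lemma lam_cball r : 0 < r -> lam (cball (r ^+ 2)) = (vball * r ^+ 3)%:E.
Proof.
move=> r0; have ri : 0 < r^-1 by rewrite invr_gt0.
rewrite (_ : cball (r ^+ 2) = affine3 ((r^-1, r^-1), r^-1) ((0, 0), 0) @^-1` cball 1).
  rewrite lam_affine//=; last exact: measurable_cball.
  rewrite lam_cball1 -EFinM; congr EFin; rewrite !invfM !invrK.
  by rewrite !exprS expr0 mulr1 mulrA mulrC.
apply/seteqP; split => p; rewrite /cball/affine3/normsq/= !addr0 !exprMn -!mulrDr
  exprVn mulrC ler_pdivrMr ?exprn_gt0// mul1r//.
Qed.

Lemma cball_sub D E : D <= E -> cball D `<=` cball E.
Proof. by move=> DE p; rewrite /cball/=; move=> h; exact: le_trans DE. Qed.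

(** Settles the isodiametric inequality for diameter 0, which the scaling formula for balls does not
    reach. *)
Lemma lam_cball0 : lam (cball 0) = 0%E.
Proof.
apply/eqP; rewrite eq_le measure_ge0 andbT; apply/lee_addgt0Pr => e e0.
rewrite add0e; pose r := Num.min 1 (e / vball).
have r0 : 0 < r by rewrite lt_min ltr01 divr_gt0// vball_gt0.
apply: (@le_trans _ _ (lam (cball (r ^+ 2)))).
  apply: le_measure; rewrite ?inE; try exact: measurable_cball.
  by apply: cball_sub; exact: sqr_ge0.
rewrite lam_cball// lee_fin mulrC -ler_pdivlMr ?vball_gt0//.
apply: (@le_trans _ _ r); last by rewrite ge_min lexx orbT.
by rewrite ler_iXnr ?(ltW r0) ?ge_min ?lexx.
Qed.

(* Steiner symmetrization along the three axes makes A centrally symmetric, hence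
   contained in the centred ball of diameter d. *)
Lemma isodiametric (A : set (bor E3)) (d : R) : measurable A -> 0 <= d ->
  (forall p q, A p -> A q -> distsq p q <= d ^+ 2) ->
  (lam A <= (vball * (d / 2) ^+ 3)%:E)%E.
Proof.
move=> /borel_prod_measurable mA d0 Ad.
pose A1 := steiner (A : set (mR * mR * mR)%type).
have mA1 : measurable A1 by exact: measurable_steiner.
(* Each swap moves the next axis into last place: points of [B1] and [A2] are read as (x, z, y),
   those of [B2] and [A3] as (z, y, x). Squared norms and distances do not see the order. *)
pose B1 := @swap23 mR @^-1` A1.
have mB1 : measurable B1.
  by rewrite -[X in measurable X]setTI; exact: measurable_swap23.
pose A2 := steiner B1.
have mA2 : measurable A2 by exact: measurable_steiner.
pose C2 := @swap12 mR @^-1` A2.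
have mC2 : measurable C2.
  by rewrite -[X in measurable X]setTI; exact: measurable_swap12.
pose B2 := @swap23 mR @^-1` C2.
have mB2 : measurable B2.
  by rewrite -[X in measurable X]setTI; exact: measurable_swap23.
pose A3 := steiner B2.
have mA3 : measurable A3 by exact: measurable_steiner.
have -> : lam A = prod_leb A3.
  have e1 : prod_leb A1 = prod_leb A := steiner_measure (leb \x leb)%E mA.
  have e2 : prod_leb B1 = prod_leb A1 := product_measure_swap23 leb mA1.
  have e3 : prod_leb A2 = prod_leb B1 := steiner_measure (leb \x leb)%E mB1.
  have e4 : prod_leb C2 = prod_leb A2 := product_measure_swap12 leb mA2.
  have e5 : prod_leb B2 = prod_leb C2 := product_measure_swap23 leb mC2.
  have e6 : prod_leb A3 = prod_leb B2 := steiner_measure (leb \x leb)%E mB2.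
  by rewrite e6 e5 e4 e3 e2 e1.
pose N (x y : mR * mR) := ((x.1 : R) - y.1) ^+ 2 + ((x.2 : R) - y.2) ^+ 2.
have d1 := @steiner_dist _ _ _ N A (d ^+ 2) mA Ad.
have d2 : forall p q, A2 p -> A2 q -> N p.1 q.1 + ((p.2 : R) - q.2) ^+ 2 <= d ^+ 2.
  apply: (steiner_dist mB1) => p q Ap Aq.
  by have := d1 (swap23 p) (swap23 q) Ap Aq; rewrite /N/= addrAC.
have d3 : forall p q, A3 p -> A3 q -> N p.1 q.1 + ((p.2 : R) - q.2) ^+ 2 <= d ^+ 2.
  apply: (steiner_dist mB2) => p q Ap Aq.
  have := d2 (swap12 (swap23 p)) (swap12 (swap23 q)) Ap Aq.
  by rewrite /N/= -addrA addrC.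
have s1 x y z : A1 (x, y, z) -> A1 (x, y, - (z : R)) by exact: steiner_opp.
have s2 x y z : A2 (x, y, z) -> A2 (x, - (y : R), - (z : R)).
  pose tau (p : mR * mR) : mR * mR := (p.1, - (p.2 : R) : mR).
  have H (p : mR * mR) (c : mR) : B1 (p, c) -> B1 (tau p, c).
    by case: p => a b; exact: s1.
  by move=> h; apply: steiner_opp; exact: (steiner_invariant mB1 H h).
have s3 x y z : A3 (x, y, z) -> A3 (- (x : R), - (y : R), - (z : R)).
  pose tau (p : mR * mR) : mR * mR := (- (p.1 : R) : mR, - (p.2 : R) : mR).
  have H (p : mR * mR) (c : mR) : B2 (p, c) -> B2 (tau p, c).
    by case: p => a b; exact: s2.
  by move=> h; apply: steiner_opp; exact: (steiner_invariant mB2 H h).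
apply: (@le_trans _ _ (prod_leb (cball ((d / 2) ^+ 2)))).
  rewrite /prod_leb; apply: (le_measure (leb \x leb \x leb)%E); rewrite ?inE//.
    by apply: (@borel_prod_measurable R); exact: measurable_cball.
  move=> [[x y] z] h; have := d3 _ _ h (s3 _ _ _ h).
  rewrite /cball/normsq/N/= !opprK exprMn exprVn -[_ ^+ 2 * _]/(_ / _).
  by rewrite ler_pdivlMr//; nra.
move: d0; rewrite le_eqVlt => /predU1P[<-|d0].
  rewrite mul0r expr0n/= expr0n/= mulr0.
  by rewrite [leLHS]lam_cball0.
by rewrite [leLHS]lam_cball ?divr_gt0.
Qed.

Lemma lam_plane2 c : lam [set p | p.1.2 = c] = 0%E.
Proof.
rewrite (_ : [set p | _] = setT `*` [set c] `*` setT).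
  by rewrite lam_box// lebesgue_measure_set1 mule0 mul0e.
by apply/seteqP; split => -[[x y] z] //= [[]].
Qed.

Lemma lam_plane3 c : lam [set p | p.2 = c] = 0%E.
Proof.
rewrite (_ : [set p | _] = setT `*` setT `*` [set c]).
  by rewrite lam_box// lebesgue_measure_set1 mule0.
by apply/seteqP; split => -[[x y] z] //= [].
Qed.

End volume.

(** * Hausdorff measure *)

Section euclidean_norm.
Variable R : realType.

Lemma enorm_ge0 n (x : 'rV[R]_n) : 0 <= enorm x.
Proof. exact: sqrtr_ge0. Qed.

Lemma enorm_sqr n (x : 'rV[R]_n) : enorm x ^+ 2 = \sum_i x 0 i ^+ 2.
Proof. by rewrite sqr_sqrtr// sumr_ge0// => i _; exact: sqr_ge0. Qed.

Lemma enorm_le n (x : 'rV[R]_n) d : 0 <= d -> (enorm x <= d) = (enorm x ^+ 2 <= d ^+ 2).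
Proof. by move=> d0; rewrite ler_pXn2r ?nnegrE// enorm_ge0. Qed.

Lemma enorm0 n : enorm (0 : 'rV[R]_n) = 0.
Proof. by rewrite /enorm big1 ?sqrtr0// => i _; rewrite mxE expr0n. Qed.

Lemma enormN n (x : 'rV[R]_n) : enorm (- x) = enorm x.
Proof. by congr Num.sqrt; apply: eq_bigr => i _; rewrite mxE sqrrN. Qed.

Lemma enorm_distC n (x y : 'rV[R]_n) : enorm (x - y) = enorm (y - x).
Proof. by rewrite -enormN opprB. Qed.

Lemma enorm_coord n (x : 'rV[R]_n) i : `|x 0 i| <= enorm x.
Proof.
rewrite -sqrtr_sqr ler_wsqrtr// (bigD1 i)//= lerDl sumr_ge0// => j _.
exact: sqr_ge0.
Qed.

Lemma continuous_enorm_sqr n : continuous (fun x : 'rV[R]_n => \sum_i x 0 i ^+ 2).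
Proof.
apply: (@continuous_big _ _ _ _ _ (@add_continuous R)) => i _ x.
apply: (@continuous_comp _ _ _ (fun M : 'rV[R]_n => M 0 i) (fun z : R => z ^+ 2)).
  exact: coord_continuous.
exact: exprn_continuous.
Qed.

Lemma continuous_enorm n : continuous (@enorm R n).
Proof.
move=> x; apply: (@continuous_comp _ _ _ _ Num.sqrt).
  exact: continuous_enorm_sqr.
exact: sqrt_continuous.
Qed.

Lemma closed_eball n (x : 'rV[R]_n) r : closed (eball x r).
Proof.
rewrite (_ : eball x r = (fun y => enorm (y - x)) @^-1` [set z | z <= r])//.
apply: closed_comp; last exact: closed_le.
have cf : continuous (fun y : 'rV[R]_n => enorm (y - x)).
  move=> y; apply: (@continuous_comp _ _ _ (fun y : 'rV[R]_n => y - x) (@enorm R n)).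
    apply: (@continuousB _ _ _ (fun z : 'rV[R]_n => z) (fun=> x)).
      by move=> A.
    exact: cst_continuous.
  exact: continuous_enorm.
by move=> y _; exact: cf.
Qed.

End euclidean_norm.

Section diameter.
Variables (R : realType) (n : nat).
Implicit Types (A B : set 'rV[R]_n) (x y : 'rV[R]_n) (d : R).

Lemma ediam_ge0 A : (0 <= ediam A)%E.
Proof. by apply: ereal_sup_ubound; left. Qed.

Lemma ediam_dist A x y : A x -> A y -> ((enorm (x - y))%:E <= ediam A)%E.
Proof. by move=> Ax Ay; apply: ereal_sup_ubound; right; exists (x, y). Qed.

Lemma ediam_le A d : 0 <= d -> (forall x y, A x -> A y -> enorm (x - y) <= d) ->
  (ediam A <= d%:E)%E.
Proof.
move=> d0 Ad; apply: ge_ereal_sup => _ [->|[[x y] [/= Ax Ay] <-]].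
  by rewrite lee_fin.
by rewrite lee_fin; exact: Ad.
Qed.

Lemma ediam_fin A d : (ediam A <= d%:E)%E -> ediam A = (fine (ediam A))%:E.
Proof.
by move=> Ad; rewrite fineK// ge0_fin_numE ?ediam_ge0//; exact: le_lt_trans (ltry d).
Qed.

Lemma ediam_distP A d x y : (ediam A <= d%:E)%E -> A x -> A y ->
  enorm (x - y) <= fine (ediam A).
Proof.
by move=> Ad Ax Ay; rewrite -lee_fin -(ediam_fin Ad); exact: ediam_dist.
Qed.

Lemma fine_ediam_ge0 A : 0 <= fine (ediam A).
Proof. exact: fine_ge0 (ediam_ge0 A). Qed.

Lemma fine_ediam_le A d : (ediam A <= d%:E)%E -> fine (ediam A) <= d.
Proof. by move=> Ad; rewrite -lee_fin -(ediam_fin Ad). Qed.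

Lemma ediam0 : ediam (set0 : set 'rV[R]_n) = 0%E.
Proof. by apply/eqP; rewrite eq_le ediam_ge0 andbT; apply: ediam_le. Qed.

(** Covers can thus be replaced by closed ones, whose preimages are Borel, at no cost in
    diameter. *)
Lemma ediam_closure A d : (ediam A <= d%:E)%E -> ediam (closure A) = ediam A.
Proof.
move=> Ad; apply/eqP; rewrite eq_le; apply/andP; split; last first.
  apply: ereal_sup_le => _ [->|[[x y] [/= Ax Ay] <-]]; first by left.
  by right; exists (x, y) => //; split => /=; exact: subset_closure.
rewrite [leRHS](ediam_fin Ad); apply: ediam_le; first exact: fine_ediam_ge0.
have step x : A `<=` eball x (fine (ediam A)) ->
    closure A `<=` eball x (fine (ediam A)).
  by move=> h; rewrite [X in _ `<=` X](closure_id _).1;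
    [exact: closure_subset|exact: closed_eball].
move=> x y cx cy; apply: (step y) cx => z Az; rewrite /eball/= enorm_distC.
by apply: (step z) cy => t At; exact: ediam_distP Ad At Az.
Qed.

Definition bvol : R := 4 * pi / 3.

Lemma bvol_gt0 : 0 < bvol.
Proof. by rewrite /bvol divr_gt0// mulr_gt0// pi_gt0. Qed.

Definition dvol A : \bar R := (bvol * (fine (ediam A) / 2) ^+ 3)%:E.

Lemma dvol_ge0 A : (0 <= dvol A)%E.
Proof.
by rewrite lee_fin mulr_ge0 ?(ltW bvol_gt0)// exprn_ge0// divr_ge0// fine_ediam_ge0.
Qed.

Lemma dvol0 : dvol set0 = 0%E.
Proof. by rewrite /dvol ediam0/= mul0r expr0n mulr0. Qed.

Lemma dvol_le A d : (ediam A <= d%:E)%E -> (dvol A <= (bvol * (d / 2) ^+ 3)%:E)%E.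
Proof.
move=> Ad; have d0 : 0 <= d by rewrite -lee_fin; exact: le_trans (ediam_ge0 A) Ad.
rewrite lee_fin ler_pM2l ?bvol_gt0// lerXn2r ?nnegrE ?divr_ge0 ?fine_ediam_ge0//.
by rewrite ler_pM2r ?invr_gt0// fine_ediam_le.
Qed.

End diameter.

Section hausdorff_measure.
Variables (R : realType) (n : nat).
Implicit Types (A B : set 'rV[R]_n) (d : R).

Lemma hausdorff3_pre_le d A (F : (set 'rV[R]_n)^nat) :
  (forall k, (ediam (F k) <= d%:E)%E) -> A `<=` \bigcup_k F k ->
  (hausdorff3_pre d A <= \sum_(0 <= k <oo) dvol (F k))%E.
Proof. by move=> Fd AF; apply: ereal_inf_lbound; exists F. Qed.

Lemma hausdorff3_pre_ge d A (m : \bar R) :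
  (forall F : (set 'rV[R]_n)^nat, (forall k, (ediam (F k) <= d%:E)%E) ->
    A `<=` \bigcup_k F k -> (m <= \sum_(0 <= k <oo) dvol (F k))%E) ->
  (m <= hausdorff3_pre d A)%E.
Proof. by move=> H; apply: le_ereal_inf_tmp => _ [F [Fd AF] <-]; exact: H. Qed.

Lemma hausdorff3_pre_ge0 d A : (0 <= hausdorff3_pre d A)%E.
Proof. by apply: hausdorff3_pre_ge => F _ _; apply: nneseries_ge0 => k _ _; exact: dvol_ge0. Qed.

Lemma hausdorff3_pre_mono d A B : A `<=` B ->
  (hausdorff3_pre d A <= hausdorff3_pre d B)%E.
Proof.
move=> AB; apply: hausdorff3_pre_ge => F Fd BF.
by apply: hausdorff3_pre_le => //; exact: subset_trans BF.
Qed.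

Lemma hausdorff3_pre_le_hausdorff3 d A : 0 < d ->
  (hausdorff3_pre d A <= hausdorff3 A)%E.
Proof. by move=> d0; apply: ereal_sup_ubound; exists d. Qed.

Lemma hausdorff3_le A (m : \bar R) :
  (forall d, 0 < d -> (hausdorff3_pre d A <= m)%E) -> (hausdorff3 A <= m)%E.
Proof. by move=> H; apply: ge_ereal_sup => _ [d d0 <-]; exact: H. Qed.

Lemma hausdorff3_ge0 A : (0 <= hausdorff3 A)%E.
Proof.
exact: le_trans (hausdorff3_pre_ge0 1 A) (hausdorff3_pre_le_hausdorff3 A ltr01).
Qed.

Lemma hausdorff3_mono A B : A `<=` B -> (hausdorff3 A <= hausdorff3 B)%E.
Proof.
move=> AB; apply: hausdorff3_le => d d0.
apply: le_trans (hausdorff3_pre_mono d AB) _.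
exact: hausdorff3_pre_le_hausdorff3.
Qed.

Lemma hausdorff3_pre_bigcup d (A : (set 'rV[R]_n)^nat) :
  (hausdorff3_pre d (\bigcup_k A k) <= \sum_(0 <= k <oo) hausdorff3_pre d (A k))%E.
Proof.
have [[i]|] := pselect (exists i, hausdorff3_pre d (A i) = +oo%E).
  move=> Ai; rewrite (@eseries_pinfty _ _ xpredT i)// ?leey// => k _.
  by rewrite gt_eqF// (lt_le_trans _ (hausdorff3_pre_ge0 d (A k))) ?ltNy0.
move/forallNP => Afin; apply/lee_addgt0Pr => e e0.
apply: le_trans (epsilon_trick xpredT (fun k => hausdorff3_pre_ge0 d (A k)) (ltW e0)).
have /choice[F HF] : forall k, exists F : (set 'rV[R]_n)^nat,
    [/\ forall j, (ediam (F j) <= d%:E)%E, A k `<=` \bigcup_j F j &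
     (\sum_(0 <= j <oo) dvol (F j) <=
        hausdorff3_pre d (A k) + (e / (2 ^ k.+1)%:R)%:E)%E].
  move=> k; have ek : 0 < e / (2 ^ k.+1)%:R by rewrite divr_gt0.
  have fk : hausdorff3_pre d (A k) \is a fin_num.
    by rewrite ge0_fin_numE ?hausdorff3_pre_ge0// ltey; exact/eqP.
  have [_ [F [Fd AF] <-] h] := lb_ereal_inf_adherent ek fk.
  by exists F; split => //; exact: ltW.
have /card_esym/ppcard_eqP[f] := card_nat2.
apply: (@le_trans _ _ (\sum_(0 <= i <oo) dvol (F (f i).1 (f i).2))%E).
  apply: hausdorff3_pre_le => [i|x [k _ Akx]]; first by case: (HF (f i).1).
  have [_ AF _] := HF k; have [j _ Fx] := AF _ Akx.
  by exists (f^-1%FUN (k, j)) => //=; rewrite invK ?inE.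
apply: (@le_trans _ _ (\sum_(0 <= k <oo) \sum_(0 <= j <oo) dvol (F k j))%E); last first.
  by apply: lee_nneseries => [k _ _|k _]; [apply: nneseries_ge0 => j _ _; exact: dvol_ge0|case: (HF k)].
rewrite nneseries_esumT; last by move=> i; exact: dvol_ge0.
rewrite -(@reindex_esum _ _ _ setT setT f (fun l => dvol (F l.1 l.2)))//.
rewrite (_ : [set: nat * nat] = setT `*`` (fun=> setT)); last by apply/seteqP; split.
rewrite -(@esum_esum _ _ _ _ _ (fun i j => dvol (F i j))); last by move=> *; exact: dvol_ge0.
rewrite nneseries_esumT; last by move=> i; apply: nneseries_ge0 => j _ _; exact: dvol_ge0.
apply: le_esum => k _; rewrite nneseries_esumT// => j; exact: dvol_ge0.
Qed.

Lemma hausdorff3_bigcup (A : (set 'rV[R]_n)^nat) :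
  (hausdorff3 (\bigcup_k A k) <= \sum_(0 <= k <oo) hausdorff3 (A k))%E.
Proof.
apply: hausdorff3_le => d d0; apply: le_trans (hausdorff3_pre_bigcup d A) _.
apply: lee_nneseries => [k _ _|k _]; first exact: hausdorff3_pre_ge0.
exact: hausdorff3_pre_le_hausdorff3.
Qed.

Lemma hausdorff3_pre_set0 d : 0 <= d -> hausdorff3_pre d (set0 : set 'rV[R]_n) = 0%E.
Proof.
move=> d0; apply/eqP; rewrite eq_le hausdorff3_pre_ge0 andbT.
apply: le_trans (@hausdorff3_pre_le d set0 (fun=> set0) _ _) _ => //.
  by move=> k; rewrite ediam0 lee_fin.
by rewrite eseries0// => k _ _; exact: dvol0.
Qed.

Lemma hausdorff3_set0 : hausdorff3 (set0 : set 'rV[R]_n) = 0%E.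
Proof.
apply/eqP; rewrite eq_le hausdorff3_ge0 andbT; apply: hausdorff3_le => d d0.
by rewrite hausdorff3_pre_set0// ltW.
Qed.

Lemma hausdorff3_pre_setU d A B : 0 <= d ->
  (hausdorff3_pre d (A `|` B) <= hausdorff3_pre d A + hausdorff3_pre d B)%E.
Proof.
move=> d0; rewrite -bigcup2E; apply: le_trans (hausdorff3_pre_bigcup d _) _.
rewrite (nneseries_split 0 2); last by move=> k _; exact: hausdorff3_pre_ge0.
rewrite add0n big_mkord !big_ord_recl big_ord0 /= adde0.
rewrite eseries0 ?adde0//= => -[//|[//|k]] _ _ /=.
exact: hausdorff3_pre_set0.
Qed.

Lemma hausdorff3_setU A B :
  (hausdorff3 (A `|` B) <= hausdorff3 A + hausdorff3 B)%E.
Proof.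
apply: hausdorff3_le => d d0; apply: le_trans (hausdorff3_pre_setU A B (ltW d0)) _.
by apply: leeD; exact: hausdorff3_pre_le_hausdorff3.
Qed.

Lemma hausdorff3_pre_small d A : 0 <= d -> (ediam A <= d%:E)%E ->
  (hausdorff3_pre d A <= dvol A)%E.
Proof.
move=> d0 Ad; pose F k : set 'rV[R]_n := if k is 0%N then A else set0.
apply: le_trans (@hausdorff3_pre_le d A F _ _) _.
- by case=> [|k]//=; rewrite ediam0 lee_fin.
- by move=> x Ax; exists 0%N.
rewrite (nneseries_split 0 1); last by move=> k _; exact: dvol_ge0.
rewrite add0n big_mkord big_ord_recl big_ord0 /= adde0.
by rewrite eseries0 ?adde0//= => -[//|k] _ _; exact: dvol0.
Qed.

(** Any cover may be closed up without changing its cost, so m has to be countably subadditive only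
    for closed covers of A. This suits a set function built from volumes of preimages, which is
    controlled on measurable sets only. *)
Lemma mass_distribution_principle (m : set 'rV[R]_n -> \bar R) (d c : R) A :
  0 < d -> 0 < c ->
  (forall F : (set 'rV[R]_n)^nat, (forall k, closed (F k)) ->
     A `<=` \bigcup_k F k -> (m A <= \sum_(0 <= k <oo) m (F k))%E) ->
  (forall F, 0 <= m F)%E ->
  (forall F, closed F -> (ediam F <= d%:E)%E -> (m F <= c%:E * dvol F)%E) ->
  (m A <= c%:E * hausdorff3 A)%E.
Proof.
move=> d0 c0 msub m0 mF.
apply: (@le_trans _ _ (c%:E * hausdorff3_pre d A)%E); last first.
  apply: lee_wpmul2l; [by rewrite lee_fin ltW|exact: hausdorff3_pre_le_hausdorff3].
rewrite muleC -lee_pdivrMr//; apply: hausdorff3_pre_ge => F Fd AF.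
rewrite lee_pdivrMr// muleC -nneseriesZl; last by move=> k _; exact: dvol_ge0.
have AF' : A `<=` \bigcup_k closure (F k).
  by apply: subset_trans AF _; apply: subset_bigcup => k _; exact: subset_closure.
apply: le_trans (msub _ (fun k => @closed_closure _ (F k)) AF') _.
apply: lee_nneseries => // k _; apply: le_trans (mF _ (@closed_closure _ _) _) _.
  by rewrite (ediam_closure (Fd k)).
by rewrite /dvol (ediam_closure (Fd k)).
Qed.

End hausdorff_measure.

Section lipschitz.
Variable R : realType.

(** Two parametrizations by a common set X are compared, so that a chart can be played against a
    linear map in either direction without inverting it. *)
Lemma hausdorff3_lipschitz m n (X : Type) (S : set X) (a : X -> 'rV[R]_m)
    (b : X -> 'rV[R]_n) (L : R) : 0 < L ->
  (forall p q, S p -> S q -> enorm (b p - b q) <= L * enorm (a p - a q)) ->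
  (hausdorff3 (b @` S) <= (L ^+ 3)%:E * hausdorff3 (a @` S))%E.
Proof.
move=> L0 Lip; apply: hausdorff3_le => d d0.
have dL0 : 0 < d / L by rewrite divr_gt0.
have L30 : 0 < L ^+ 3 by rewrite exprn_gt0.
apply: (@le_trans _ _ ((L ^+ 3)%:E * hausdorff3_pre (d / L) (a @` S))%E);
  last first.
  apply: lee_wpmul2l; first by rewrite lee_fin ltW.
  exact: hausdorff3_pre_le_hausdorff3.
rewrite muleC -lee_pdivrMr//; apply: hausdorff3_pre_ge => F Fd SF.
rewrite lee_pdivrMr// muleC -nneseriesZl; last by move=> k _; exact: dvol_ge0.
pose G k := b @` (S `&` a @^-1` F k).
have Gd k : (ediam (G k) <= (L * fine (ediam (F k)))%:E)%E.
  apply: ediam_le; first by rewrite mulr_ge0 ?fine_ediam_ge0// ltW.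
  move=> _ _ [p [Sp Fp] <-] [q [Sq Fq] <-]; apply: le_trans (Lip _ _ Sp Sq) _.
  by rewrite ler_pM2l//; exact: ediam_distP (Fd k) Fp Fq.
apply: (@le_trans _ _ (\sum_(0 <= k <oo) dvol (G k))%E).
  apply: hausdorff3_pre_le => [k|_ [p Sp <-]].
    apply: le_trans (Gd k) _; rewrite lee_fin mulrC -ler_pdivlMr//.
    exact: fine_ediam_le.
  have [|k _ Fp] := SF (a p); first by exists p.
  by exists k => //; exists p.
apply: lee_nneseries => [k _ _|k _]; first exact: dvol_ge0.
apply: le_trans (dvol_le (Gd k)) _; rewrite -EFinM lee_fin.
by rewrite -mulrA exprMn mulrCA.
Qed.

End lipschitz.

(** * The sharp constant on R^3 *)

Section flat.
Variable R : realType.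
Local Notation E3 := (R * R * R)%type.
Local Notation lam := (@lam R).
Local Notation vball := (vball R).
Implicit Types (p q : E3) (W : set E3).

Definition iota3 (p : E3) : 'rV[R]_3 :=
  \row_i (if i == 0 then p.1.1 else if i == 1 then p.1.2 else p.2).

Lemma enorm_iota3 p : enorm (iota3 p) ^+ 2 = normsq p.
Proof.
by rewrite enorm_sqr !big_ord_recl big_ord0 !mxE/= addr0 addrA.
Qed.

Lemma iota3B p q : iota3 p - iota3 q =
  iota3 ((p.1.1 - q.1.1, p.1.2 - q.1.2), p.2 - q.2).
Proof. by apply/rowP => i; rewrite !mxE; case: ifP => // _; case: ifP. Qed.

Lemma enorm_iota3B p q : enorm (iota3 p - iota3 q) ^+ 2 = distsq p q.
Proof. by rewrite iota3B enorm_iota3. Qed.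

Definition hflat (d : R) W : \bar R := hausdorff3_pre d (iota3 @` W).

Definition hratio : R := bvol R / vball.

Lemma hratio_gt0 : 0 < hratio.
Proof. by rewrite divr_gt0 ?bvol_gt0 ?vball_gt0. Qed.

Lemma ediam_iota3 W (D : R) : 0 <= D ->
  (forall p q, W p -> W q -> distsq p q <= D ^+ 2) ->
  (ediam (iota3 @` W) <= D%:E)%E.
Proof.
move=> D0 WD; apply: ediam_le => // _ _ [p Wp <-] [q Wq <-].
by rewrite enorm_le// enorm_iota3B; exact: WD.
Qed.

(** The diagonal of a cube of side s is at most 2 s. This crude bound costs the factor [bvol] in
    place of the sharp [hratio]. *)
Lemma hflat_cube d s c : 0 < s -> 2 * s <= d ->
  (hflat d (cube s c) <= (bvol R)%:E * lam (cube s c))%E.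
Proof.
move=> s0 sd; have s20 : 0 <= 2 * s by rewrite mulr_ge0// ltW.
have dc : (ediam (iota3 @` cube s c) <= (2 * s)%:E)%E.
  apply: ediam_iota3 => // p q pc qc.
  have [] := cell_near s0 (etrans pc (esym qc)).
  rewrite /distsq !ltr_norml => /andP[h1 h2] /andP[h3 h4] /andP[h5 h6].
  by nra.
apply: le_trans (hausdorff3_pre_small _ _) _.
- exact: le_trans sd.
- by apply: le_trans dc _; rewrite lee_fin.
apply: le_trans (dvol_le dc) _.
by rewrite (_ : 2 * s / 2 = s) ?lam_cube// -?EFinM//; field.
Qed.

Lemma cell_dyad_le m n p q : (m <= n)%N -> cell (dyad R n) p = cell (dyad R n) q ->
  cell (dyad R m) p = cell (dyad R m) q.
Proof.
move=> mn; rewrite -(subnK mn); elim: (n - m)%N => [//|k IH] h; apply: IH.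
exact: cell_dyadS.
Qed.

Lemma lam_bigcup (F : (set (bor E3))^nat) :
  (forall k, measurable (F k)) -> trivIset setT F ->
  lam (\bigcup_k F k) = (\sum_(0 <= k <oo) lam (F k))%E.
Proof.
move=> mF tF; apply/esym/cvg_lim => //.
by apply: measure_sigma_additive.
Qed.

Lemma hflat_bigcup d (F : (set E3)^nat) :
  (hflat d (\bigcup_k F k) <= \sum_(0 <= k <oo) hflat d (F k))%E.
Proof.
by rewrite /hflat image_bigcup; exact: hausdorff3_pre_bigcup.
Qed.

Lemma measurable_bor_nth_cube s W k : 0 < s ->
  measurable (nth_cube s W k : set (bor E3)).
Proof.
move=> s0; have [->|[c -> _]] := nth_cubeE s W k; first exact: measurable0.
exact: measurable_bor_cube.
Qed.

Lemma measurable_bor_grid_part s W : 0 < s ->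
  measurable (grid_part s W : set (bor E3)).
Proof.
move=> s0; rewrite grid_partE; apply: bigcup_measurable => k _.
exact: measurable_bor_nth_cube.
Qed.

Lemma hflat_set0 d : 0 <= d -> hflat d set0 = 0%E.
Proof. by move=> d0; rewrite /hflat image_set0 hausdorff3_pre_set0. Qed.

(** Starting point of the bootstrap. An open set is cut into disjoint cubes of decreasing size, the
    cubes of a generation being those not already covered by an earlier one. *)
Lemma hflat_open_crude d W : 0 < d -> open W ->
  (hflat d W <= (bvol R)%:E * lam W)%E.
Proof.
move=> d0 oW.
have [n nd] : exists n, dyad R n < d / 2 by apply: dyad_lt; rewrite divr_gt0.
pose S m := grid_part (dyad R (n + m)) W.
have mS m : measurable (S m : set (bor E3)).
  exact: measurable_bor_grid_part (dyad_gt0 _ _).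
have mD m : measurable (seqDU S m : set (bor E3)).
  by apply: measurableD => //; exact: bigsetU_measurable.
have WE : W = \bigcup_m seqDU S m.
  by rewrite -seqDU_bigcup_eq; exact: open_grid_partE.
rewrite [in leLHS]WE [in leRHS]WE lam_bigcup//.
rewrite -nneseriesZl; last by move=> k _; exact: measure_ge0.
apply: le_trans (hflat_bigcup _ _) _.
apply: lee_nneseries => [m _ _|m _]; first exact: hausdorff3_pre_ge0.
pose F k := nth_cube (dyad R (n + m)) W k `&` seqDU S m.
have SF : seqDU S m = \bigcup_k F k.
  rewrite -setI_bigcupl -grid_partE; apply/seteqP; split => [p Dp|p []//].
  by split => //; case: Dp.
have mF k : measurable (F k : set (bor E3)).
  by apply: measurableI => //; exact: measurable_bor_nth_cube (dyad_gt0 _ _).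
have tF : trivIset setT F.
  move=> i j _ _ [p [[pi _] [pj _]]].
  by apply: (trivIset_nth_cube (s := dyad R (n + m)) (W := W)) => //; exists p.
rewrite SF lam_bigcup// -nneseriesZl; last by move=> k _; exact: measure_ge0.
apply: le_trans (hflat_bigcup _ _) _.
apply: lee_nneseries => [k _ _|k _]; first exact: hausdorff3_pre_ge0.
have [[p [pk pD]]|F0] := pselect (F k !=set0); last first.
  have -> : F k = set0 by rewrite -subset0 => p Fp; apply: F0; exists p.
  by rewrite hflat_set0 ?(ltW d0)// measure0 mule0.
have [N0|[c Nc _]] := nth_cubeE (dyad R (n + m)) W k; first by rewrite N0 in pk.
(* As the grids are nested, a cube of this generation lies entirely inside or entirely outside the
   earlier generations, so removing them never cuts a cube. *)
have -> : F k = cube (dyad R (n + m)) c.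
  rewrite /F Nc; apply/seteqP; split => [q []//|q qc]; split => //.
  have qp : cell (dyad R (n + m)) p = cell (dyad R (n + m)) q.
    by rewrite qc; move: pk; rewrite Nc.
  case: pD => Sp nSp; split; first by rewrite /S/grid_part/= -qp.
  move=> Sq; apply: nSp; move: Sq; rewrite -!bigcup_mkord => -[i /= im Sq].
  exists i => //; rewrite /S /grid_part/=.
  rewrite (@cell_dyad_le (n + i) (n + m) p q)//.
  by rewrite leq_add2l ltnW.
apply: hflat_cube; first exact: dyad_gt0.
by move: nd; rewrite ltr_pdivlMr// mulrC => /ltW; apply: le_trans; rewrite ler_pM2l// dyad_le// leq_addr.
Qed.

Lemma seq_measure_ex (mu : {measure set (bor E3) -> \bar R})
    (F : (set (bor E3))^nat) (b : \bar R) :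
  (forall k, measurable (F k)) -> {homo F : n m / (n <= m)%N >-> (n <= m)%O} ->
  (b < mu (\bigcup_k F k))%E -> exists k, (b < mu (F k))%E.
Proof.
move=> mF ndF bF.
have [k Hk] := ecvg_ex_gt (nondecreasing_cvg_mu mF (bigcup_measurable (fun k _ => mF k)) ndF) bF.
by exists k.
Qed.

(** The concentric ball of radius s / 4 has diameter at most s / 2, so that as a one-set cover of
    itself it costs exactly [hratio] times its volume. A radius below s / 2 keeps the closed ball
    inside the half-open cube. *)
Lemma cube_ball s c : 0 < s -> exists A : set E3,
  [/\ A `<=` cube s c, closed A, lam A = (vball / 64 * s ^+ 3)%:E &
      forall d, s <= d -> (hflat d A <= hratio%:E * lam A)%E].
Proof.
move=> s0.
pose o : E3 := (((c.1.1%:~R + 2^-1) * s, (c.1.2%:~R + 2^-1) * s),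
  (c.2%:~R + 2^-1) * s).
pose A := affine3 ((1, 1), 1) ((- o.1.1, - o.1.2), - o.2) @^-1` cball ((s / 4) ^+ 2).
have s40 : 0 < s / 4 by rewrite divr_gt0.
have lA : lam A = (vball * (s / 4) ^+ 3)%:E.
  rewrite /A lam_affine//=; last exact: measurable_cball.
  by rewrite !mulr1 invr1 mul1e lam_cball.
have near (x y : R) : (1 * x - y) ^+ 2 <= (s / 4) ^+ 2 -> `|x - y| <= s / 4.
  rewrite mul1r => h; rewrite -(ler_pXn2r (n := 2)) ?nnegrE ?(ltW s40)//.
  by rewrite -normrX ger0_norm ?sqr_ge0.
have Ao p : A p -> [/\ `|p.1.1 - o.1.1| <= s / 4, `|p.1.2 - o.1.2| <= s / 4 &
    `|p.2 - o.2| <= s / 4].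
  rewrite /A/cball/affine3/normsq/= => h.
  have le3 (x y z D : R) : x ^+ 2 + y ^+ 2 + z ^+ 2 <= D ->
      [/\ x ^+ 2 <= D, y ^+ 2 <= D & z ^+ 2 <= D].
    by have := sqr_ge0 x; have := sqr_ge0 y; have := sqr_ge0 z; split; lra.
  by case/le3: h => h1 h2 h3; split; exact: near.
exists A; split.
- move=> p /Ao[]; rewrite !ler_distl /o/= => /andP[h1 h2] /andP[h3 h4] /andP[h5 h6].
  have fl (k : int) (x : R) : (k%:~R + 2^-1) * s - s / 4 <= x ->
      x <= (k%:~R + 2^-1) * s + s / 4 -> Num.floor (x / s) = k.
    move=> g1 g2; apply/floor_def; rewrite intrD ler_pdivlMr// ltr_pdivrMr//.
    by rewrite (_ : 1%:~R = 1 :> R)//; apply/andP; split; lra.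
  rewrite /cube/cell/= (fl _ _ h1 h2) (fl _ _ h3 h4) (fl _ _ h5 h6).
  by case: (c) => -[].
- rewrite /A; apply: closed_comp; last exact: closed_cball.
  by move=> p _; exact: continuous_affine3.
- by rewrite lA; congr EFin; rewrite expr_div_n; field.
- move=> d sd.
  have dA : (ediam (iota3 @` A) <= (s / 2)%:E)%E.
    apply: ediam_iota3; first by rewrite divr_ge0// ltW.
    move=> p q; rewrite /A/cball/affine3/normsq/distsq/= !mul1r.
    move: (p.1.1) (p.1.2) (p.2) (q.1.1) (q.1.2) (q.2) => x y z x' y' z' h1 h2.
    have par (u v w : R) : (u - v) ^+ 2 <= 2 * (u - w) ^+ 2 + 2 * (v - w) ^+ 2.
      by have := sqr_ge0 (u + v - 2 * w); nra.
    have := par x x' (o.1.1); have := par y y' o.1.2; have := par z z' o.2.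
    have -> : (s / 2) ^+ 2 = 4 * (s / 4) ^+ 2 by field.
    rewrite /o/=; lra.
  apply: le_trans (hausdorff3_pre_small _ _) _.
  + by apply: le_trans sd; exact: ltW.
  + by apply: le_trans dA _; rewrite lee_fin; apply: le_trans sd; lra.
  apply: le_trans (dvol_le dA) _; rewrite lA -EFinM lee_fin.
  rewrite (_ : s / 2 / 2 = s / 4); last by field.
  by rewrite /hratio (mulrA (bvol R / vball)) divfK// gt_eqF// vball_gt0.
Qed.

(* Vitali-type bootstrap: the balls inscribed in the cubes of a grid fill a fixed
   fraction of W and are covered with the sharp constant hratio; the open
   remainder is covered with the old constant kappa. *)
Lemma hflat_improve d (kappa theta : R) : 0 < d -> hratio <= kappa ->
  0 < theta -> theta <= vball / 256 ->
  (forall W, open W -> (lam W < +oo)%E -> (hflat d W <= kappa%:E * lam W)%E) ->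
  forall W, open W -> (lam W < +oo)%E ->
    (hflat d W <= (hratio + (1 - theta) * (kappa - hratio))%:E * lam W)%E.
Proof.
move=> d0 hk th0 thv H W oW Wfin.
have mW : measurable (W : set (bor E3)) by exact: open_bor.
have k0 : 0 < kappa by exact: lt_le_trans hratio_gt0 hk.
have [W0|W0] := eqVneq (lam W) 0%E.
  by rewrite W0 mule0; have := H W oW Wfin; rewrite W0 mule0.
have Wf : lam W = (fine (lam W))%:E by rewrite fineK// ge0_fin_numE.
set w := fine (lam W) in Wf.
have w0 : 0 < w by rewrite -lte_fin -Wf lt_neqAle eq_sym W0/= measure_ge0.
have [n nd] := dyad_lt d0.
have half : ((w / 2)%:E < lam W)%E by rewrite Wf lte_fin; lra.
have [m Hm] : exists m, ((w / 2)%:E < lam (grid_part (dyad R (n + m)) W))%E.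
  apply: seq_measure_ex.
  - by move=> k; exact: measurable_bor_grid_part (dyad_gt0 _ _).
  - by move=> i j ij; apply/subsetPset; apply: grid_part_dyad_mono; rewrite leq_add2l.
  - by rewrite -open_grid_partE.
set s := dyad R (n + m) in Hm.
have s0 : 0 < s by exact: dyad_gt0.
have sd : s <= d by apply: le_trans (ltW nd); rewrite dyad_le// leq_addr.
have mN k : measurable (nth_cube s W k : set (bor E3)).
  exact: measurable_bor_nth_cube.
(* Finitely many cubes suffice for half of the measure; the union B of their balls is then closed
   and the remainder of W is open again. *)
have [N HN] : exists N, ((w / 2)%:E < lam (\big[setU/set0]_(k < N) nth_cube s W k))%E.
  suff [N HN] : exists N,
      ((w / 2)%:E < lam (\big[setU/set0]_(k < N.+1) nth_cube s W k))%E.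
    by exists N.+1.
  apply: (@seq_measure_ex _ (fun N => \big[setU/set0]_(k < N.+1) nth_cube s W k)).
  - by move=> i; exact: bigsetU_measurable.
  - by move=> i j ij; apply/subsetPset; exact: subset_bigsetU.
  - by rewrite bigcup_bigsetU_bigcup -grid_partE.
have /choice[A HA] : forall k, exists A : set E3,
    [/\ A `<=` nth_cube s W k, closed A,
      lam A = ((vball / 64)%:E * lam (nth_cube s W k))%E &
      (hflat d A <= hratio%:E * lam A)%E].
  move=> k; have [->|[c -> _]] := nth_cubeE s W k.
    exists set0; split => //; first exact: closed0.
      by rewrite measure0 mule0.
    by rewrite measure0 mule0 hflat_set0// ltW.
  have [A [Ac cA lA hA]] := cube_ball c s0.
  exists A; split => //; last exact: hA.
  by rewrite lam_cube// -EFinM.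
pose B := \big[setU/set0]_(k < N) A k.
have cB : closed B by apply: closed_bigsetU => k _; case: (HA k).
have mA k : measurable (A k : set (bor E3)) by apply: closed_bor; case: (HA k).
have mB : measurable (B : set (bor E3)) by exact: bigsetU_measurable.
have BW : B `<=` W.
  rewrite /B -bigcup_mkord => p [k _ Akp].
  by case: (HA k) => + _ _ _ => /(_ _ Akp)[_]; apply.
have tN : trivIset setT (nth_cube s W) by exact: trivIset_nth_cube.
have tA : trivIset setT A.
  move=> i j _ _ [p [Ai Aj]]; apply: tN => //; exists p; split.
  - by case: (HA i) => + _ _ _; exact.
  - by case: (HA j) => + _ _ _; exact.
have lB : lam B = ((vball / 64)%:E * lam (\big[setU/set0]_(k < N) nth_cube s W k))%E.
  rewrite /B !measure_bigsetU// ge0_sume_distrr//.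
  by apply: eq_bigr => k _; case: (HA k).
have hB : (hflat d B <= hratio%:E * lam B)%E.
  rewrite /B [in leRHS]measure_bigsetU// ge0_sume_distrr//.
  elim: (N) => [|M IH]; first by rewrite !big_ord0 hflat_set0// ltW.
  rewrite !big_ord_recr/= /hflat image_setU.
  apply: le_trans (hausdorff3_pre_setU _ _ (ltW d0)) _.
  by apply: leeD => //; case: (HA M).
have Bf : lam B = (fine (lam B))%:E.
  rewrite fineK// ge0_fin_numE//; apply: le_lt_trans Wfin.
  by apply: le_measure; rewrite ?inE.
set b := fine (lam B) in Bf.
(* The balls fill the fraction [vball / 64] of cubes whose total volume exceeds w / 2. *)
have bw : vball / 128 * w <= b.
  rewrite -lee_fin -Bf lB (_ : vball / 128 * w = vball / 64 * (w / 2)); last by field.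
  rewrite EFinM; apply: lee_wpmul2l; last exact: ltW.
  by rewrite lee_fin divr_ge0// ltW// vball_gt0.
have oWB : open (W `\` B) by rewrite setDE; apply: openI => //; rewrite openC.
have lWB : lam (W `\` B) = (w - b)%:E.
  by rewrite measureD// setIidr// EFinB -Wf -Bf.
have hWB : (hflat d (W `\` B) <= kappa%:E * lam (W `\` B))%E.
  by apply: H => //; rewrite lWB ltry.
apply: (@le_trans _ _ (hflat d (B `|` (W `\` B)))).
  apply: hausdorff3_pre_mono; apply: image_subset => p Wp.
  by have [Bp|nBp] := pselect (B p); [left|right].
rewrite /hflat image_setU; apply: le_trans (hausdorff3_pre_setU _ _ (ltW d0)) _.
apply: le_trans (leeD hB hWB) _.
rewrite Wf Bf lWB -!EFinM -EFinD lee_fin.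
have thw : theta * w <= b.
  apply: le_trans bw; rewrite ler_pM2r//; apply: le_trans thv _.
  have := vball_gt0 R; lra.
have : 0 <= kappa - hratio by rewrite subr_ge0.
move=> kh; have : 0 <= (kappa - hratio) * (b - theta * w).
  by rewrite mulr_ge0// subr_ge0.
lra.
Qed.

(** Each use of [hflat_improve] multiplies the excess of the constant over [hratio] by 1 - theta.
    The iteration starts from [hratio + bvol], which is above the crude constant, and the cap theta
    <= 1 / 2 keeps the ratio in [1/2, 1[. *)
Lemma hflat_open d W : 0 < d -> open W -> (hflat d W <= hratio%:E * lam W)%E.
Proof.
move=> d0 oW.
have [Winf|] := eqVneq (lam W) +oo%E.
  by rewrite Winf gt0_muley ?leey// lte_fin hratio_gt0.
rewrite -ltey => Wfin.
pose theta := Num.min (vball / 256) 2^-1.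
have v0 := vball_gt0 R.
have th0 : 0 < theta by rewrite lt_min divr_gt0//= invr_gt0.
have thv : theta <= vball / 256 by rewrite ge_min lexx.
have th1 : theta <= 2^-1 by rewrite ge_min lexx orbT.
have step m W' : open W' -> (lam W' < +oo)%E ->
    (hflat d W' <= (hratio + (1 - theta) ^+ m * bvol R)%:E * lam W')%E.
  elim: m W' => [|m IH] W' oW' fW'.
    rewrite expr0 mul1r; apply: le_trans (hflat_open_crude d0 oW') _.
    rewrite lee_wpmul2r ?measure_ge0// lee_fin lerDr.
    exact: ltW hratio_gt0.
  apply: le_trans (hflat_improve d0 _ th0 thv IH oW' fW') _.
    rewrite lerDl mulr_ge0 ?exprn_ge0// ?(ltW (bvol_gt0 _))// subr_ge0.
    by apply: le_trans th1 _; lra.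
  by rewrite addrAC subrr add0r exprS mulrA.
have Wf : lam W = (fine (lam W))%:E by rewrite fineK// ge0_fin_numE.
set w := fine (lam W) in Wf.
apply/lee_addgt0Pr => e e0.
have w0 : 0 <= w by exact: fine_ge0.
have [m Hm] : exists m, (1 - theta) ^+ m * (bvol R * w) <= e.
  have b0 := bvol_gt0 R.
  have lt1 : `|1 - theta| < 1 by rewrite ger0_norm; lra.
  have K0 : 0 < e / (bvol R * w + 1).
    by rewrite divr_gt0// ltr_wpDl// mulr_ge0// ltW.
  have /cvgrPdist_lt/(_ _ K0)[m _ /(_ m (leqnn m))] := cvg_expr lt1.
  rewrite sub0r normrN ger0_norm; last by rewrite exprn_ge0//; lra.
  move=> h; exists m; move: h; rewrite ltr_pdivlMr; last first.
    by rewrite ltr_wpDl// mulr_ge0// ltW.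
  rewrite mulrDr mulr1 => h; apply: le_trans (ltW h); rewrite lerDl exprn_ge0//; lra.
apply: le_trans (step m W oW Wfin) _.
rewrite Wf -!EFinM -EFinD lee_fin mulrDl lerD2l.
by rewrite -mulrA.
Qed.

Lemma hausdorff3_flat W : open W ->
  (hausdorff3 (iota3 @` W) <= hratio%:E * lam W)%E.
Proof. by move=> oW; apply: hausdorff3_le => d d0; exact: hflat_open. Qed.

End flat.

(** * The area formula *)

Section scaling.
Variable R : realType.
Local Notation E3 := (R * R * R)%type.
Local Notation lam := (@lam R).

Definition diag3 (a : E3) : E3 -> E3 := affine3 a ((0, 0), 0).

Lemma distsq_diag3 (a p q : E3) : distsq (diag3 a p) (diag3 a q) =
  a.1.1 ^+ 2 * (p.1.1 - q.1.1) ^+ 2 + a.1.2 ^+ 2 * (p.1.2 - q.1.2) ^+ 2 +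
  a.2 ^+ 2 * (p.2 - q.2) ^+ 2.
Proof. by rewrite /distsq /diag3 /affine3/= !addr0 -!mulrBr !exprMn. Qed.

Definition inv3 (a : E3) : E3 := ((a.1.1^-1, a.1.2^-1), a.2^-1).

Lemma diag3K (a : E3) : 0 < a.1.1 -> 0 < a.1.2 -> 0 < a.2 ->
  cancel (diag3 a) (diag3 (inv3 a)) /\ cancel (diag3 (inv3 a)) (diag3 a).
Proof.
move=> a1 a2 a3; split => -[[x y] z]; rewrite /diag3/inv3/affine3/= !addr0.
  by rewrite !mulKf ?gt_eqF.
by rewrite !mulVKf ?gt_eqF.
Qed.

Lemma image_diag3 (a : E3) (W : set E3) : 0 < a.1.1 -> 0 < a.1.2 -> 0 < a.2 ->
  diag3 a @` W = diag3 (inv3 a) @^-1` W.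
Proof.
move=> a1 a2 a3; have [K1 K2] := diag3K a1 a2 a3.
apply/seteqP; split => [_ [p Wp <-]|p Wp]; first by rewrite /preimage/= K1.
by exists (diag3 (inv3 a) p) => //; exact: K2.
Qed.

Lemma measurable_image_diag3 (a : E3) (W : set (bor E3)) :
  0 < a.1.1 -> 0 < a.1.2 -> 0 < a.2 -> measurable W ->
  measurable (diag3 a @` W : set (bor E3)).
Proof.
move=> a1 a2 a3 mW; rewrite image_diag3//; apply: bor_preimageT => //.
exact: continuous_affine3.
Qed.

Lemma open_image_diag3 (a : E3) (W : set E3) :
  0 < a.1.1 -> 0 < a.1.2 -> 0 < a.2 -> open W -> open (diag3 a @` W).
Proof.
move=> a1 a2 a3 oW; rewrite image_diag3//; apply: open_comp => // p _.
exact: continuous_affine3.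
Qed.

Lemma lam_image_diag3 (a : E3) (W : set (bor E3)) :
  0 < a.1.1 -> 0 < a.1.2 -> 0 < a.2 -> measurable W ->
  lam (diag3 a @` W) = ((a.1.1 * a.1.2 * a.2)%:E * lam W)%E.
Proof.
move=> a1 a2 a3 mW; rewrite image_diag3// lam_affine//= ?invr_gt0//.
by rewrite -!invfM invrK.
Qed.

Definition lam_exhaust (m : nat) : set (bor E3) := [set p | normsq p < m%:R].

Lemma open_lam_exhaust m : open (lam_exhaust m).
Proof.
rewrite (_ : lam_exhaust m = @normsq R @^-1` [set x | x < m%:R])//.
by apply: open_comp; [move=> p _; exact: continuous_normsq|exact: open_lt].
Qed.

Lemma lam_exhaustT : \bigcup_m lam_exhaust m = setT.
Proof.
apply/seteqP; split => // p _; exists (Num.truncn (normsq p)).+1 => //.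
by rewrite /lam_exhaust/=; exact: truncnS_gt.
Qed.

Lemma lam_exhaust_fin m : (lam (lam_exhaust m) < +oo)%E.
Proof.
apply: le_lt_trans (lam_cball_fin (m%:R : R)); apply: le_measure; rewrite ?inE.
- by apply: open_bor; exact: open_lam_exhaust.
- exact: measurable_cball.
- by move=> p /ltW.
Qed.

Definition lam_outer (A : set (bor E3)) (e : R) :=
  fun mA : measurable A =>
  (borel_outer_regular open_lam_exhaust lam_exhaustT lam_exhaust_fin mA).2 e.

End scaling.

Lemma le_cube_factor (R : realType) (x y : \bar R) : (0 <= y)%E ->
  (forall e : R, 0 < e -> (x <= ((1 + e) ^+ 3)%:E * y)%E) -> (x <= y)%E.
Proof.
case: y => [r| |//] r0 H; last by rewrite leey.
rewrite lee_fin in r0; apply/lee_addgt0Pr => d d0.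
(* Chosen from (1 + e)^3 <= 1 + 7 e for e <= 1; the extra 1 in the denominator covers r = 0. *)
pose e := Num.min 1 (d / (7 * r + 1)).
have r70 : 0 < 7 * r + 1 by lra.
have e0 : 0 < e by rewrite lt_min ltr01 divr_gt0.
apply: le_trans (H e e0) _; rewrite -EFinM -EFinD lee_fin.
have e1 : e <= 1 by rewrite ge_min lexx.
have : e * (7 * r + 1) <= d by rewrite -ler_pdivlMr// ge_min lexx orbT.
have e2 : e ^+ 2 <= e by rewrite expr2 ler_piMr// ltW.
have e3 : e ^+ 3 <= e by rewrite exprS ler_piMr ?(ltW e0)//; exact: le_trans e2 e1.
move=> h; have h3 : (1 + e) ^+ 3 <= 1 + 7 * e.
  by rewrite (_ : (1 + e) ^+ 3 = 1 + 3 * e + 3 * e ^+ 2 + e ^+ 3); [lra|ring].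
apply: (@le_trans _ _ ((1 + 7 * e) * r)); first by rewrite ler_wpM2r.
nra.
Qed.

(** A covering argument instead of an attained minimum, so that an empty K is included. *)
Lemma compact_lower_bound (R : realType) (T : topologicalType) (K : set T)
    (h : T -> R) : compact K ->
  (forall x, K x -> h z @[z --> x] --> h x /\ 0 < h x) ->
  exists2 d : R, 0 < d & forall x, K x -> d < h x.
Proof.
move=> /compact_near_coveringP cK hK.
have := cK _ (0 : R)^'+ (fun d x => d < h x) _ _.
move=> H; have {}H : \forall d \near (0 : R)^'+, forall x, K x -> d < h x.
  apply: H => x Kx; have [hx h0] := hK x Kx.
  have h2 : h x / 2 < h x by rewrite ltr_pdivrMr// ltr_pMr// ltr1n.
  have h20 : 0 < h x / 2 by rewrite divr_gt0.
  exists ([set z | h x / 2 < h z], [set d | d < h x / 2]) => /=.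
    by split; [exact: (cvgr_gt _ hx _ h2)|exact: nbhs_right_lt].
  by move=> [z d] /= [zx dx]; exact: lt_trans dx zx.
have [d [Hd d0]] := filter_ex (filterI H (nbhs_right_gt 0)).
by exists d.
Qed.

(** * Families of charts with a diagonal metric and constant Jacobian *)

Section chart.
Variables (R : realType) (N : nat) (I : finType).
Local Notation E3 := (R * R * R)%type.
Local Notation lam := (@lam R).
Local Notation hratio := (hratio R).
Variables (D : set E3) (g : I -> E3 -> 'rV[R]_N) (J : R).
Variables (A1 A2 A3 : E3 -> E3 -> R).
Hypothesis oD : open D.
Hypothesis J0 : 0 < J.
Hypothesis g_dist : forall i p q, D p -> D q ->
  enorm (g i p - g i q) ^+ 2 =
  A1 p q * (p.1.1 - q.1.1) ^+ 2 + A2 p q * (p.1.2 - q.1.2) ^+ 2 +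
  A3 p q * (p.2 - q.2) ^+ 2.
Hypothesis A_gt0 : forall p q, D p -> D q ->
  [/\ 0 < A1 p q, 0 < A2 p q & 0 < A3 p q].
Hypothesis A_cont : forall p q, D p -> D q ->
  [/\ (fun z : E3 * E3 => A1 z.1 z.2) z @[z --> (p, q)] --> A1 p q,
      (fun z : E3 * E3 => A2 z.1 z.2) z @[z --> (p, q)] --> A2 p q &
      (fun z : E3 * E3 => A3 z.1 z.2) z @[z --> (p, q)] --> A3 p q].
Hypothesis A_jac : forall p, D p -> A1 p p * A2 p p * A3 p p = J ^+ 2.
Hypothesis g_cont : forall i p, D p -> {for p, continuous (g i)}.
Hypothesis g_sep : forall i j p q, i != j -> D p -> D q -> g i p <> g j q.

(** One diagonal map serves all the charts at once, because the coefficients in [g_dist] do not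
    depend on the index i. *)
Definition quasi_isometric (e : R) (U : set E3) := exists a : E3,
  [/\ [/\ 0 < a.1.1, 0 < a.1.2, 0 < a.2 & a.1.1 * a.1.2 * a.2 = J],
   U `<=` D &
   forall i p q, U p -> U q ->
     enorm (g i p - g i q) <= (1 + e) * enorm (iota3 (diag3 a p) - iota3 (diag3 a q)) /\
     enorm (iota3 (diag3 a p) - iota3 (diag3 a q)) <= (1 + e) * enorm (g i p - g i q)].

Lemma quasi_isometric0 e : quasi_isometric e set0.
Proof.
by exists ((J, 1), 1); split => //=; rewrite !mulr1; split => //; exact: J0.
Qed.

Lemma quasi_isometricS e U V : U `<=` V -> quasi_isometric e V ->
  quasi_isometric e U.
Proof.
move=> UV [a [a0 VD aV]]; exists a; split => //; first exact: subset_trans VD.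
by move=> i p q Up Uq; apply: aV; exact: UV.
Qed.

(** The entries of the diagonal map are the square roots of the three coefficients at (p, p), with
    product J by [A_jac]; continuity at (p, p) keeps the coefficients of nearby pairs within a
    factor 1 + e. *)
Lemma quasi_isometric_ball e p : 0 < e -> D p ->
  exists2 r : R, 0 < r & quasi_isometric e (ball p r).
Proof.
move=> e0 Dp; have [a10 a20 a30] := A_gt0 Dp Dp.
have [c1 c2 c3] := A_cont Dp Dp.
have up (A : E3 -> E3 -> R) : 0 < A p p ->
    (fun z : E3 * E3 => A z.1 z.2) z @[z --> (p, p)] --> A p p ->
    \forall z \near (p, p), A z.1 z.2 <= (1 + e) * A p p /\
                            A p p <= (1 + e) * A z.1 z.2.
  move=> App cA.
  have h1 : A p p < (1 + e) * A p p by rewrite mulrDl mul1r ltrDl mulr_gt0.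
  have h2 : A p p / (1 + e) < A p p.
    by rewrite ltr_pdivrMr ?addr_gt0// mulrDr mulr1 ltrDl mulr_gt0.
  apply: filterS2 (cvgr_lt _ cA _ h1) (cvgr_gt _ cA _ h2) => z /= z1 z2.
  split; first exact: ltW.
  by move: z2; rewrite ltr_pdivrMr ?addr_gt0// mulrC => /ltW.
have nD : nbhs (p, p) (D `*` D).
  by exists (D, D) => //=; split; apply: open_nbhs_nbhs; split.
have nH := filterI (filterI (up _ a10 c1) (up _ a20 c2))
  (filterI (up _ a30 c3) nD).
have [r1 /= r10 H] := (@nbhs_ballP R (E3 * E3)%type _ _).1 (nH _ _ _).
exists r1 => //.
have inD q : ball p r1 q -> D q.
  by move=> pq; have [|_ [_ []]] := H (q, q).
exists ((Num.sqrt (A1 p p), Num.sqrt (A2 p p)), Num.sqrt (A3 p p)); split => //=.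
  split; rewrite ?sqrtr_gt0// -!sqrtrM ?mulr_ge0 ?ltW//.
  by rewrite A_jac// sqrtr_sqr ger0_norm// ltW.
move=> i q q' pq pq'.
have [//|[h1 h2] [h3 _]] := H (q, q').
have e1 : 0 <= 1 + e by rewrite addr_ge0// ltW.
have e11 : 1 + e <= (1 + e) ^+ 2 by rewrite expr2 ler_peMr// lerDl ltW.
have sq (x : R) : 0 < x -> Num.sqrt x ^+ 2 = x by move=> x0; rewrite sqr_sqrtr// ltW.
set X := enorm (g i q - g i q'); set Y := enorm (_ - iota3 _).
have X2 := g_dist i (inD _ pq) (inD _ pq').
have Y2 : Y ^+ 2 = A1 p p * (q.1.1 - q'.1.1) ^+ 2 +
    A2 p p * (q.1.2 - q'.1.2) ^+ 2 + A3 p p * (q.2 - q'.2) ^+ 2.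
  by rewrite enorm_iota3B distsq_diag3/= !sq.
move: h1 h2 h3 X2 Y2; rewrite -/X /=.
have := sqr_ge0 (q.1.1 - q'.1.1); have := sqr_ge0 (q.1.2 - q'.1.2).
have := sqr_ge0 (q.2 - q'.2).
move: (_ ^+ 2) (_ ^+ 2) (_ ^+ 2) => s3 s2 s1 s30 s20 s10.
move=> [h1 h1'] [h2 h2'] [h3 h3'] X2 Y2.
(* The comparison holds for squared distances with factor 1 + e, which is at most (1 + e)^2. *)
have sub (u v : R) : 0 <= u -> 0 <= v -> u ^+ 2 <= (1 + e) * v ^+ 2 ->
    u <= (1 + e) * v.
  move=> u0 v0 uv; rewrite -(ler_pXn2r (n := 2)) ?nnegrE// ?mulr_ge0//.
  apply: le_trans uv _; rewrite exprMn ler_wpM2r ?sqr_ge0//.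
split; apply: sub; rewrite ?enorm_ge0//.
- rewrite X2 Y2 !mulrDr !mulrA; apply: lerD; [apply: lerD|]; exact: ler_wpM2r.
- rewrite X2 Y2 !mulrDr !mulrA; apply: lerD; [apply: lerD|]; exact: ler_wpM2r.
Qed.

(** The sharp bound on R^3 is known for open sets; a Borel E is reached by open sets V around it,
    cut down to U where the chart is controlled, with little excess volume. *)
Lemma quasi_isometric_upper e i U (E : set (bor E3)) : 0 < e -> open U ->
  quasi_isometric e U -> measurable E -> E `<=` U ->
  (hausdorff3 (g i @` E) <= ((1 + e) ^+ 3)%:E * ((hratio * J)%:E * lam E))%E.
Proof.
move=> e0 oU [a [[a1 a2 a3 aJ] UD aU]] mE EU.
have e10 : 0 < 1 + e by rewrite addr_gt0.
have openV V : open V -> V `<=` U ->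
    (hausdorff3 (g i @` V) <= ((1 + e) ^+ 3 * (hratio * J))%:E * lam V)%E.
  move=> oV VU.
  have lip p q : V p -> V q -> enorm (g i p - g i q) <= (1 + e) *
      enorm (iota3 (diag3 a p) - iota3 (diag3 a q)).
    by move=> Vp Vq; exact: (aU i _ _ (VU _ Vp) (VU _ Vq)).1.
  apply: le_trans (hausdorff3_lipschitz e10 lip) _.
  rewrite [in leRHS]EFinM -muleA; apply: lee_wpmul2l.
    by rewrite lee_fin exprn_ge0// ltW.
  rewrite -(image_comp (diag3 a) (@iota3 R)); apply: le_trans (hausdorff3_flat (open_image_diag3 a1 a2 a3 oV)) _.
  rewrite lam_image_diag3 ?aJ//; last exact: open_bor.
  by rewrite EFinM muleA.
rewrite muleA -EFinM.
set C := (1 + e) ^+ 3 * (hratio * J).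
have C0 : 0 < C by rewrite mulr_gt0 ?exprn_gt0// mulr_gt0// hratio_gt0.
apply/lee_addgt0Pr => d d0.
have dC : 0 < d / C by rewrite divr_gt0.
have [V [oV EV Ve]] := lam_outer mE dC.
have oVU : open (V `&` U) by exact: openI.
apply: (@le_trans _ _ (C%:E * lam (V `&` U))%E).
  apply: le_trans (openV _ oVU (@subIsetr _ _ _)); apply: hausdorff3_mono.
  by apply: image_subset => p Ep; split; [exact: EV|exact: EU].
rewrite (_ : d%:E = (C%:E * (d / C)%:E)%E); last first.
  by rewrite -EFinM mulrCA divff ?mulr1// gt_eqF.
rewrite -ge0_muleDr ?lee_fin ?(ltW dC)//.
apply: lee_wpmul2l; first by rewrite lee_fin ltW.
apply: (@le_trans _ _ (lam (E `|` (V `\` E)))).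
  apply: le_measure; rewrite ?inE//; first exact: open_bor.
    by apply: measurableU => //; apply: measurableD => //; exact: open_bor.
  by move=> p [Vp _]; have [Ep|nEp] := pselect (E p); [left|right].
apply: le_trans (measureU2 _ mE _) _; last by rewrite leeD2l.
by apply: measurableD => //; exact: open_bor.
Qed.

(** There are only countably many dyadic cubes, and those contained in some good open set cover D.
    The choice is indexed by codes of pairs (generation, cell), with the empty set at the other
    codes. *)
Lemma quasi_isometric_cover e : 0 < e -> exists Q U : nat -> set E3,
  [/\ forall k, measurable (Q k : set (bor E3)),
      forall k, [/\ open (U k), Q k `<=` U k & quasi_isometric e (U k)] &
      D `<=` \bigcup_k Q k].
Proof.
move=> e0.
pose good (Q U : set E3) := [/\ measurable (Q : set (bor E3)), open U, Q `<=` U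
  & quasi_isometric e U].
have good0 : good set0 set0.
  by split; [exact: measurable0|exact: open0|by []|exact: quasi_isometric0].
have /choice[QU H] : forall k, exists QU : set E3 * set E3, good QU.1 QU.2 /\
    forall (x : nat * (int * int * int)) U, unpickle k = Some x ->
      good (cube (dyad R x.1) x.2) U -> QU.1 = cube (dyad R x.1) x.2.
  move=> k; case uk : (unpickle k : option (nat * (int * int * int))) => [x|];
    last by exists (set0, set0).
  have [[U HU]|nU] := pselect (exists U, good (cube (dyad R x.1) x.2) U).
    by exists (cube (dyad R x.1) x.2, U); split => // y V [<-].
  by exists (set0, set0); split => // y V [<-] HV; case: nU; exists V.
exists (fun k => (QU k).1), (fun k => (QU k).2); split.
- by move=> k; case: (H k) => -[].
- by move=> k; case: (H k) => -[].
move=> p Dp; have [r r0 gr] := quasi_isometric_ball e0 Dp.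
have [m mr] := dyad_lt r0; pose x := (m, cell (dyad R m) p).
exists (pickle x) => //; have [_ Hx] := H (pickle x).
suff -> : (QU (pickle x)).1 = cube (dyad R m) (cell (dyad R m) p) by [].
apply: (Hx x (ball p r)); first exact: pickleK.
split => //.
- exact: measurable_bor_cube (dyad_gt0 _ _).
- exact: ball_open.
- move=> q qp; have [h1 h2 h3] := cell_near (dyad_gt0 R m) (esym qp).
  by apply/ball_E3; split; apply: lt_trans mr.
Qed.

Lemma chart_upper i (E : set (bor E3)) : measurable E -> E `<=` D ->
  (hausdorff3 (g i @` E) <= (hratio * J)%:E * lam E)%E.
Proof.
move=> mE ED; apply: le_cube_factor.
  apply: mule_ge0; last exact: measure_ge0.
  by rewrite lee_fin; apply: mulr_ge0; apply: ltW => //; exact: hratio_gt0.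
move=> e e0; have [Q [U [mQ HU DQ]]] := quasi_isometric_cover e0.
pose F k : set (bor E3) := E `&` Q k.
have mF k : measurable (seqDU F k).
  by apply: measurableD; [|apply: bigsetU_measurable => j _]; exact: measurableI.
have EF : E = \bigcup_k seqDU F k.
  rewrite -seqDU_bigcup_eq -setI_bigcupr; apply/seteqP; split => [p Ep|p []//].
  by split => //; apply: DQ; exact: ED.
rewrite [in leLHS]EF [in leRHS]EF image_bigcup lam_bigcup//.
rewrite muleA -EFinM -nneseriesZl; last by move=> k _; exact: measure_ge0.
apply: le_trans (hausdorff3_bigcup _) _.
apply: lee_nneseries => [k _ _|k _]; first exact: hausdorff3_ge0.
have [oU QU qU] := HU k.
rewrite EFinM -muleA; apply: (quasi_isometric_upper _ _ oU) => //.
by move=> p [[_ Qp] _]; exact: QU.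
Qed.

Lemma measurable_chart i (A : set (bor 'rV[R]_N)) : measurable A ->
  measurable (D `&` g i @^-1` A : set (bor E3)).
Proof. by move=> mA; apply: bor_preimage => // p; exact: g_cont. Qed.

Lemma hausdorff3_bigsetU (F : I -> set 'rV[R]_N) :
  (hausdorff3 (\big[setU/set0]_i F i) <= \sum_i hausdorff3 (F i))%E.
Proof.
elim/big_ind2 : _ => [|A x B y Ax By|//]; first by rewrite hausdorff3_set0.
by apply: le_trans (hausdorff3_setU _ _) _; exact: leeD.
Qed.

Lemma chart_family_upper (A : set (bor 'rV[R]_N)) : measurable A ->
  (hausdorff3 (A `&` \bigcup_i g i @` D) <=
    (hratio * J)%:E * \sum_i lam (D `&` g i @^-1` A))%E.
Proof.
move=> mA; rewrite ge0_sume_distrr//.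
apply: le_trans (_ : _ <= \sum_i hausdorff3 (g i @` (D `&` g i @^-1` A)))%E _.
  apply: le_trans (hausdorff3_bigsetU _); apply: hausdorff3_mono.
  move=> x [Ax [i _ [p Dp px]]]; rewrite -bigcup_seq.
  exists i => //=; first by rewrite mem_index_enum.
  by exists p => //; split => //; rewrite /preimage/= px.
by apply: lee_sum => i _; apply: chart_upper; [exact: measurable_chart|exact: subIsetl].
Qed.

(** A Lebesgue number for the good neighbourhoods of the points of K. *)
Lemma quasi_isometric_number e K : 0 < e -> compact K -> K `<=` D ->
  exists2 r : R, 0 < r & forall p, K p -> quasi_isometric e (ball p r).
Proof.
move=> e0 /compact_near_coveringP cK KD.
have := cK _ (0 : R)^'+ (fun r p => quasi_isometric e (ball p r)) _ _.
move=> H; have {}H : \forall r \near (0 : R)^'+, forall p, K p ->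
    quasi_isometric e (ball p r).
  apply: H => p Kp; have [r r0 qr] := quasi_isometric_ball e0 (KD _ Kp).
  have r20 : 0 < r / 2 by rewrite divr_gt0.
  exists (ball p (r / 2), [set d | d < r / 2]) => /=.
    by split; [exact: nbhsx_ballx|exact: nbhs_right_lt].
  move=> [q d] /= [pq dr]; apply: quasi_isometricS qr => x qx.
  rewrite (splitr r); apply: ball_triangle pq _.
  by apply: le_ball qx; exact: ltW.
have [r [Hr r0]] := filter_ex (filterI H (nbhs_right_gt 0)).
by exists r.
Qed.

(** The mass of F is the total volume of the parts of the K i that the charts send into F. A set F
    of small diameter meets a single sheet, because the compact images are at positive mutual
    distance, and its preimage lies in one quasi-isometric ball; the isodiametric inequality then
    bounds its mass by its diameter. *)
Lemma chart_compact e (K : I -> set E3) : 0 < e ->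
  (forall i, compact (K i)) -> (forall i, K i `<=` D) ->
  (\sum_i lam (K i) <= ((1 + e) ^+ 3 / (hratio * J))%:E *
     hausdorff3 (\bigcup_i g i @` K i))%E.
Proof.
move=> e0 cK KD.
have hE : hausdorff_space E3 by exact: norm_hausdorff.
have mK i : measurable (K i : set (bor E3)).
  by apply: closed_bor; exact: compact_closed.
have mKF i F : closed F -> measurable (K i `&` g i @^-1` F : set (bor E3)).
  move=> cF; rewrite -[K i](setIidl (KD i)) -setIA; apply: measurableI => //.
  by apply: measurable_chart; exact: closed_bor.
pose KK := \big[setU/set0]_i K i.
have cKK : compact KK by apply: bigsetU_compact.
have KKi i p : K i p -> KK p.
  by move=> Kp; rewrite /KK -bigcup_seq; exists i => //=; rewrite mem_index_enum.
have KKD : KK `<=` D.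
  by rewrite /KK -bigcup_seq => p [i _]; exact: KD.
have [r r0 qr] := quasi_isometric_number e0 cKK KKD.
have [kap kap0 Hkap] : exists2 k : R, 0 < k & forall p q, KK p -> KK q ->
    [/\ k < A1 p q, k < A2 p q & k < A3 p q].
  have c2 := compact_setX cKK cKK.
  have [|k1 k10 H1] := @compact_lower_bound R _ _ (fun z => A1 z.1 z.2) c2.
    move=> [p q] [/= /KKD Dp /KKD Dq].
    by have [] := A_cont Dp Dq; have [] := A_gt0 Dp Dq.
  have [|k2 k20 H2] := @compact_lower_bound R _ _ (fun z => A2 z.1 z.2) c2.
    move=> [p q] [/= /KKD Dp /KKD Dq].
    by have [] := A_cont Dp Dq; have [] := A_gt0 Dp Dq.
  have [|k3 k30 H3] := @compact_lower_bound R _ _ (fun z => A3 z.1 z.2) c2.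
    move=> [p q] [/= /KKD Dp /KKD Dq].
    by have [] := A_cont Dp Dq; have [] := A_gt0 Dp Dq.
  exists (Num.min k1 (Num.min k2 k3)); first by rewrite !lt_min k10 k20 k30.
  move=> p q Kp Kq; split; rewrite !gt_min.
  - by rewrite (H1 (p, q)).
  - by rewrite (H2 (p, q))// orbT.
  - by rewrite (H3 (p, q))// !orbT.
have [d1 d10 Hd1] : exists2 d : R, 0 < d & forall i j p q, i != j -> K i p ->
    K j q -> d < enorm (g i p - g j q).
  have : \forall d \near (0 : R)^'+, forall ij : I * I, ij.1 != ij.2 ->
      forall z, (K ij.1 `*` K ij.2) z -> d < enorm (g ij.1 z.1 - g ij.2 z.2).
    apply: filter_forall => -[i j] /=.
    have [<-|ij] := eqVneq i j; first exact: filterE.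
    have [|d d0 Hd] := @compact_lower_bound R _ _
      (fun z => enorm (g i z.1 - g j z.2)) (compact_setX (cK i) (cK j)).
      move=> [p q] [/= /KD Dp /KD Dq]; split.
        apply: (@cvg_comp _ _ _ (fun z : E3 * E3 => g i z.1 - g j z.2) (@enorm R N)
          _ (nbhs (g i p - g j q))); last exact: continuous_enorm.
        apply: cvgB.
          by apply: (@cvg_comp _ _ _ fst (g i) _ (nbhs p)); [exact: cvg_fst|exact: g_cont].
        by apply: (@cvg_comp _ _ _ snd (g j) _ (nbhs q)); [exact: cvg_snd|exact: g_cont].
      rewrite lt_neqAle enorm_ge0 andbT eq_sym; apply/eqP => g0.
      apply: (g_sep ij Dp Dq); apply/eqP; rewrite -subr_eq0; apply/eqP.
      by apply/rowP => k; apply/eqP; rewrite [eqbRHS]mxE -normr_le0 -g0 enorm_coord.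
    apply: filterS (nbhs_right_lt d0) => x xd _ z Kz; exact: lt_trans xd (Hd _ Kz).
  move=> H; have [d [Hd d0]] := filter_ex (filterI H (nbhs_right_gt 0)).
  by exists d => // i j p q ij Kp Kq; exact: (Hd (i, j) ij (p, q)).
(* Below [d1] only one sheet is met. Below the second bound, kap dx^2 <= kap r^2 / 4 in each
   coordinate, so preimages stay within distance r of each other. *)
pose d := Num.min d1 (Num.sqrt kap * r / 2).
have d0 : 0 < d by rewrite lt_min d10 divr_gt0// mulr_gt0// sqrtr_gt0.
have e10 : 0 < 1 + e by rewrite addr_gt0.
have hJ0 : 0 < hratio * J by rewrite mulr_gt0// hratio_gt0.
have c0 : 0 < (1 + e) ^+ 3 / (hratio * J) by rewrite divr_gt0// exprn_gt0.
pose m F := (\sum_i lam (K i `&` g i @^-1` F))%E.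
rewrite (_ : (\sum_i lam (K i))%E = m (\bigcup_i g i @` K i)); last first.
  apply: eq_bigr => i _; congr (lam _); apply/seteqP; split => [p Kp|p []//].
  by split => //; exists i => //; exists p.
apply: (mass_distribution_principle d0 c0) => [F cF gF|F|F cF Fd].
- rewrite /m nneseries_sum; last by move=> *; exact: measure_ge0.
  apply: lee_sum => i _; apply: (@le_trans _ _ (lam (K i))).
    rewrite le_eqVlt; apply/orP; left; apply/eqP; congr (lam _).
    apply/seteqP; split => [p []//|p Kp].
    by split => //; exists i => //; exists p.
  apply: measure_sigma_subadditive => //; first by move=> k; exact: mKF.
  move=> p Kp; have [|k _ Fp] := gF (g i p); first by exists i => //; exists p.
  by exists k.
- by apply: sume_ge0 => i _; exact: measure_ge0.
have [[i [p0 [Kp0 Fp0]]]|nF] := pselect (exists i, K i `&` g i @^-1` F !=set0);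
    last first.
  rewrite /m big1 => [|i _]; first by rewrite mule_ge0 ?dvol_ge0// lee_fin ltW.
  rewrite (_ : _ `&` _ = set0) ?measure0// -subset0 => p Hp.
  by apply: nF; exists i, p.
have fd := fine_ediam_le Fd.
rewrite /m (bigD1 i)//= [X in (_ + X)%E]big1 ?adde0 => [|j ji]; last first.
  rewrite (_ : _ `&` _ = set0) ?measure0// -subset0 => p [Kp Fp].
  have := Hd1 _ _ _ _ ji Kp Kp0; rewrite ltNge => /negP; apply.
  by apply: le_trans (ediam_distP Fd Fp Fp0) _; apply: le_trans fd _; rewrite ge_min lexx.
set S := K i `&` g i @^-1` F.
have Sball : S `<=` ball p0 r.
  move=> q [Kq Fq]; have [k1 k2 k3] := Hkap _ _ (KKi _ _ Kp0) (KKi _ _ Kq).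
  have := g_dist i (KD _ _ Kp0) (KD _ _ Kq).
  have gd : enorm (g i p0 - g i q) <= Num.sqrt kap * r / 2.
    apply: le_trans (ediam_distP Fd Fp0 Fq) _; apply: le_trans fd _.
    by rewrite ge_min lexx orbT.
  have gd2 : enorm (g i p0 - g i q) ^+ 2 <= kap * (r ^+ 2 / 4).
    apply: (@le_trans _ _ ((Num.sqrt kap * r / 2) ^+ 2)).
      by rewrite lerXn2r ?nnegrE ?enorm_ge0// divr_ge0// mulr_ge0 ?sqrtr_ge0// ltW.
    rewrite expr_div_n exprMn sqr_sqrtr ?(ltW kap0)// -mulrA.
    by rewrite (_ : (2 : R) ^+ 2 = 4)// -natrX.
  move=> ge; rewrite ge in gd2.
  have fin (x : R) : kap * x ^+ 2 <= kap * (r ^+ 2 / 4) -> `|x| < r.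
    rewrite ler_pM2l// => h; rewrite -(ltr_pXn2r (n := 2)) ?nnegrE ?(ltW r0)//.
    rewrite -normrX ger0_norm ?sqr_ge0//; apply: le_lt_trans h _.
    by rewrite ltr_pdivrMr// ltr_pMr ?exprn_gt0// ltr1n.
  have s1 := sqr_ge0 (p0.1.1 - q.1.1); have s2 := sqr_ge0 (p0.1.2 - q.1.2).
  have s3 := sqr_ge0 (p0.2 - q.2).
  have t1 := ler_wpM2r s1 (ltW k1); have t2 := ler_wpM2r s2 (ltW k2).
  have t3 := ler_wpM2r s3 (ltW k3).
  have u1 := mulr_ge0 (ltW kap0) s1; have u2 := mulr_ge0 (ltW kap0) s2.
  have u3 := mulr_ge0 (ltW kap0) s3.
  by apply/ball_E3; split; apply: fin; lra.
have [a [[a1 a2 a3 aJ] _ aS]] := qr _ (KKi _ _ Kp0).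
have mS : measurable (S : set (bor E3)) by exact: mKF.
have iso : (lam (diag3 a @` S) <= ((vball R) * ((1 + e) * fine (ediam F) / 2) ^+ 3)%:E)%E.
  apply: isodiametric; first exact: measurable_image_diag3.
    by rewrite mulr_ge0 ?fine_ediam_ge0// ltW.
  move=> _ _ [p Sp <-] [q Sq <-]; rewrite -enorm_iota3B -enorm_le; last first.
    by rewrite mulr_ge0 ?fine_ediam_ge0// ltW.
  apply: le_trans (aS i _ _ (Sball _ Sp) (Sball _ Sq)).2 _.
  rewrite ler_pM2l//; case: Sp => _ Fp; case: Sq => _ Fq.
  exact: ediam_distP Fd Fp Fq.
rewrite lam_image_diag3// aJ muleC -lee_pdivlMr// in iso.
apply: le_trans iso _; rewrite /dvol -!EFinM lee_fin le_eqVlt; apply/orP; left.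
have v0 := vball_gt0 R; have b0 := bvol_gt0 R.
by apply/eqP; rewrite /hratio; field; rewrite !gt_eqF.
Qed.

(** A sequence of compact sets with a limit, rather than one compact set: if E has infinite measure,
    no single compact set comes within e of it. *)
Lemma lam_compact_approx (E : set (bor E3)) (e : R) : measurable E -> 0 < e ->
  exists K : nat -> set E3, [/\ forall m, compact (K m), forall m, K m `<=` E,
    forall m, measurable (K m : set (bor E3)) &
    exists2 l : \bar R, lam (K m) @[m --> \oo] --> l & (lam E <= l + e%:E)%E].
Proof.
move=> mE e0.
have [F [cF FE EF]] := borel_closed_approx (@open_lam_exhaust R)
  (@lam_exhaustT R) (@lam_exhaust_fin R) mE e0.
have mF : measurable F by exact: closed_bor.
pose K m := F `&` cball (m%:R ^+ 2 : R).
have mK m : measurable (K m : set (bor E3)).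
  by apply: measurableI => //; exact: measurable_cball.
exists K; split.
- move=> m; pose I1 := [set` `[- (m%:R), m%:R : R]].
  apply: (@subclosed_compact E3 (K m) (I1 `*` I1 `*` I1)).
  + by apply: closedI => //; exact: closed_cball.
  + by apply: compact_setX; [apply: compact_setX|]; exact: segment_compact.
  + move=> p [_ pm]; have [] := cball_bound (ler0n _ m) pm.
    by move=> h1 h2 h3; split; [split|]; rewrite /I1/= in_itv/= -ler_norml.
- by move=> m p [Fp _]; exact: FE.
- exact: mK.
exists (lam F).
  rewrite (_ : F = \bigcup_m K m); last first.
    rewrite -setI_bigcupr; apply/seteqP; split => [p Fp|p []//]; split => //.
    exists (Num.truncn (normsq p)).+1 => //; rewrite /cball/=.
    apply: le_trans (ltW (truncnS_gt _)) _.
    by rewrite expr2 ler_peMl// ler1n.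
  apply: nondecreasing_cvg_mu => //; first exact: bigcup_measurable.
  move=> i j ij; apply/subsetPset => p [Fp pi]; split => //.
  apply: cball_sub pi; rewrite lerXn2r ?nnegrE ?ler_nat//.
apply: (@le_trans _ _ (lam (F `|` (E `\` F)))).
  apply: le_measure; rewrite ?inE//; first by apply: measurableU => //; exact: measurableD.
  by move=> p Ep; have [Fp|nFp] := pselect (F p); [left|right].
apply: le_trans (measureU2 _ mF _) _; first exact: measurableD.
by rewrite leeD2l.
Qed.

Lemma chart_family_lower (A : set (bor 'rV[R]_N)) : measurable A ->
  ((hratio * J)%:E * \sum_i lam (D `&` g i @^-1` A) <=
    hausdorff3 (A `&` \bigcup_i g i @` D))%E.
Proof.
move=> mA; have hJ0 : 0 < hratio * J by rewrite mulr_gt0// hratio_gt0.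
rewrite muleC -lee_pdivlMr//.
set H := hausdorff3 _.
apply/lee_addgt0Pr => d d0.
pose n := #|I|%:R : R.
(* The error d is shared by the n indices; n + 1 keeps the quotient meaningful when I is empty. *)
have dn0 : 0 < d / (n + 1) by rewrite divr_gt0// ltr_wpDl.
have mE i : measurable (D `&` g i @^-1` A : set (bor E3)) by exact: measurable_chart.
have /choice[K HK] := fun i => lam_compact_approx (mE i) dn0.
have /choice[l Hl] : forall i, exists l : \bar R,
    lam (K i m) @[m --> \oo] --> l /\ (lam (D `&` g i @^-1` A) <= l + (d / (n + 1))%:E)%E.
  by move=> i; have [_ _ _ [l h1 h2]] := HK i; exists l.
have lim : (\sum_i l i <= H * (hratio * J)^-1%:E)%E.
  have cl : (\sum_i lam (K i m))%E @[m --> \oo] --> (\sum_i l i)%E.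
    apply: cvg_nnesum => [i _|i _]; first by apply: nearW => m; exact: measure_ge0.
    exact: (Hl i).1.
  rewrite -(cvg_lim _ cl)//; apply: lime_le; first by apply/cvg_ex; eexists; exact: cl.
  apply: nearW => m; apply: le_cube_factor.
    by rewrite mule_ge0 ?hausdorff3_ge0// lee_fin invr_ge0 ltW.
  move=> e e0.
  have cK i : compact (K i m) by have [] := HK i.
  have KE i : K i m `<=` D `&` g i @^-1` A by have [] := HK i.
  have KD i : K i m `<=` D by move=> p /KE[].
  apply: le_trans (chart_compact e0 cK KD) _.
  rewrite EFinM -muleA; apply: lee_wpmul2l; first by rewrite lee_fin exprn_ge0// addr_ge0// ltW.
  rewrite muleC; apply: lee_wpmul2r; first by rewrite lee_fin invr_ge0 ltW.
  apply: hausdorff3_mono => _ [i _ [p /KE[Dp Ap] <-]]; split => //.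
  by exists i => //; exists p.
apply: le_trans (leeD2r d%:E lim).
apply: (@le_trans _ _ (\sum_i (l i + (d / (n + 1))%:E))%E).
  by apply: lee_sum => i _; exact: (Hl i).2.
rewrite big_split/= leeD2l// sumEFin lee_fin sumr_const -[leLHS]mulr_natl -/n.
by rewrite mulrA ler_pdivrMr ?ltr_wpDl// mulrC ler_pM2l// lerDl.
Qed.

(* Near the diagonal a chart is (1 + e)-bi-Lipschitz to the linear map [diag3 a]
   with a1 a2 a3 = J, so [hausdorff3_flat] bounds the measure from above and the
   isodiametric inequality, fed to the mass distribution principle on compact
   pieces, bounds it from below. *)
Theorem chart_family (A : set (bor 'rV[R]_N)) : measurable A ->
  hausdorff3 (A `&` \bigcup_i g i @` D) =
  ((hratio * J)%:E * \sum_i lam (D `&` g i @^-1` A))%E.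
Proof.
by move=> mA; apply/eqP; rewrite eq_le chart_family_upper//= chart_family_lower.
Qed.

End chart.

(** * Polar charts of cones *)

Section lipschitz_continuity.
Variable R : realType.
Local Notation E3 := (R * R * R)%type.

Lemma mx_norm_le_enorm n (x : 'rV[R]_n) : `|x| <= enorm x.
Proof.
rewrite /Num.Def.normr/= mx_normrE; apply: bigmax_le => [|[i j] _]; first exact: enorm_ge0.
by rewrite ord1; exact: enorm_coord.
Qed.

Lemma lipschitz_continuous n (f : E3 -> 'rV[R]_n) (L : R) : 0 < L ->
  (forall p q, enorm (f p - f q) ^+ 2 <= L * distsq p q) -> continuous f.
Proof.
move=> L0 fL p; apply/cvgrPdist_le => e e0.
have e2 : 0 < e ^+ 2 / L by rewrite divr_gt0// exprn_gt0.
have cd : distsq p z @[z --> p] --> distsq p p.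
  have ct : continuous (fun z : E3 => ((p.1.1 - z.1.1, p.1.2 - z.1.2), p.2 - z.2)).
    apply: continuous_triple => z; apply: cvgB; try exact: cvg_cst.
    - exact: continuous_coord1.
    - exact: continuous_coord2.
    - exact: continuous_coord3.
  have := @continuous_comp _ _ _ _ (@normsq R) p (ct p).
  by apply; exact: continuous_normsq.
have dpp : distsq p p < e ^+ 2 / L by rewrite /distsq !subrr expr0n/= !addr0.
apply: filterS (cvgr_lt _ cd _ dpp) => z zp.
apply: le_trans (mx_norm_le_enorm _) _; rewrite enorm_le ?(ltW e0)//.
apply: le_trans (fL _ _) _; move: zp; rewrite ltr_pdivlMr// mulrC => /ltW; exact.
Qed.

Lemma cvg_triple (T : Type) (F : set_system T) (FF : Filter F) (f g h : T -> R)
    (a b c : R) : f x @[x --> F] --> a -> g x @[x --> F] --> b ->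
  h x @[x --> F] --> c ->
  ((f x, g x), h x) @[x --> F] --> (((a, b), c) : E3).
Proof.
move=> fa gb hc; apply: (@cvg_pair _ _ _ F (nbhs (a, b)) (nbhs c)) => //.
exact: (@cvg_pair _ _ _ F (nbhs a) (nbhs b)).
Qed.

End lipschitz_continuity.

Section sinc.
Variable R : realType.

Definition sinc (x : R) := if x == 0 then 1 else sin x / x.

Lemma sincM x : sinc x * x = sin x.
Proof.
rewrite /sinc; have [->|x0] := eqVneq; first by rewrite mulr0 sin0.
by rewrite divfK.
Qed.

Lemma sinc_gt0 x : - pi < x < pi -> 0 < sinc x.
Proof.
move=> /andP[x1 x2]; rewrite /sinc; case: ifPn => // x0.
have pos y : 0 < y -> y < pi -> 0 < sin y / y.
  by move=> y0 yp; rewrite divr_gt0// sin_gt0_pi// y0.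
have [xl|xg|xe] := ltgtP x 0; last by rewrite xe eqxx in x0.
  by rewrite -mulrNN -invrN -sinN pos ?oppr_gt0// ltrNl.
exact: pos.
Qed.

Lemma continuous_sinc : continuous sinc.
Proof.
move=> x; have [->|x0] := eqVneq x 0; last first.
  have nx : \forall y \near x, sin y / y = sinc y.
    have : nbhs (x : R) [set y | y != 0].
      by apply: open_nbhs_nbhs; split; [exact: open_neq|].
    by apply: filterS => y y0; rewrite /sinc (negbTE y0).
  rewrite /continuous_at -(nbhs_singleton nx); apply: cvg_trans (near_eq_cvg nx) _.
  by apply: cvgM; [exact: continuous_sin|exact: cvgV].
apply/continuous_withinNx; rewrite /sinc eqxx.
(* The limit of sin h / h at 0 is the derivative of sin there. *)
have := @derivable_sin R 0; have [ds] := @is_derive_sin R 0.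
rewrite cos0 => d0 /cvg_ex[l]. 
move=> cl; have <- : l = 1 by rewrite -d0 /derive; apply/esym/cvg_lim.
apply: cvg_trans cl; apply: near_eq_cvg.
near=> h; have h0 : h != 0 by near: h; exact: nbhs_dnbhs_neq.
by rewrite (negbTE h0) /= addr0 sin0 subr0 [_%:A]mulr1 [RHS]mulrC.
Unshelve. all: by end_near. Qed.

(** Squared ratio of chord to arc on the unit circle. It writes 2 (1 - cos x) as a continuous
    multiple of x^2, positive for |x| < 2 pi. *)
Definition chord (x : R) := sinc (x / 2) ^+ 2.

Lemma chordM x : chord x * x ^+ 2 = 2 * (1 - cos x).
Proof.
have -> : chord x * x ^+ 2 = 4 * (sinc (x / 2) * (x / 2)) ^+ 2.
  by rewrite /chord; field.
rewrite sincM sin2cos2 [in RHS](splitr x) -mulr2n cos_mulr2n.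
by rewrite !mulr2n; ring.
Qed.

Lemma chord_gt0 x : - (2 * pi) < x < 2 * pi -> 0 < chord x.
Proof.
move=> /andP[x1 x2]; rewrite exprn_gt0// sinc_gt0//; apply/andP; split; lra.
Qed.

Lemma continuous_chord : continuous chord.
Proof.
move=> x; apply: (@continuous_comp _ _ _ (fun x : R => sinc (x / 2)) (fun y : R => y ^+ 2));
  last exact: exprn_continuous.
apply: (@continuous_comp _ _ _ (fun x : R => x / 2) sinc);
  last exact: continuous_sinc.
by apply: cvgMl.
Qed.

End sinc.

Section cube_root.
Variable R : realType.

(** With this form the radius is positive at every point; it inverts the cube on positive
    arguments. *)
Definition cbrt (x : R) := expR (ln x / 3).

Lemma cbrt_gt0 x : 0 < cbrt x. Proof. exact: expR_gt0. Qed.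

Lemma cbrtK x : 0 < x -> cbrt x ^+ 3 = x.
Proof. by move=> x0; rewrite -expRM_natr divfK ?pnatr_eq0// lnK. Qed.

Lemma exprK3 x : 0 < x -> cbrt (x ^+ 3) = x.
Proof.
move=> x0; rewrite /cbrt lnXn// -[ln x *+ 3]mulr_natr mulfK ?pnatr_eq0//.
by rewrite lnK.
Qed.

Lemma continuous_cbrt x : 0 < x -> {for x, continuous cbrt}.
Proof.
move=> x0; apply: (@continuous_comp _ _ _ (fun x => ln x / 3) expR); last exact: continuous_expR.
by apply: cvgMl; exact: continuous_ln.
Qed.

End cube_root.

Section polar.
Variable R : realType.
Local Notation E3 := (R * R * R)%type.
Implicit Types p q z : E3.

(* Volume-preserving polar coordinates: cube of the radius, cosine of the polar
   angle, azimuth. *)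
Definition radius p := cbrt p.1.1.
Definition colat p := Num.sqrt (1 - p.1.2 ^+ 2).
Definition polar p : E3 :=
  ((radius p * p.1.2, radius p * colat p * cos p.2), radius p * colat p * sin p.2).
Definition pdom : set E3 :=
  [set p | [/\ 0 < p.1.1, -1 < p.1.2 < 1 & - pi < p.2 < pi]].

Lemma radius_gt0 p : 0 < radius p. Proof. exact: cbrt_gt0. Qed.

Lemma lt1_sqr (t : R) : -1 < t < 1 -> 0 < 1 - t ^+ 2.
Proof.
move=> /andP[h1 h2]; rewrite (_ : 1 - t ^+ 2 = (1 - t) * (1 + t)); last by ring.
by rewrite mulr_gt0 ?subr_gt0//; lra.
Qed.

Lemma colat_gt0 p : pdom p -> 0 < colat p.
Proof. by case=> _ /lt1_sqr h _; rewrite sqrtr_gt0. Qed.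

Lemma colat_sqr p : pdom p -> colat p ^+ 2 = 1 - p.1.2 ^+ 2.
Proof. by case=> _ /lt1_sqr h _; rewrite sqr_sqrtr// ltW. Qed.

Lemma open_pdom : open pdom.
Proof.
have -> : pdom = (((fun p => p.1.1) @^-1` `]0, +oo[%classic `&`
   (fun p => p.1.2) @^-1` `]-1, 1[%classic) `&`
   (fun p => p.2) @^-1` `](- pi), pi[%classic : set E3).
  apply/seteqP; split => [p [h1 h2 h3]|p [[]]] /=.
    by split; [split|]; rewrite /preimage/= in_itv/= ?andbT.
  by rewrite /preimage/= !in_itv/= andbT.
by apply: openI; [apply: openI|]; apply: open_comp => [p _|];
  try exact: interval_open; [exact: continuous_coord1|exact: continuous_coord2|
  exact: continuous_coord3].
Qed.

Lemma normsq_polar p : pdom p -> normsq (polar p) = radius p ^+ 2.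
Proof.
move=> /colat_sqr s2; rewrite /normsq/= !exprMn s2.
have := cos2Dsin2 p.2; set c := cos _ ^+ 2; set s := sin _ ^+ 2 => cs.
rewrite -addrA -mulrDr cs; ring.
Qed.

(** The polar axis and the half-plane of azimuth pi, which the open domain misses, both lie in the
    plane z.2 = 0; leaving out the whole plane is harmless because it is null. *)
Lemma polar_surj z : z.2 != 0 -> exists2 p, pdom p & polar p = z.
Proof.
case: z => [[z1 z2] z3]/= z30.
have z32 : 0 < z3 ^+ 2 by rewrite lt_neqAle sqr_ge0 andbT eq_sym sqrf_eq0.
pose n2 := z1 ^+ 2 + z2 ^+ 2 + z3 ^+ 2.
have n20 : 0 < n2 by rewrite ltr_wpDl// addr_ge0// sqr_ge0.
pose r := Num.sqrt n2.
have r0 : 0 < r by rewrite sqrtr_gt0.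
have r2 : r ^+ 2 = n2 by rewrite sqr_sqrtr// ltW.
pose t := z1 / r.
have t2 : 1 - t ^+ 2 = (z2 ^+ 2 + z3 ^+ 2) / n2.
  by rewrite /t expr_div_n r2 /n2; field; rewrite gt_eqF.
pose s := Num.sqrt (1 - t ^+ 2).
have m0 : 0 < z2 ^+ 2 + z3 ^+ 2 by rewrite ltr_wpDl// sqr_ge0.
have t20 : 0 < 1 - t ^+ 2 by rewrite t2 divr_gt0.
have s0 : 0 < s by rewrite sqrtr_gt0.
have s2 : s ^+ 2 = (z2 ^+ 2 + z3 ^+ 2) / n2 by rewrite sqr_sqrtr ?(ltW t20).
have sqlt (x : R) : 0 < 1 - x ^+ 2 -> -1 < x < 1.
  rewrite subr_gt0 -ltr_norml => h; rewrite -(ltr_pXn2r (n := 2)) ?nnegrE//.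
  by rewrite expr1n -normrX ger0_norm// sqr_ge0.
pose c := z2 / (r * s).
have rs2 : (r * s) ^+ 2 = z2 ^+ 2 + z3 ^+ 2.
  by rewrite exprMn r2 s2 mulrC divfK// gt_eqF.
have rs0 : 0 < r * s by rewrite mulr_gt0.
have c2 : 1 - c ^+ 2 = (z3 / (r * s)) ^+ 2.
  rewrite /c !expr_div_n rs2; field; rewrite gt_eqF//.
have zrs0 : z3 / (r * s) != 0 by rewrite mulf_neq0// invr_eq0 gt_eqF.
have c20 : 0 < 1 - c ^+ 2 by rewrite c2 lt_neqAle sqr_ge0 andbT eq_sym sqrf_eq0.
have /andP[c_gt c_lt] := sqlt c c20.
have c_le : -1 <= c <= 1 by rewrite !ltW.
have a0 : 0 < acos c by rewrite acos_gt0// (ltW c_gt) c_lt.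
have api : acos c < pi by rewrite acos_ltpi// (ltW c_lt) c_gt.
have ca : cos (acos c) = c by rewrite acosK// in_itv.
have sa : sin (acos c) = `|z3 / (r * s)| by rewrite sin_acos// c2 sqrtr_sqr.
pose phi := if 0 < z3 then acos c else - acos c.
have cphi : cos phi = c by rewrite /phi; case: ifP; rewrite ?cosN.
have sphi : sin phi = z3 / (r * s).
  rewrite /phi; case: ifPn => z3s; rewrite ?sinN sa.
    by rewrite ger0_norm// divr_ge0// ltW.
  rewrite normrM (gtr0_norm (_ : 0 < (r * s)^-1)) ?invr_gt0// ler0_norm ?leNgt//.
  by rewrite mulNr opprK.
exists ((r ^+ 3, t), phi); first split => /=.
- exact: exprn_gt0.
- exact: sqlt.
- by rewrite /phi; case: ifP => _; apply/andP; split; lra.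
rewrite /polar /radius /colat/= exprK3// -/s cphi sphi.
by congr ((_, _), _); rewrite mulrC divfK// gt_eqF.
Qed.

Lemma continuous_radius p : pdom p -> {for p, continuous radius}.
Proof.
move=> Dp; apply: (@continuous_comp _ _ _ (fun p : E3 => p.1.1) (@cbrt R)).
  exact: continuous_coord1.
by apply: continuous_cbrt; case: Dp.
Qed.

Lemma continuous_colat : continuous colat.
Proof.
move=> p; apply: (@continuous_comp _ _ _ (fun p : E3 => 1 - p.1.2 ^+ 2) Num.sqrt);
  last exact: sqrt_continuous.
apply: cvgB; first exact: cvg_cst.
apply: (@continuous_comp _ _ _ (fun p : E3 => p.1.2) (fun x : R => x ^+ 2)).
  exact: continuous_coord2.
exact: exprn_continuous.
Qed.

Lemma colat_den_gt0 p q : pdom p -> pdom q ->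
  0 < 1 - p.1.2 * q.1.2 + colat p * colat q.
Proof.
move=> Dp Dq; apply: ltr_pwDr; first by apply: mulr_gt0; exact: colat_gt0.
case: Dp => _ /andP[h1 h2] _; case: Dq => _ /andP[h3 h4] _; nra.
Qed.

(** Origin of the diagonal metric. With r, t, s the radius, cosine and sine of the colatitude: r^3 -
    r'^3 is divisible by r - r'; since s^2 = 1 - t^2, (t - t')^2 is the product of 1 - t t' + s s'
    and 1 - t t' - s s'; the law of cosines and [chordM] give the azimuth. At p = q the coefficients
    are k / (9 r^4), r^2 / s^2 and r^2 s^2, of product k / 9, whence the Jacobian sqrt k / 3. *)
Lemma distsq_polar k p q : pdom p -> pdom q ->
  distsq (polar p) (polar q) + (k - 1) * (radius p - radius q) ^+ 2 =
  k / (radius p ^+ 2 + radius p * radius q + radius q ^+ 2) ^+ 2 *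
    (p.1.1 - q.1.1) ^+ 2 +
  2 * radius p * radius q / (1 - p.1.2 * q.1.2 + colat p * colat q) *
    (p.1.2 - q.1.2) ^+ 2 +
  radius p * radius q * colat p * colat q * chord (p.2 - q.2) *
    (p.2 - q.2) ^+ 2.
Proof.
move=> Dp Dq.
have s0 := colat_gt0 Dp; have s0' := colat_gt0 Dq.
have s2 := colat_sqr Dp; have s2' := colat_sqr Dq.
have r0 := radius_gt0 p; have r0' := radius_gt0 q.
rewrite -[_ * chord _ * _]mulrA chordM cosB.
have <- : (radius p) ^+ 3 = p.1.1 by case: Dp => h _ _; exact: cbrtK.
have <- : (radius q) ^+ 3 = q.1.1 by case: Dq => h _ _; exact: cbrtK.
have tt := colat_den_gt0 Dp Dq.
rewrite /distsq/=.
have := cos2Dsin2 p.2; have := cos2Dsin2 q.2.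
move: (cos _) (sin _) (cos _) (sin _) s0 s0' s2 s2' r0 r0' tt => c S c' S'.
move: (colat p) (colat q) (radius p) (radius q) (p.1.2) (q.1.2) => s s' r r' t t'.
move=> s0 s0' s2 s2' r0 r0' tt e e'.
have d0 : 0 < r ^+ 2 + r * r' + r' ^+ 2 by rewrite !addr_gt0// ?exprn_gt0// mulr_gt0.
have -> : k / (r ^+ 2 + r * r' + r' ^+ 2) ^+ 2 * (r ^+ 3 - r' ^+ 3) ^+ 2 =
    k * (r - r') ^+ 2 by field; rewrite gt_eqF.
have -> : 2 * r * r' / (1 - t * t' + s * s') * (t - t') ^+ 2 =
    2 * r * r' * (1 - t * t' - s * s').
  have -> : (t - t') ^+ 2 = (1 - t * t' + s * s') * (1 - t * t' - s * s').
    have -> : (1 - t * t' + s * s') * (1 - t * t' - s * s') =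
      (1 - t * t') ^+ 2 - s ^+ 2 * s' ^+ 2 by ring.
    by rewrite s2 s2'; ring.
  by field; rewrite gt_eqF.
have -> : (r * t - r' * t') ^+ 2 + (r * s * c - r' * s' * c') ^+ 2 +
  (r * s * S - r' * s' * S') ^+ 2 =
  r ^+ 2 * t ^+ 2 + r ^+ 2 * s ^+ 2 * (c ^+ 2 + S ^+ 2) +
  (r' ^+ 2 * t' ^+ 2 + r' ^+ 2 * s' ^+ 2 * (c' ^+ 2 + S' ^+ 2)) -
  2 * r * r' * (t * t' + s * s' * (c * c' + S * S')) by ring.
by rewrite e e' s2 s2'; ring.
Qed.

Lemma continuous_polar p : pdom p -> {for p, continuous polar}.
Proof.
move=> Dp; have cr := continuous_radius Dp; have cs := @continuous_colat p.
apply: cvg_triple.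
- by apply: cvgM => //; exact: continuous_coord2.
- apply: cvgM; first exact: cvgM.
  apply: (@continuous_comp _ _ _ (fun p : E3 => p.2) (@cos R)).
    exact: continuous_coord3.
  exact: continuous_cos.
- apply: cvgM; first exact: cvgM.
  apply: (@continuous_comp _ _ _ (fun p : E3 => p.2) (@sin R)).
    exact: continuous_coord3.
  exact: continuous_sin.
Qed.

Definition nrm z := Num.sqrt (normsq z).

Lemma normsq_ge0 z : 0 <= normsq z.
Proof. by rewrite !addr_ge0// sqr_ge0. Qed.

Lemma nrm_sqr z : nrm z ^+ 2 = normsq z.
Proof. by rewrite sqr_sqrtr// normsq_ge0. Qed.

Lemma nrm_polar p : pdom p -> nrm (polar p) = radius p.
Proof. by move=> Dp; rewrite /nrm normsq_polar// sqrtr_sqr gtr0_norm// radius_gt0. Qed.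

(** Cauchy-Schwarz, by Lagrange's identity for the sum of squared two-by-two minors. *)
Lemma dist_nrm_le z z' : (nrm z - nrm z') ^+ 2 <= distsq z z'.
Proof.
have -> : distsq z z' = normsq z + normsq z' -
    2 * (z.1.1 * z'.1.1 + z.1.2 * z'.1.2 + z.2 * z'.2).
  by rewrite /distsq /normsq; ring.
rewrite -!nrm_sqr sqrrB mulr2n.
suff : z.1.1 * z'.1.1 + z.1.2 * z'.1.2 + z.2 * z'.2 <= nrm z * nrm z' by lra.
apply: le_trans (ler_norm _) _; rewrite -sqrtr_sqr -sqrtrM ?normsq_ge0//.
apply: ler_wsqrtr; rewrite -subr_ge0 /normsq.
rewrite (_ : _ - _ = (z.1.1 * z'.1.2 - z.1.2 * z'.1.1) ^+ 2 +
  (z.1.1 * z'.2 - z.2 * z'.1.1) ^+ 2 + (z.1.2 * z'.2 - z.2 * z'.1.2) ^+ 2);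
  last by ring.
by rewrite !addr_ge0// sqr_ge0.
Qed.

End polar.

Section cone.
Variables (R : realType) (N : nat) (I : finType).
Local Notation E3 := (R * R * R)%type.
Local Notation lam := (@lam R).
Local Notation hratio := (hratio R).
Variables (G : I -> E3 -> 'rV[R]_N) (k : R).
Hypothesis k1 : 1 <= k.
Hypothesis G_dist : forall i z z', enorm (G i z - G i z') ^+ 2 =
  distsq z z' + (k - 1) * (nrm z - nrm z') ^+ 2.
Hypothesis G_sep : forall i j z z', i != j -> 0 < normsq z -> 0 < normsq z' ->
  G i z <> G j z'.

Let k0 : 0 < k := lt_le_trans ltr01 k1.

Lemma cone_lipschitz i z z' : enorm (G i z - G i z') ^+ 2 <= k * distsq z z'.
Proof.
have := dist_nrm_le z z'; rewrite G_dist => h.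
have := ler_wpM2l (_ : 0 <= k - 1) h; rewrite subr_ge0 => /(_ k1); lra.
Qed.

Lemma cone_continuous i : continuous (G i).
Proof. exact: lipschitz_continuous k0 (cone_lipschitz i). Qed.

(** G i is Lipschitz with constant sqrt k by [cone_lipschitz], and [chart_upper] for the flat chart
    [iota3] shows that Z has Hausdorff measure 0 in R^3. *)
Lemma cone_null i (Z : set (bor E3)) : measurable Z -> lam Z = 0%E ->
  hausdorff3 (G i @` Z) = 0%E.
Proof.
move=> mZ Z0; apply/eqP; rewrite eq_le hausdorff3_ge0 andbT.
have sk0 : 0 < Num.sqrt k by rewrite sqrtr_gt0.
apply: le_trans (@hausdorff3_lipschitz R _ _ _ Z (@iota3 R) (G i) _ sk0 _) _.
  move=> p q _ _; rewrite enorm_le ?mulr_ge0 ?enorm_ge0 ?sqrtr_ge0//.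
  by rewrite exprMn enorm_iota3B (sqr_sqrtr (ltW k0)); exact: cone_lipschitz.
apply: mule_ge0_le0; first by rewrite lee_fin exprn_ge0// sqrtr_ge0.
apply: le_trans (@chart_upper R 3 unit setT (fun _ => @iota3 R) 1
  (fun _ _ => 1) (fun _ _ => 1) (fun _ _ => 1) (@openT _) ltr01 _ _ _ _ tt Z mZ _) _ => //.
- by move=> _ p q _ _; rewrite enorm_iota3B !mul1r.
- by move=> p q _ _; split; exact: cvg_cst.
- by move=> p _; rewrite !mulr1 expr1n.
- by rewrite Z0 mule0.
Qed.

(** The area formula for the charts G i composed with [polar]. Distinct sheets are separated only
    away from the apex, which the polar domain avoids since the radius is positive there. *)
Theorem cone_area (A : set (bor 'rV[R]_N)) : measurable A ->
  hausdorff3 (A `&` \bigcup_i range (G i)) =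
  ((hratio * (Num.sqrt k / 3))%:E *
    \sum_i lam (@pdom R `&` (G i \o @polar R) @^-1` A))%E.
Proof.
move=> mA; set H := hausdorff3 _; set H' := (_ * _)%E.
have chart : hausdorff3 (A `&` \bigcup_i (G i \o @polar R) @` @pdom R) = H'.
  apply: (@chart_family R N I (@pdom R) (fun i => G i \o @polar R)
  (Num.sqrt k / 3)
  (fun p q => k / (radius p ^+ 2 + radius p * radius q + radius q ^+ 2) ^+ 2)
  (fun p q => 2 * radius p * radius q / (1 - p.1.2 * q.1.2 + colat p * colat q))
  (fun p q => radius p * radius q * colat p * colat q * chord (p.2 - q.2))) mA.
  - exact: open_pdom.
  - by rewrite divr_gt0// sqrtr_gt0.
  - move=> i p q Dp Dq; rewrite /= G_dist !nrm_polar//; exact: distsq_polar.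
  - move=> p q Dp Dq; have r0 := radius_gt0 p; have r0' := radius_gt0 q.
    have s0 := colat_gt0 Dp; have s0' := colat_gt0 Dq.
    split.
    + by rewrite divr_gt0// exprn_gt0// !addr_gt0 ?exprn_gt0// mulr_gt0.
    + by rewrite divr_gt0 ?colat_den_gt0// !mulr_gt0.
    + apply: mulr_gt0; first by rewrite !mulr_gt0.
      apply: chord_gt0; case: Dp Dq => [_ _ /andP[h1 h2]] [_ _ /andP[h3 h4]].
      by apply/andP; split; lra.
  - move=> p q Dp Dq.
    have c1 (T : topologicalType) (f : E3 -> T) : {for p, continuous f} ->
        f z.1 @[z --> (p, q)] --> f p.
      by move=> fp; apply: (@cvg_comp _ _ _ fst f _ (nbhs p)) => //; exact: cvg_fst.
    have c2 (T : topologicalType) (f : E3 -> T) : {for q, continuous f} ->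
        f z.2 @[z --> (p, q)] --> f q.
      by move=> fq; apply: (@cvg_comp _ _ _ snd f _ (nbhs q)) => //; exact: cvg_snd.
    have r1 := c1 _ _ (continuous_radius Dp); have r2 := c2 _ _ (continuous_radius Dq).
    have s1 := c1 _ _ (@continuous_colat R p); have s2 := c2 _ _ (@continuous_colat R q).
    have t1 := c1 _ _ (@continuous_coord2 R p); have t2 := c2 _ _ (@continuous_coord2 R q).
    have f1 := c1 _ _ (@continuous_coord3 R p); have f2 := c2 _ _ (@continuous_coord3 R q).
    have r0 := radius_gt0 p; have r0' := radius_gt0 q.
    split.
    + apply: cvgM; first exact: cvg_cst.
      apply: cvgV; first by rewrite gt_eqF// exprn_gt0// !addr_gt0 ?exprn_gt0// mulr_gt0.
      have sq (f : E3 * E3 -> R) (a : R) : f z @[z --> (p, q)] --> a ->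
        f z ^+ 2 @[z --> (p, q)] --> a ^+ 2 by move=> fa; exact: cvgM.
      by apply: (sq); apply: cvgD; [apply: cvgD; [exact: sq|exact: cvgM]|exact: sq].
    + apply: cvgM; first by apply: cvgM => //; apply: cvgM => //; exact: cvg_cst.
      apply: cvgV; first by rewrite gt_eqF// colat_den_gt0.
      apply: cvgD; last exact: cvgM.
      by apply: cvgB; [exact: cvg_cst|exact: cvgM].
    + apply: cvgM; first by do 2 (apply: cvgM => //); exact: cvgM.
      apply: (@cvg_comp _ _ _ (fun z : E3 * E3 => z.1.2 - z.2.2) (@chord R) _ (nbhs (p.2 - q.2))).
        exact: cvgB.
      exact: continuous_chord.
  - move=> p Dp; rewrite subrr /chord /sinc mul0r eqxx expr1n mulr1.
    have r0 := radius_gt0 p; have s0 := colat_gt0 Dp.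
    rewrite -[p.1.2 * _]expr2 -colat_sqr// expr_div_n (sqr_sqrtr (ltW k0)).
    move: (radius p) (colat p) r0 s0 => r s r0 s0.
    have -> : r ^+ 2 + r * r + r ^+ 2 = 3 * r ^+ 2 by ring.
    have -> : s ^+ 2 + s * s = 2 * s ^+ 2 by ring.
    by field; rewrite (gt_eqF r0) (gt_eqF s0).
  - move=> i p Dp; apply: continuous_comp; first exact: continuous_polar.
    exact: cone_continuous.
  - move=> i j p q ij Dp Dq; apply: G_sep ij _ _; rewrite normsq_polar//;
    by rewrite exprn_gt0// radius_gt0.
apply/eqP; rewrite eq_le -chart; apply/andP; split; last first.
  apply: hausdorff3_mono => x [Ax [i _ [p Dp px]]]; split => //.
  by exists i => //; exists (polar p).
(* This plane contains everything that the polar chart misses, apex included. *)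
pose Z : set (bor E3) := [set p : E3 | p.2 = 0].
have mZ : measurable Z.
  apply: closed_bor; rewrite (_ : Z = (fun p : E3 => p.2) @^-1` [set x | x = 0])//.
  apply: closed_comp; last exact: closed_eq.
  by move=> p _; exact: continuous_coord3.
rewrite -[leRHS]adde0.
apply: (@le_trans _ _ (hausdorff3 (A `&` \bigcup_i (G i \o @polar R) @` @pdom R) +
    hausdorff3 (\big[setU/set0]_i (G i @` Z)))%E).
  apply: le_trans (hausdorff3_setU _ _); apply: hausdorff3_mono.
  move=> x [Ax [i _ [z _ zx]]]; have [z0|z0] := eqVneq z.2 0.
    by right; rewrite -bigcup_seq; exists i; [rewrite /= mem_index_enum|exists z].
  have [p Dp pz] := polar_surj z0.
  by left; split => //; exists i => //; exists p => //=; rewrite pz.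
apply: leeD2l; apply: le_trans (hausdorff3_bigsetU _) _.
by rewrite big1// => i _; apply: cone_null => //; exact: lam_plane3.
Qed.

End cone.

(** * Balls centred on the cone *)

Section flat_ball.
Variable R : realType.
Local Notation E3 := (R * R * R)%type.
Local Notation lam := (@lam R).
Local Notation hratio := (hratio R).
Implicit Types z : E3.

Lemma iota3_surj (x : 'rV[R]_3) : exists z, iota3 z = x.
Proof.
exists ((x 0 0, x 0 1), x 0 2%:R); apply/rowP => i; rewrite mxE.
by case: i => -[|[|[|//]]] i3 /=; congr (x 0 _); apply/val_inj.
Qed.

Lemma hausdorff3_iota3 (A : set (bor 'rV[R]_3)) : measurable A ->
  hausdorff3 A = (hratio%:E * lam (@iota3 R @^-1` A))%E.
Proof.
move=> mA.
have -> : hausdorff3 A = ((hratio * 1)%:E * \sum_(i : unit)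
    lam (setT `&` @iota3 R @^-1` A))%E; last first.
  by rewrite mulr1 (big_pred1 tt) ?setTI// => -[].
rewrite [in LHS](_ : A = A `&` \bigcup_(i : unit) @iota3 R @` setT); last first.
  apply/esym/seteqP; split => [x []//|x Ax]; split => //; exists tt => //.
  by have [z zx] := iota3_surj x; exists z.
apply: (@chart_family R 3 unit setT (fun _ => @iota3 R) 1
  (fun _ _ => 1) (fun _ _ => 1) (fun _ _ => 1) (@openT _) ltr01) => //.
- by move=> _ p q _ _; rewrite enorm_iota3B !mul1r.
- by move=> p q _ _; split; exact: cvg_cst.
- by move=> p _; rewrite !mulr1 expr1n.
- move=> _ p _; apply: (@lipschitz_continuous R 3 (@iota3 R) 1 ltr01).
  by move=> q q'; rewrite mul1r enorm_iota3B.
Qed.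

Definition axis (a : R) : E3 := ((a, 0), 0).

(** The ball of radius r about (a, 0, 0) in polar coordinates, by the law of cosines. *)
Definition pball (a r : R) : set E3 :=
  [set p | pdom p /\ radius p ^+ 2 + a ^+ 2 - 2 * a * radius p * p.1.2 <= r ^+ 2].

Lemma distsq_polar_axis p a : pdom p ->
  distsq (polar p) (axis a) = radius p ^+ 2 + a ^+ 2 - 2 * a * radius p * p.1.2.
Proof.
move=> Dp; have := normsq_polar Dp; rewrite /normsq /distsq /= !subr0 => <-.
ring.
Qed.

Lemma measurable_pball a r : measurable (pball a r : set (bor E3)).
Proof.
rewrite (_ : pball a r = @pdom R `&` @polar R @^-1` [set z | distsq z (axis a) <= r ^+ 2]).
  apply: bor_preimage; first exact: open_pdom.
    by move=> p; exact: continuous_polar.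
  rewrite (_ : [set z | _] = (fun z => affine3 ((1, 1), 1) ((- a, 0), 0) z) @^-1` cball (r ^+ 2)).
    by apply: bor_preimageT; [exact: continuous_affine3|exact: measurable_cball].
  by apply/seteqP; split => z; rewrite /affine3 /cball /normsq /distsq /preimage/= !mul1r !addr0 !subr0.
by apply/seteqP; split => p [Dp] h; split => //; move: h; rewrite /preimage/= distsq_polar_axis.
Qed.

Lemma measurable_eball n (x : 'rV[R]_n) r : measurable (eball x r : set (bor 'rV[R]_n)).
Proof. by apply: closed_bor; exact: closed_eball. Qed.

(* Comparing the flat and the polar chart of R^3 evaluates the left-hand side
   without computing any integral. *)
Lemma hratio_pball a r : 0 < r ->
  ((hratio / 3)%:E * lam (pball a r) = (bvol R * r ^+ 3)%:E)%E.
Proof.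
move=> r0; pose B := eball (iota3 (axis a)) r.
have BE z : B (iota3 z) <-> distsq z (axis a) <= r ^+ 2.
  by rewrite /B /eball/= enorm_le ?(ltW r0)// enorm_iota3B.
have mB : measurable (B : set (bor 'rV[R]_3)) by exact: measurable_eball.
have h1 := hausdorff3_iota3 mB.
have := @cone_area R 3 unit (fun _ => @iota3 R) 1 (lexx _) _ _ B mB.
rewrite sqrtr1 (big_pred1 tt) => [|[]//].
rewrite (_ : B `&` _ = B); last first.
  apply/seteqP; split => [x []//|x Bx]; split => //; exists tt => //.
  by have [z zx] := iota3_surj x; exists z.
rewrite (_ : pdom (R := R) `&` _ = pball a r); last first.
  apply/seteqP; split => p [Dp] h; split => //; move: h; rewrite /preimage/= BE distsq_polar_axis//.
rewrite mul1r => <-.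
- rewrite h1 (_ : _ @^-1` _ = affine3 ((1, 1), 1) ((- a, 0), 0) @^-1` cball (r ^+ 2)).
    rewrite lam_affine//=; last exact: measurable_cball.
    rewrite lam_cball// !mulr1 invr1 mul1e -EFinM /hratio mulrA divfK// gt_eqF//.
    exact: vball_gt0.
  apply/seteqP; split => z; rewrite /preimage/= BE /affine3 /cball /normsq /distsq/= !mul1r !addr0 !subr0//.
- by move=> _ z z'; rewrite subrr mul0r addr0 enorm_iota3B.
- by move=> [] [].
Qed.

Lemma radius_scale (s : R) p q : 0 < s -> 0 < p.1.1 -> q.1.1 = s ^+ 3 * p.1.1 ->
  radius q = s * radius p.
Proof.
move=> s0 p0 qE; rewrite /radius qE -{1}(cbrtK p0) -exprMn exprK3//.
by rewrite mulr_gt0// cbrt_gt0.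
Qed.

End flat_ball.

Section reflection.
Variable R : realType.
Local Notation E3 := (R * R * R)%type.
Implicit Types z : E3.

Definition dot3 z z' := z.1.1 * z'.1.1 + z.1.2 * z'.1.2 + z.2 * z'.2.

(* The identity if v = 0, because 2 / 0 = 0. *)
Definition householder (v z : E3) : E3 :=
  let c := 2 / normsq v * dot3 v z in
  ((z.1.1 - c * v.1.1, z.1.2 - c * v.1.2), z.2 - c * v.2).

Lemma householder_coef (v : E3) : (2 / normsq v) ^+ 2 * normsq v = 2 * (2 / normsq v).
Proof.
have [->|v0] := eqVneq (normsq v) 0; first by rewrite !mulr0 !invr0 mulr0 mulr0.
by field.
Qed.

Lemma householderK v : involutive (householder v).
Proof.
move=> z; have := householder_coef v; rewrite /householder/=.
set c := 2 / _ => cc; set d := dot3 v z.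
have -> : dot3 v ((z.1.1 - c * d * v.1.1, z.1.2 - c * d * v.1.2), z.2 - c * d * v.2) =
    d - c * d * normsq v by rewrite /d /dot3 /normsq/=; ring.
have -> : c * (d - c * d * normsq v) = - (c * d).
  have -> : c * (d - c * d * normsq v) = c * d - d * (c ^+ 2 * normsq v) by ring.
  by rewrite cc; ring.
by rewrite !mulNr !opprK !subrK; case: z {d} => -[].
Qed.

Lemma normsq_householder v z : normsq (householder v z) = normsq z.
Proof.
have := householder_coef v; rewrite /householder/=.
set c := 2 / _ => cc; set d := dot3 v z.
have -> : normsq ((z.1.1 - c * d * v.1.1, z.1.2 - c * d * v.1.2), z.2 - c * d * v.2) =
    normsq z - 2 * c * d ^+ 2 + d ^+ 2 * (c ^+ 2 * normsq v).
  by rewrite /d /dot3 /normsq/=; ring.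
by rewrite cc; ring.
Qed.

Lemma distsq_householder v z z' :
  distsq (householder v z) (householder v z') = distsq z z'.
Proof.
pose u : E3 := ((z.1.1 - z'.1.1, z.1.2 - z'.1.2), z.2 - z'.2).
rewrite -[RHS](normsq_householder v u); rewrite /distsq /normsq /householder /dot3/=.
by congr (_ ^+ 2 + _ ^+ 2 + _ ^+ 2); ring.
Qed.

(** Take v = z - |z| e1. Then |v|^2 = 2 <v, z>, so the coefficient of the reflection is 1 and z is
    sent to z - v = |z| e1. If v = 0, then z already is on the axis. *)
Lemma householder_axis z : exists v, householder v z = axis (nrm z).
Proof.
pose a := nrm z; pose v : E3 := ((z.1.1 - a, z.1.2), z.2); exists v.
have a2 : a ^+ 2 = normsq z by exact: nrm_sqr.
have vv : normsq v = 2 * dot3 v z.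
  have -> : normsq v = normsq z + a ^+ 2 - 2 * a * z.1.1 by rewrite /normsq/=; ring.
  by rewrite a2 /dot3 /normsq/=; ring.
have h x y w : normsq v = 0 -> v = ((x, y), w) -> [/\ x = 0, y = 0 & w = 0].
  move=> v0 ve; move: v0; rewrite ve /normsq/= => /eqP.
  by rewrite !paddr_eq0 ?addr_ge0 ?sqr_ge0// !sqrf_eq0 => /andP[/andP[/eqP-> /eqP->] /eqP->].
have [v0|v0] := eqVneq (normsq v) 0.
  have [h1 h2 h3] := h _ _ _ v0 erefl.
  rewrite /householder v0 invr0 mulr0 mul0r/= !mul0r !subr0 /axis h2 h3 -/a.
  by congr ((_, _), _); apply/eqP; rewrite -subr_eq0 h1.
have c1 : 2 / normsq v * dot3 v z = 1.
  have d0 : dot3 v z != 0 by apply: contra_neq v0 => d0; rewrite vv d0 mulr0.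
  by rewrite vv; field.
rewrite /householder c1 !mul1r/= !subrr opprB addrC subrK //.
Qed.

End reflection.

Section tiles.
Variable R : realType.
Local Notation E3 := (R * R * R)%type.
Local Notation lam := (@lam R).
Variable n : nat.
Hypothesis n0 : (0 < n)%N.

Definition tile (k : nat) : set E3 :=
  [set p | (n%:R - 2 - 2 * k%:R) / n%:R < p.1.2 < (n%:R - 2 * k%:R) / n%:R].

(** Half-open intervals of cosines partition exactly; they differ from the open tiles by null
    planes. *)
Definition htile (k : nat) : set E3 :=
  [set p | (n%:R - 2 - 2 * k%:R) / n%:R < p.1.2 <= (n%:R - 2 * k%:R) / n%:R].

Lemma measurable_plane2 (c : R) : measurable ([set p | p.1.2 = c] : set (bor E3)).
Proof.
apply: closed_bor; apply: (@closed_comp _ _ (fun p : E3 => p.1.2) [set x | x = c]).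
  by move=> p _; exact: continuous_coord2.
exact: closed_eq.
Qed.

Lemma htileE k : htile k = tile k `|` [set p | p.1.2 = (n%:R - 2 * k%:R) / n%:R].
Proof.
apply/seteqP; split => p /=.
  move=> /andP[h1]; rewrite le_eqVlt => /orP[/eqP h2|h2]; [by right|left].
  by rewrite /tile/= h1.
move=> [/andP[h1 h2]|e]; rewrite /htile/= ?e; first by rewrite h1 ltW.
by rewrite lexx andbT ltr_pM2r ?invr_gt0 ?ltr0n//; lra.
Qed.

Lemma measurable_tile k : measurable (tile k : set (bor E3)).
Proof.
apply: open_bor; rewrite (_ : tile k = (fun p => p.1.2) @^-1`
  `](n%:R - 2 - 2 * k%:R) / n%:R, (n%:R - 2 * k%:R) / n%:R[%classic).
  by apply: open_comp => [p _|]; [exact: continuous_coord2|exact: interval_open].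
by apply/seteqP; split => p; rewrite /tile /preimage/= in_itv.
Qed.

Lemma measurable_htile k : measurable (htile k : set (bor E3)).
Proof.
by rewrite htileE; apply: measurableU; [exact: measurable_tile|exact: measurable_plane2].
Qed.

Lemma lam_htile (S : set (bor E3)) k : measurable S ->
  lam (S `&` htile k) = lam (S `&` tile k).
Proof.
move=> mS; have mt := measurable_tile k; have mp := measurable_plane2 ((n%:R - 2 * k%:R) / n%:R).
apply/eqP; rewrite eq_le; apply/andP; split.
  rewrite htileE setIUr; apply: le_trans (measureU2 _ _ _) _; try exact: measurableI.
  rewrite -[leRHS]adde0; apply: leeD2l; rewrite -(lam_plane2 ((n%:R - 2 * k%:R) / n%:R)).
  by apply: le_measure; rewrite ?inE//; exact: measurableI.
apply: le_measure; rewrite ?inE//; try exact: measurableI.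
  by apply: measurableI => //; exact: measurable_htile.
by rewrite htileE => p [Sp tp]; split => //; left.
Qed.

Lemma htile_disjoint : trivIset [set: 'I_n] (fun k : 'I_n => htile k).
Proof.
apply/trivIsetP => i j _ _ ij; rewrite -subset0 => p [].
rewrite /htile/= => /andP[h1 h2] /andP[h3 h4].
have n0' : 0 < (n%:R : R) by rewrite ltr0n.
move: h1 h2 h3 h4; rewrite !ltr_pdivrMr// !ler_pdivlMr// => h1 h2 h3 h4.
have [ji|ji] : (i.+1 <= j \/ j.+1 <= i)%N.
  by move: ij; rewrite -val_eqE/= neq_ltn => /orP[]; [left|right].
- have : ((i.+1)%:R : R) <= j%:R by rewrite ler_nat.
  rewrite -natr1 => h; lra.
- have : ((j.+1)%:R : R) <= i%:R by rewrite ler_nat.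
  rewrite -natr1 => h; lra.
Qed.

Lemma htile_cover p : -1 < p.1.2 < 1 -> exists k : 'I_n, htile k p.
Proof.
move=> /andP[t1 t2]; have n0' : 0 < (n%:R : R) by rewrite ltr0n.
(* The condition of [htile k] on the cosine, solved for k, reads k <= x < k + 1. *)
pose x := n%:R * (1 - p.1.2) / 2.
have x0 : 0 <= x by rewrite divr_ge0// mulr_ge0 ?(ltW n0')// subr_ge0 ltW.
have xn : x < n%:R.
  rewrite /x -mulrA -[ltRHS]mulr1 ltr_pM2l// ltr_pdivrMr//; lra.
have /andP[k1 k2] := truncn_itv x0.
have kn : (Num.truncn x < n)%N by rewrite -(ltr_nat R); exact: le_lt_trans xn.
exists (Ordinal kn); rewrite /htile/= ltr_pdivrMr// ler_pdivlMr//.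
move: k1 k2; rewrite -natr1 /x ler_pdivlMr// ltr_pdivrMr// => k1 k2.
by apply/andP; split; lra.
Qed.

Lemma lam_tiles (S : set (bor E3)) : measurable S -> S `<=` @pdom R ->
  lam S = (\sum_(k < n) lam (S `&` tile k))%E.
Proof.
move=> mS SD; rewrite (eq_bigr (fun k : 'I_n => lam (S `&` htile k))); last first.
  by move=> k _; rewrite lam_htile.
have := @measure_bigsetU_ord _ _ _ lam n predT (fun k : 'I_n => S `&` htile k).
move=> <-; last 2 first.
- by move=> k; apply: measurableI => //; exact: measurable_htile.
- apply/trivIsetP => i j _ _ ij; have /trivIsetP/(_ i j Logic.I Logic.I ij) := htile_disjoint.
  by rewrite setIACA => ->; rewrite setI0.
congr (lam _); rewrite -bigcup_seq; apply/seteqP; split => [p Sp|p [k _ []//]].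
have [_ tp _] := SD _ Sp; have [k hk] := htile_cover tp.
by exists k => //=; rewrite mem_index_enum.
Qed.

End tiles.

Section sheets.
Variable R : realType.
Local Notation E3 := (R * R * R)%type.
Local Notation lam := (@lam R).
Local Notation hratio := (hratio R).
Variables (n m : nat) (xi : 'I_n -> 'rV[R]_m) (W : 'I_n -> 'I_n -> 'I_n).
Hypothesis n0 : (0 < n)%N.
Hypothesis W_inj : forall i, injective (W i).
Hypothesis W_diag : forall i, W i i = 0%N :> nat.
Hypothesis xi_norm : forall i, enorm (xi i) ^+ 2 = (n%:R - 1) / n%:R.
Hypothesis xi_dist : forall i j,
  enorm (xi i - xi j) ^+ 2 = 4 * (W i j)%:R / n%:R.

Let nR : R := n%:R.
Let nR0 : 0 < nR. Proof. by rewrite ltr0n. Qed.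

(* The cone over S_j is the graph of z |-> sqrt n * |z| * xi_j. *)
Definition sheet (j : 'I_n) (z : E3) : 'rV[R]_(3 + m) :=
  row_mx (iota3 z) ((Num.sqrt nR * nrm z) *: xi j).

Lemma enorm_row_mx k l (x : 'rV[R]_k) (y : 'rV[R]_l) :
  enorm (row_mx x y) ^+ 2 = enorm x ^+ 2 + enorm y ^+ 2.
Proof.
rewrite !enorm_sqr big_split_ord/=; congr (_ + _); apply: eq_bigr => i _.
  by rewrite row_mxEl.
by rewrite row_mxEr.
Qed.

(** Avoids inner products: only norms and mutual distances are prescribed for the xi_j. *)
Lemma enorm_comb k (x y : 'rV[R]_k) a b :
  enorm (a *: x - b *: y) ^+ 2 = a * (a - b) * enorm x ^+ 2 +
    b * (b - a) * enorm y ^+ 2 + a * b * enorm (x - y) ^+ 2.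
Proof.
rewrite !enorm_sqr !mulr_sumr -!big_split/=; apply: eq_bigr => i _.
by rewrite !mxE; ring.
Qed.

Lemma sheet_dist i j z z' : enorm (sheet i z - sheet j z') ^+ 2 =
  distsq z z' + (nR - 1) * (nrm z - nrm z') ^+ 2 + 4 * (W i j)%:R * nrm z * nrm z'.
Proof.
rewrite /sheet opp_row_mx add_row_mx enorm_row_mx enorm_iota3B enorm_comb.
rewrite !xi_norm xi_dist -[RHS]addrA; congr (_ + _).
have s2 : Num.sqrt nR ^+ 2 = nR by rewrite sqr_sqrtr// ltW.
set s := Num.sqrt nR in s2 *; set a := nrm z; set b := nrm z'.
have -> : s * a * (s * a - s * b) = s ^+ 2 * (a * (a - b)) by ring.
have -> : s * b * (s * b - s * a) = s ^+ 2 * (b * (b - a)) by ring.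
have -> : s * a * (s * b) = s ^+ 2 * (a * b) by ring.
by rewrite s2 -/nR; field; rewrite gt_eqF.
Qed.

Lemma sheet_dist_same i z z' : enorm (sheet i z - sheet i z') ^+ 2 =
  distsq z z' + (nR - 1) * (nrm z - nrm z') ^+ 2.
Proof. by rewrite sheet_dist W_diag mulr0 !mul0r addr0. Qed.

(** W i is injective with W i i = 0, so W i j > 0 and the term 4 w |z| |z'| of the squared distance
    is positive. *)
Lemma sheet_sep i j z z' : i != j -> 0 < normsq z -> 0 < normsq z' ->
  sheet i z <> sheet j z'.
Proof.
move=> ij z0 z0' /eqP; rewrite -subr_eq0 => /eqP e.
have := sheet_dist i j z z'; rewrite e enorm0 expr0n/= => /esym h.
have w0 : 0 < ((W i j)%:R : R).
  rewrite ltr0n lt0n -(W_diag i) val_eqE; apply: contra ij => /eqP/W_inj ->//.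
have a0 : 0 < nrm z by rewrite sqrtr_gt0.
have b0 : 0 < nrm z' by rewrite sqrtr_gt0.
have := mulr_gt0 (mulr_gt0 (mulr_gt0 (ltr0n R 4) w0) a0) b0.
have d0 : 0 <= distsq z z' by rewrite !addr_ge0// sqr_ge0.
have : 0 <= (nR - 1) * (nrm z - nrm z') ^+ 2.
  by rewrite mulr_ge0 ?sqr_ge0// subr_ge0 ler1n.
lra.
Qed.

(** An isometric involution H preserving norms reparametrizes each sheet without changing its range.
    H is free so that a reflection can bring the centre of a ball onto the polar axis. *)
Lemma sheet_area (H : E3 -> E3) (A : set (bor 'rV[R]_(3 + m))) :
  (forall z, nrm (H z) = nrm z) ->
  (forall z z', distsq (H z) (H z') = distsq z z') -> involutive H ->
  measurable A ->
  hausdorff3 (A `&` \bigcup_j range (sheet j)) =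
  ((hratio * (Num.sqrt nR / 3))%:E *
    \sum_j lam (@pdom R `&` (sheet j \o H \o @polar R) @^-1` A))%E.
Proof.
move=> Hn Hd HK mA.
have -> : \bigcup_j range (sheet j) = \bigcup_j range (sheet j \o H).
  apply/seteqP; split => x [j _ [z _ zx]]; exists j => //.
    by exists (H z) => //=; rewrite HK.
  by exists (H z).
apply: cone_area => //.
- by rewrite ler1n.
- by move=> i z z' /=; rewrite sheet_dist_same !Hn Hd.
- by move=> i j z z' ij z0 z0' /=; apply: sheet_sep ij _ _; rewrite -nrm_sqr Hn nrm_sqr.
Qed.

(* In polar coordinates, the part of the ball on sheet j is an affine image of the
   part of a Euclidean ball of R^3 over the tile of cosines ]1 - 2 (w + 1) / n, 1 - 2 w / n[
   with w = W i j; as W i is a permutation, the n tiles fill the whole ball. *)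
Lemma hausdorff3_sheets_ball i z0 r : 0 < r ->
  hausdorff3 (eball (sheet i z0) r `&` \bigcup_j range (sheet j)) =
  (bvol R * r ^+ 3)%:E.
Proof.
move=> r0; have [v vz0] := householder_axis z0.
set a := nrm z0 in vz0; set H := householder v in vz0.
have HK : involutive H by exact: householderK.
have Hd z z' : distsq (H z) (H z') = distsq z z' by exact: distsq_householder.
have Hn z : nrm (H z) = nrm z by rewrite /nrm normsq_householder.
rewrite (sheet_area Hn Hd HK)//; last exact: measurable_eball.
pose s := Num.sqrt nR.
have s0 : 0 < s by rewrite sqrtr_gt0.
have s2 : s ^+ 2 = nR by rewrite sqr_sqrtr// ltW.
rewrite (eq_bigr (fun j => ((s ^+ 3 * nR^-1)^-1)%:E *
    lam (pball (s * a) r `&` tile n (W i j)))%E); last first.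
  move=> j _.
  (* For a point of radius r and cosine t, the terms of the squared distance collect into n (r^2 +
     a^2 - 2 a r t'), where t' = (t + n - 1 - 2 w) / n. This is the Euclidean law of cosines for the
     radii sqrt n r and sqrt n a, and T replaces r by sqrt n r and t by t'. *)
  pose T := affine3 ((s ^+ 3, nR^-1), 1) ((0, (nR - 1 - 2 * (W i j)%:R) / nR), 0).
  rewrite (_ : _ `&` _ = T @^-1` (pball (s * a) r `&` tile n (W i j))).
    rewrite lam_affine/= ?mulr1 ?exprn_gt0 ?invr_gt0//.
    by apply: measurableI; [exact: measurable_pball|exact: measurable_tile].
  have Tt p : (T p).1.2 = (p.1.2 + (nR - 1 - 2 * (W i j)%:R)) / nR.
    by rewrite /T /affine3/= [RHS]mulrDl [nR^-1 * _]mulrC.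
  have Ts p : (T p).1.1 = s ^+ 3 * p.1.1 by rewrite /T /affine3/= addr0.
  have Tf p : (T p).2 = p.2 by rewrite /T /affine3/= addr0 mul1r.
  clearbody T.
  have Wn : ((W i j)%:R : R) <= nR - 1.
    by rewrite lerBrDr natr1 ler_nat ltn_ord.
  have W0 : 0 <= ((W i j)%:R : R) by rewrite ler0n.
  have Ttile p : tile n (W i j) (T p) <-> -1 < p.1.2 < 1.
    rewrite /tile/= Tt -/nR !ltr_pM2r ?invr_gt0//.
    by split => /andP[h1 h2]; apply/andP; split; lra.
  have Tdom p : pdom p -> pdom (T p).
    move=> [p1 p2 p3]; split; rewrite ?Ts ?Tf ?mulr_gt0 ?exprn_gt0//.
    rewrite Tt ltr_pdivlMr// ltr_pdivrMr//; move: p2 => /andP[h1 h2].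
    by apply/andP; split; lra.
  have Trad p : pdom p -> radius (T p) = s * radius p.
    by move=> [p1 _ _]; apply: radius_scale.
  have ball_iff p : pdom p -> eball (sheet i z0) r (sheet j (H (polar p))) <->
      radius (T p) ^+ 2 + (s * a) ^+ 2 - 2 * (s * a) * radius (T p) * (T p).1.2 <= r ^+ 2.
    move=> Dp; rewrite /eball/= enorm_le ?(ltW r0)// enorm_distC sheet_dist.
    rewrite -[distsq z0 _]Hd HK vz0 Hn nrm_polar// -/a Trad// Tt.
    have -> : distsq (axis a) (polar p) = distsq (polar p) (axis a).
      by rewrite /distsq; ring.
    rewrite distsq_polar_axis//.
    have -> : (s * radius p) ^+ 2 + (s * a) ^+ 2 - 2 * (s * a) * (s * radius p) *
      ((p.1.2 + (nR - 1 - 2 * (W i j)%:R)) / nR) = s ^+ 2 * (radius p ^+ 2 + a ^+ 2 -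
      2 * a * radius p * ((p.1.2 + (nR - 1 - 2 * (W i j)%:R)) / nR)) by ring.
    rewrite s2 (_ : nR * _ = radius p ^+ 2 + a ^+ 2 - 2 * a * radius p * p.1.2 +
      (nR - 1) * (a - radius p) ^+ 2 + 4 * (W i j)%:R * a * radius p) //.
    by field; rewrite gt_eqF.
  apply/seteqP; split => p.
    move=> [Dp Bp]; split; last by apply/Ttile; case: Dp.
    by split; [exact: Tdom|exact/ball_iff].
  move=> [[[p1 p2 p3] h] /Ttile t1].
  have Dp : pdom p.
    by split => //; [move: p1; rewrite Ts pmulr_rgt0// exprn_gt0|rewrite -Tf].
  by split => //; apply/ball_iff.
rewrite -ge0_sume_distrr//.
have <- : lam (pball (s * a) r) = (\sum_j lam (pball (s * a) r `&` tile n (W i j)))%E.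
  rewrite (lam_tiles n0 (@measurable_pball R (s * a) r)); last by move=> p [].
  by rewrite (reindex_inj (@W_inj i)).
(* The Jacobian s / 3 of the sheets times the inverse factor n / s^3 of T is 1 / 3, because s^2 =
   n. *)
rewrite muleA -EFinM -/s -(hratio_pball (s * a) r0); congr (_%:E * _)%E.
rewrite -s2; field; rewrite gt_eqF//.
Qed.

End sheets.

HB.instance Definition _ (R : realType) m n := Pointed.on 'M[R]_(m, n).

(** * The measure on the cone is Radon *)

Section radon_criterion.
Variables (R : realType) (N : nat).
Local Notation V := 'rV[R]_N.

Lemma enorm_le_mx_norm (x : V) : enorm x <= Num.sqrt N%:R * `|x|.
Proof.
rewrite enorm_le ?mulr_ge0 ?sqrtr_ge0// enorm_sqr exprMn sqr_sqrtr ?ler0n//.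
apply: (@le_trans _ _ (\sum_(i < N) `|x| ^+ 2)); last first.
  by rewrite sumr_const card_ord mulr_natl.
apply: ler_sum => i _; rewrite -real_normK ?num_real// lerXn2r ?nnegrE//.
rewrite [leRHS]/Num.Def.normr/= mx_normrE.
exact: (@le_bigmax _ _ _ 0 (fun ij : 'I_1 * 'I_N => `|x ij.1 ij.2|) (0, i)).
Qed.

Lemma compact_eball (K : set V) : compact K ->
  exists2 r : R, 0 < r & K `<=` eball 0 r.
Proof.
move=> /compact_bounded[M [_ HM]].
have M0 : 0 < `|M| + 1 by rewrite ltr_wpDl.
exists (Num.sqrt N%:R * (`|M| + 1) + 1); first by rewrite ltr_wpDl// mulr_ge0 ?sqrtr_ge0// ltW.
move=> x Kx; rewrite /eball/= subr0; apply: le_trans (enorm_le_mx_norm _) _.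
apply: (@le_trans _ _ (Num.sqrt N%:R * (`|M| + 1))); last by rewrite lerDl.
rewrite ler_wpM2l ?sqrtr_ge0//; apply: HM Kx.
by rewrite ltr_pwDr// ler_norm.
Qed.

Lemma eball_bounded (r : R) : bounded_set (eball (0 : V) r).
Proof.
exists r; split; first exact: num_real.
move=> M rM x; rewrite /eball/= subr0 => xr; apply: le_trans (mx_norm_le_enorm _) _.
exact: le_trans xr (ltW rM).
Qed.

Definition enorm_exhaust (k : nat) : set (bor V) := [set x | enorm x < k%:R].

Lemma open_enorm_exhaust k : open (enorm_exhaust k).
Proof.
apply: (@open_comp _ _ (@enorm R N) [set x | x < k%:R]); last exact: open_lt.
by move=> x _; exact: continuous_enorm.
Qed.

Lemma enorm_exhaustT : \bigcup_k enorm_exhaust k = setT.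
Proof.
apply/seteqP; split => // x _; exists (Num.truncn (enorm x)).+1 => //.
by rewrite /enorm_exhaust/=; exact: truncnS_gt.
Qed.

(** Outer regularity is [borel_outer_regular] for the exhaustion by open balls. Inner regularity
    approximates U by a closed set and cuts it with closed balls, which gives compact sets; passing
    to the limit includes sets of infinite measure. *)
Lemma locally_finite_radon (m : {measure set (bor V) -> \bar R})
    (nu : set V -> \bar R) :
  (forall A : set (bor V), measurable A -> m A = nu A) ->
  (forall r, (m (eball 0 r) < +oo)%E) -> radon nu.
Proof.
move=> mnu mfin.
have mfin' k : (m (enorm_exhaust k) < +oo)%E.
  apply: le_lt_trans (mfin k%:R); apply: le_measure; rewrite ?inE.
  - by apply: open_bor; exact: open_enorm_exhaust.
  - exact: measurable_eball.
  - by move=> x; rewrite /enorm_exhaust /eball/= subr0 => /ltW.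
have cK K : compact K -> measurable (K : set (bor V)).
  by move=> cK; apply: closed_bor; apply: compact_closed => //; exact: norm_hausdorff.
split.
- by exists m.
- move=> K /[dup] /cK mK /compact_eball[r r0 Kr]; rewrite -mnu//.
  apply: le_lt_trans (mfin r); apply: le_measure; rewrite ?inE//; exact: measurable_eball.
- move=> A mA; apply/eqP; rewrite eq_le; apply/andP; split.
    apply: le_ereal_inf_tmp => _ [U [oU AU] <-]; rewrite -!mnu//; last exact: open_bor.
    by apply: le_measure; rewrite ?inE//; exact: open_bor.
  apply/lee_addgt0Pr => e e0.
  have [_ /(_ _ e0)[U [oU AU Ue]]] := @borel_outer_regular R V m _
    open_enorm_exhaust enorm_exhaustT mfin' A mA.
  apply: ereal_inf_le; exists (nu U); first by exists U.
  rewrite -!mnu//; last exact: open_bor.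
  apply: (@le_trans _ _ (m (A `|` (U `\` A)))).
    apply: le_measure; rewrite ?inE//; first exact: open_bor.
      by apply: measurableU => //; apply: measurableD => //; exact: open_bor.
    by move=> p Up; have [Ap|nAp] := pselect (A p); [left|right].
  apply: le_trans (measureU2 _ mA _) _; last by rewrite leeD2l.
  by apply: measurableD => //; exact: open_bor.
- move=> U oU; have mU : measurable (U : set (bor V)) by exact: open_bor.
  apply/eqP; rewrite eq_le; apply/andP; split; last first.
    apply: ge_ereal_sup => _ [K [Kc KU] <-]; rewrite -!mnu//; last exact: cK.
    by apply: le_measure; rewrite ?inE//; exact: cK.
  apply/lee_addgt0Pr => e e0; rewrite -[in leLHS]mnu//.
  have [F [cF FU UF]] := @borel_closed_approx R V m _
    open_enorm_exhaust enorm_exhaustT mfin' U e mU e0.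
  have mF : measurable F by exact: closed_bor.
  pose K k := F `&` eball 0 (k%:R : R).
  have Kc k : compact (K k).
    apply: bounded_closed_compact; last by apply: closedI => //; exact: closed_eball.
    have [M [Mr HM]] := @eball_bounded k%:R; exists M; split => // M' MM x [_ xk].
    exact: HM MM _ xk.
  have lim : (m F <= ereal_sup [set nu K | K in [set K | compact K /\ K `<=` U]])%E.
    have cl : m (K k) @[k --> \oo] --> m F.
      rewrite (_ : F = \bigcup_k K k); last first.
        rewrite -setI_bigcupr; apply/seteqP; split => [p Fp|p []//]; split => //.
        have [k _ kp] : (\bigcup_k enorm_exhaust k) p by rewrite enorm_exhaustT.
        by exists k => //; rewrite /eball/= subr0; exact: ltW.
      apply: nondecreasing_cvg_mu.
      - by move=> k; exact: cK.
      - by apply: bigcup_measurable => k _; exact: cK.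
      - move=> i j ij; apply/subsetPset => p [Fp pi]; split => //.
        by apply: le_trans pi _; rewrite ler_nat.
    rewrite -(cvg_lim _ cl)//; apply: lime_le; first by apply/cvg_ex; eexists; exact: cl.
    apply: nearW => k; apply: ereal_sup_ubound; exists (K k); last by rewrite mnu//; exact: cK.
    by split => // x [Fx _]; exact: FU.
  apply: le_trans (leeD2r e%:E lim).
  apply: (@le_trans _ _ (m (F `|` (U `\` F)))).
    apply: le_measure; rewrite ?inE//; first by apply: measurableU => //; exact: measurableD.
    by move=> p Ep; have [Fp|nFp] := pselect (F p); [left|right].
  apply: le_trans (measureU2 _ mF _) _; first exact: measurableD.
  by rewrite leeD2l.
Qed.

End radon_criterion.

Section sheet_measure.
Variable R : realType.
Local Notation E3 := (R * R * R)%type.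
Local Notation lam := (@lam R).
Local Notation hratio := (hratio R).
Variables (n m : nat) (xi : 'I_n -> 'rV[R]_m) (W : 'I_n -> 'I_n -> 'I_n).
Hypothesis n0 : (0 < n)%N.
Hypothesis W_inj : forall i, injective (W i).
Hypothesis W_diag : forall i, W i i = 0%N :> nat.
Hypothesis xi_norm : forall i, enorm (xi i) ^+ 2 = (n%:R - 1) / n%:R.
Hypothesis xi_dist : forall i j,
  enorm (xi i - xi j) ^+ 2 = 4 * (W i j)%:R / n%:R.

Local Notation S := (\bigcup_j range (sheet xi j)).
Local Notation V := 'rV[R]_(3 + m).

(** Equations continuous in x describe the graph, from which its closedness is read off. *)
Lemma sheetP j (x : V) : range (sheet xi j) x <->
  forall k, x 0 (rshift 3 k) = Num.sqrt n%:R * enorm (lsubmx x) * xi j 0 k.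
Proof.
have nz z : enorm (iota3 z) = nrm z by rewrite /nrm -enorm_iota3 sqrtr_sqr ger0_norm// enorm_ge0.
split => [[z _ <-] k|H].
  by rewrite /sheet row_mxEr row_mxKl nz !mxE.
have [z zx] := iota3_surj (lsubmx x); exists z => //.
rewrite /sheet -nz zx; rewrite -[RHS]hsubmxK; congr row_mx.
by apply/rowP => k; rewrite !mxE H.
Qed.

Lemma closed_sheets : closed S.
Proof.
apply: closed_bigcup; first exact: finite_finset.
move=> j _.
rewrite (_ : range (sheet xi j) = \bigcap_k [set x : V | x 0 (rshift 3 k) -
   Num.sqrt n%:R * enorm (lsubmx x) * xi j 0 k = 0]); last first.
  apply/seteqP; split => x.
    by move=> /sheetP H k _ /=; rewrite H subrr.
  by move=> H; apply/sheetP => k; apply/eqP; rewrite -subr_eq0; apply/eqP; exact: H.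
apply: closed_bigI => k _.
apply: (@closed_comp _ _ (fun x : V => x 0 (rshift 3 k) -
   Num.sqrt n%:R * enorm (lsubmx x) * xi j 0 k) [set y | y = 0]); last exact: closed_eq.
have ck : continuous (fun x : V => x 0 (rshift 3 k)) by exact: coord_continuous.
have cl : continuous (fun x : V => enorm (lsubmx x)).
  move=> x; apply: (@continuous_comp _ _ _ (fun x : V => \sum_i (lsubmx x) 0 i ^+ 2)
    Num.sqrt); last exact: sqrt_continuous.
  apply: (@continuous_big _ _ _ _ _ (@add_continuous R)) => i _ y.
  apply: (@continuous_comp _ _ _ (fun M : V => lsubmx M 0 i) (fun z : R => z ^+ 2));
    last exact: exprn_continuous.
  rewrite (_ : (fun M : V => _) = fun M : V => M 0 (lshift m i)); first exact: coord_continuous.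
  by apply/funext => M; rewrite mxE.
move=> x _; apply: (cvgB (ck x)).
apply: (@continuous_comp _ _ _ (fun x : V => enorm (lsubmx x))
  (fun y : R => Num.sqrt n%:R * y * xi j 0 k)); first exact: cl.
by apply: cvgMl; exact: cvgMr.
Qed.

Definition sheets_measure (A : set (bor V)) : \bar R := hausdorff3 (A `&` S).

Lemma sheets_measureE (A : set (bor V)) : measurable A ->
  sheets_measure A = ((hratio * (Num.sqrt n%:R / 3))%:E *
    \sum_j lam (@pdom R `&` (sheet xi j \o @polar R) @^-1` A))%E.
Proof. by move=> mA; apply: (sheet_area n0 W_inj W_diag xi_norm xi_dist (H := id)). Qed.

Lemma continuous_sheet j : continuous (sheet xi j).
Proof.
apply: (@cone_continuous R (3 + m) 'I_n (sheet xi) n%:R); first by rewrite ler1n.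
by move=> i z z'; apply: (sheet_dist_same n0 W_diag xi_norm xi_dist).
Qed.

(** Obtained without Caratheodory's criterion: on Borel sets the area formula identifies the outer
    measure with a finite sum of volumes of preimages, each countably additive. *)
Lemma sheets_measure_sigma_additive : semi_sigma_additive sheets_measure.
Proof.
move=> F mF tF mUF; rewrite sheets_measureE//.
have mP j (A : set (bor V)) : measurable A ->
    measurable (@pdom R `&` (sheet xi j \o @polar R) @^-1` A : set (bor E3)).
  move=> mA; apply: (bor_preimage (@open_pdom R)) mA => p Dp; apply: continuous_comp; first exact: continuous_polar.
  exact: continuous_sheet.
rewrite (_ : (fun k : nat => _) = fun k => ((hratio * (Num.sqrt n%:R / 3))%:E *
    \sum_j \sum_(0 <= i < k) lam (@pdom R `&` (sheet xi j \o @polar R) @^-1` F i))%E); last first.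
  apply/funext => k; rewrite exchange_big ge0_sume_distrr/=; last first.
    by move=> i _; apply: sume_ge0 => j _; exact: measure_ge0.
  by apply: eq_bigr => i _; exact: sheets_measureE.
apply: cvgeZl => //; apply: cvg_nnesum => [j _|j _].
  by apply: nearW => k; apply: sume_ge0 => i _; exact: measure_ge0.
rewrite preimage_bigcup setI_bigcupr; apply: measure_semi_sigma_additive.
- by move=> k; exact: mP.
- apply/trivIsetP => a b _ _ ab; have /trivIsetP/(_ a b Logic.I Logic.I ab) := tF.
  by rewrite -subset0 => F0; rewrite -subset0 => p [[_ Fa] [_ Fb]]; exact: (F0 _ (conj Fa Fb)).
- by apply: bigcup_measurable => k _; exact: mP.
Qed.

Lemma sheets_radon : radon (restriction (@hausdorff3 R (3 + m)) S).
Proof.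
have h0 : sheets_measure set0 = 0%E by rewrite /sheets_measure set0I hausdorff3_set0.
have hp A : (0 <= sheets_measure A)%E by exact: hausdorff3_ge0.
pose mu : {measure set (bor V) -> \bar R} := HB.pack sheets_measure
  (isMeasure.Build _ _ _ sheets_measure h0 hp sheets_measure_sigma_additive).
apply: (@locally_finite_radon R (3 + m) mu) => // r.
have r0 : 0 < `|r| + 1 by rewrite ltr_wpDl.
pose i := Ordinal n0; pose o : E3 := ((0, 0), 0).
(* The apex lies on the sheets, so the ball formula applies at 0 and gives finiteness on bounded
   sets. *)
have o0 : sheet xi i o = 0.
  rewrite /sheet /nrm /normsq/= expr0n/= !addr0 sqrtr0 mulr0 scale0r.
  rewrite (_ : iota3 _ = 0) ?row_mx0//.
  by apply/rowP => k; rewrite !mxE/=; do 2 case: ifP => // _.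
apply: le_lt_trans (ltry (bvol R * (`|r| + 1) ^+ 3)).
rewrite -(hausdorff3_sheets_ball n0 W_inj W_diag xi_norm xi_dist i o r0) o0.
apply: hausdorff3_mono; apply: setSI => x /=; rewrite /eball/= => h.
by apply: le_trans h _; rewrite ler_wpDr// ler_norm.
Qed.

Lemma sheets_support x : msupport (restriction (@hausdorff3 R (3 + m)) S) x -> S x.
Proof.
move=> sx; apply: contrapT => nSx.
have : nbhs x (~` S) by apply: open_nbhs_nbhs; split => //; rewrite openC; exact: closed_sheets.
move=> /nbhs_ballP[e /= e0 eS].
have e20 : 0 < e / 2 by rewrite divr_gt0.
have := sx _ e20; rewrite /restriction (_ : _ `&` _ = set0) ?hausdorff3_set0 ?ltxx//.
rewrite -subset0 => y [yx Sy]; apply: (eS y) Sy.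
rewrite -ball_normE /ball_/= distrC; apply: le_lt_trans (mx_norm_le_enorm _) _.
by apply: le_lt_trans yx _; rewrite ltr_pdivrMr// ltr_pMr// ltr1n.
Qed.

Lemma sheets_uniform : uniform3 (restriction (@hausdorff3 R (3 + m)) S).
Proof.
split; first exact: sheets_radon.
exists (bvol R); first exact: bvol_gt0.
move=> x r /sheets_support[i _ [z _ <-]] r0; rewrite /restriction.
exact: (hausdorff3_sheets_ball n0 W_inj W_diag xi_norm xi_dist).
Qed.

End sheet_measure.

(** * The cone of the theorem *)

Section cone_description.
Variables (R : realType) (p : nat) (xi : 'I_(4 * p) -> 'rV[R]_(4 * p - 1)).
Hypothesis p0 : (1 <= p)%N.
Local Notation n := (4 * p)%N.
Hypothesis xi_norm : forall i, enorm (xi i) ^+ 2 = (n%:R - 1) / n%:R.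

Let nR0 : 0 < (n%:R : R). Proof. by rewrite ltr0n muln_gt0. Qed.

Let pR0 : (p%:R : R) != 0. Proof. by rewrite pnatr_eq0 -lt0n. Qed.

Lemma enorm_eq k (x : 'rV[R]_k) c : 0 <= c -> enorm x = c <-> enorm x ^+ 2 = c ^+ 2.
Proof.
move=> c0; split => [->//|/eqP].
by rewrite eqrXn2 ?enorm_ge0// => /eqP.
Qed.

Lemma VtranslateP i (x : ambient R p) :
  Vtranslate xi i x <-> exists u, x = row_mx u (xi i).
Proof.
rewrite /Vtranslate /Vspace /sphere_center; split.
  by move=> [_ [u _ <-] <-]; exists u; rewrite add_row_mx addr0 add0r.
move=> [u ->]; exists (row_mx u 0); first by exists u.
by rewrite add_row_mx addr0 add0r.
Qed.

Lemma Ssphere_norm (i : 'I_n) (u : 'rV[R]_3) :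
  enorm (row_mx u (xi i)) = 1 <-> enorm u ^+ 2 = 1 / n%:R.
Proof.
rewrite enorm_eq// enorm_row_mx xi_norm expr1n.
have e : 1 / n%:R + (n%:R - 1) / n%:R = 1 :> R by field; exact: pR0.
split => h; last by rewrite h e.
by apply: (addIr ((n%:R - 1) / n%:R)); rewrite h e.
Qed.

Lemma SsphereE (i : 'I_n) : Ssphere xi i = [set x | Vtranslate xi i x /\
  enorm (x - sphere_center xi i) = Num.sqrt (1 / n%:R)].
Proof.
have c0 : 0 <= 1 / (n%:R : R) by rewrite divr_ge0// ltW.
have key u : enorm (row_mx u (xi i) - sphere_center xi i) = Num.sqrt (1 / n%:R) <->
    enorm u ^+ 2 = 1 / n%:R.
  rewrite /sphere_center opp_row_mx add_row_mx subr0 subrr enorm_eq ?sqrtr_ge0//.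
  by rewrite enorm_row_mx enorm0 expr0n/= addr0 (sqr_sqrtr c0).
apply/seteqP; split => x.
  move=> [Vx]; split => //; move: (Vx) => /VtranslateP[u xE]; rewrite xE in b *.
  exact: (key u).2 ((Ssphere_norm i u).1 b).
move=> [Vx h]; split => //; move: (Vx) => /VtranslateP[u xE]; rewrite xE in h *.
exact: (Ssphere_norm i u).2 ((key u).1 h).
Qed.

Lemma enorm_sheet j z : enorm (sheet xi j z) = Num.sqrt n%:R * nrm z.
Proof.
apply/enorm_eq; first by rewrite mulr_ge0// sqrtr_ge0.
rewrite enorm_row_mx enorm_iota3.
have -> : enorm ((Num.sqrt n%:R * nrm z) *: xi j) ^+ 2 =
    (Num.sqrt n%:R * nrm z) ^+ 2 * enorm (xi j) ^+ 2.
  by rewrite !enorm_sqr mulr_sumr; apply: eq_bigr => k _; rewrite mxE exprMn.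
rewrite xi_norm exprMn (sqr_sqrtr (ltW nR0)) nrm_sqr; field; exact: pR0.
Qed.

(** If x / |x| = (u, xi_j) is on the unit sphere, then |u|^2 = 1 / n; hence z = |x| u satisfies sqrt
    n |z| = |x|, and x is the point of the sheet j over z. The added point 0 is the common apex. *)
Lemma SigmaE : Sigma xi = \bigcup_j range (sheet xi j).
Proof.
have n0 : (0 < n)%N by rewrite muln_gt0.
have s0 : 0 < Num.sqrt (n%:R : R) by rewrite sqrtr_gt0.
apply/seteqP; split => x.
  case=> [[x0 [j _ [/VtranslateP[u xu] ux]]]|->]; last first.
    exists (Ordinal n0) => //; exists ((0, 0), 0) => //.
    rewrite /sheet /nrm /normsq/= expr0n/= !addr0 sqrtr0 mulr0 scale0r.
    rewrite (_ : iota3 _ = 0) ?row_mx0//.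
    by apply/rowP => k; rewrite !mxE/=; do 2 case: ifP => // _.
  have e0 : enorm x != 0.
    apply: contra_neq x0 => e0; apply/rowP => k; apply/eqP; rewrite [eqbRHS]mxE.
    by rewrite -normr_le0 -e0 enorm_coord.
  have [z zu] := iota3_surj (enorm x *: u).
  exists j => //; exists z => //.
  have u2 : enorm u ^+ 2 = 1 / n%:R by apply/(Ssphere_norm j); rewrite -xu.
  have nz : Num.sqrt n%:R * nrm z = enorm x.
    apply/eqP; rewrite -(eqrXn2 (n := 2)) ?mulr_ge0 ?sqrtr_ge0 ?enorm_ge0//.
    rewrite exprMn (sqr_sqrtr (ltW nR0)) nrm_sqr -enorm_iota3 zu.
    have -> : enorm (enorm x *: u) ^+ 2 = enorm x ^+ 2 * enorm u ^+ 2.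
      by rewrite !(@enorm_sqr _ 3) mulr_sumr; apply: eq_bigr => k _; rewrite mxE exprMn.
    by rewrite u2; apply/eqP; field; exact: pR0.
  by rewrite /sheet nz zu -scale_row_mx -xu scalerA divff// scale1r.
move=> [j _ [z _ <-]].
have [z0|z0] := eqVneq (sheet xi j z) 0; [by right|left]; split => //.
have es := enorm_sheet j z.
have e0 : enorm (sheet xi j z) != 0.
  apply: contra_neq z0 => e0; apply/rowP => k; apply/eqP; rewrite [eqbRHS]mxE.
  by rewrite -normr_le0 -e0 enorm_coord.
exists j => //.
have E : (enorm (sheet xi j z))^-1 *: sheet xi j z =
    row_mx ((enorm (sheet xi j z))^-1 *: iota3 z) (xi j).
  by rewrite {2}/sheet scale_row_mx scalerA -es mulVf// scale1r.
split; first by apply/VtranslateP; eexists; exact: E.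
rewrite /usphere/= enorm_eq//.
rewrite enorm_sqr; under eq_bigr do rewrite mxE exprMn.
by rewrite -mulr_sumr -enorm_sqr -exprMn mulVf.
Qed.

End cone_description.

(** * From edge colorings to permutations *)

Section coloring.
Variables (R : realType) (p : nat) (w : {set 'I_(4 * p)} -> nat).
Hypothesis HG : frakG R w.
Local Notation n := (4 * p)%N.

Lemma frakG_n0 : (0 < n)%N.
Proof. by case: HG => p0 _ _ _; rewrite muln_gt0. Qed.

(** With values in ['I_n], injectivity of a row makes it a permutation that can reindex sums. The
    weight 0 on the diagonal completes the colors 1, ..., n - 1 at a vertex; the default of [insubd]
    is never reached by [val_wmat]. *)
Definition wmat (i j : 'I_n) : 'I_n :=
  insubd (Ordinal frakG_n0) (if i == j then 0%N else w [set i; j]%SET).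

Lemma edge_set2 (i j : 'I_n) : i != j -> edge [set i; j]%SET.
Proof. by move=> ij; rewrite /edge cards2 ij. Qed.

Lemma val_wmat i j : wmat i j = (if i == j then 0%N else w [set i; j]%SET) :> nat.
Proof.
rewrite val_insubd; case: eqVneq => [_|ij]; first by rewrite frakG_n0.
have [_ /(_ _ (edge_set2 ij)) wb _ _] := HG.
suff -> : (w [set i; j]%SET < n)%N by [].
by have := frakG_n0; move: wb; lia.
Qed.

Lemma wmat_diag i : wmat i i = 0%N :> nat.
Proof. by rewrite val_wmat eqxx. Qed.

Lemma wmat_inj i : injective (wmat i).
Proof.
have [_ wb wc _] := HG.
have pos j : i != j -> (0 < w [set i; j]%SET)%N.
  by move=> /edge_set2/wb/andP[].
move=> j k /(congr1 val)/=; rewrite !val_wmat.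
case: eqVneq => [<-|ij]; case: eqVneq => [<-//|ik]//.
- by move=> h; have := pos _ ik; rewrite -h.
- by move=> h; have := pos _ ij; rewrite h.
move=> h; apply/eqP; apply: contraT => jk.
have : w [set i; j]%SET != w [set i; k]%SET.
  apply: (wc _ _ (edge_set2 ij) (edge_set2 ik) _ i); rewrite ?inE ?eqxx//.
  apply/eqP => /setP/(_ j); rewrite !inE eqxx orbT => /esym/orP[]; apply/negP => //.
  by rewrite eq_sym.
by rewrite h eqxx.
Qed.

Variable xi : 'I_n -> 'rV[R]_(4 * p - 1).
Hypothesis Hxi : associated_points w xi.

Lemma associated_norm i : enorm (xi i) ^+ 2 = (n%:R - 1) / n%:R.
Proof.
rewrite Hxi.1 sqr_sqrtr ?divr_ge0//; congr (_ / _).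
by rewrite natrB// frakG_n0.
Qed.

Lemma associated_dist i j : enorm (xi i - xi j) ^+ 2 = 4 * (wmat i j)%:R / n%:R.
Proof.
rewrite val_wmat; case: eqVneq => [<-|ij].
  by rewrite subrr enorm0 expr0n/= mulr0 mul0r.
by rewrite Hxi.2// !exprMn !sqr_sqrtr ?divr_ge0// -natrX mulrA mulr1.
Qed.

End coloring.

(** * Existence of the points *)

Section gram.
Variable R : realType.

Definition qform n (A : 'M[R]_n) (u v : 'rV[R]_n) : R := (u *m A *m v^T) 0 0.
Definition dotv n (u v : 'rV[R]_n) : R := (u *m v^T) 0 0.
Definition psd n (A : 'M[R]_n) := forall v, 0 <= qform A v v.

Lemma dotvE n (u v : 'rV[R]_n) : dotv u v = \sum_i u 0 i * v 0 i.
Proof. by rewrite /dotv mxE; apply: eq_bigr => i _; rewrite mxE. Qed.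

Lemma dotvC n (u v : 'rV[R]_n) : dotv u v = dotv v u.
Proof. by rewrite !dotvE; apply: eq_bigr => i _; rewrite mulrC. Qed.

Lemma dotvv n (u : 'rV[R]_n) : dotv u u = enorm u ^+ 2.
Proof. by rewrite dotvE enorm_sqr; apply: eq_bigr => i _; rewrite expr2. Qed.

Lemma dotvDl n (u v x : 'rV[R]_n) : dotv (u + v) x = dotv u x + dotv v x.
Proof. by rewrite /dotv mulmxDl mxE. Qed.

Lemma dotvBl n (u v x : 'rV[R]_n) : dotv (u - v) x = dotv u x - dotv v x.
Proof. by rewrite /dotv mulmxBl !mxE. Qed.

Lemma dotvZl n a (u v : 'rV[R]_n) : dotv (a *: u) v = a * dotv u v.
Proof. by rewrite /dotv -scalemxAl mxE. Qed.

Lemma qformE n (A : 'M[R]_n) u v : qform A u v = dotv (u *m A) v.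
Proof. by []. Qed.

Lemma qform_sum n (A : 'M[R]_n) u v :
  qform A u v = \sum_i \sum_j u 0 i * A i j * v 0 j.
Proof.
rewrite qformE dotvE exchange_big/=; apply: eq_bigr => j _.
by rewrite mxE mulr_suml.
Qed.

Lemma qformC n (A : 'M[R]_n) u v : A^T = A -> qform A u v = qform A v u.
Proof.
move=> AT; rewrite /qform -[in RHS](trmxK (_ *m _)) [RHS]mxE trmx_mul trmx_mul AT.
by rewrite trmxK mulmxA.
Qed.

Lemma qform_add n (A : 'M[R]_n) u v t : A^T = A ->
  qform A (u + t *: v) (u + t *: v) =
  qform A u u + 2 * t * qform A u v + t ^+ 2 * qform A v v.
Proof.
move=> AT.
have l x y z : qform A (x + y) z = qform A x z + qform A y z.
  by rewrite !qformE mulmxDl dotvDl.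
have s a x y : qform A (a *: x) y = a * qform A x y.
  by rewrite !qformE -scalemxAl dotvZl.
rewrite l [qform A u _]qformC// [qform A (t *: v) _]qformC// !l !s.
rewrite [qform A u (t *: v)]qformC// [qform A v (t *: v)]qformC// !s.
by rewrite [qform A v u]qformC//; ring.
Qed.

Lemma qform_block n (a : R) (b : 'rV[R]_n) (C : 'M[R]_n) x (u : 'rV[R]_n) :
  qform (block_mx a%:M b b^T C) (row_mx x%:M u) (row_mx x%:M u) =
  a * x ^+ 2 + 2 * x * dotv b u + qform C u u.
Proof.
rewrite /qform mul_row_block tr_row_mx mul_row_col !mul_scalar_mx tr_scalar_mx.
rewrite mul_mx_scalar mulmxDl -scalemxAl !mxE -/(dotv b u) -/(dotv u b).
rewrite [\sum_j (u *m C) 0 j * _](_ : _ = (u *m C *m u^T) 0 0); last by rewrite [RHS]mxE.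
rewrite [\sum_j u 0 j * _](_ : _ = dotv u b); last by rewrite /dotv [RHS]mxE.
rewrite [\sum_j b 0 j * _](_ : _ = dotv b u); last by rewrite /dotv [RHS]mxE.
by rewrite eqxx mulr1n [dotv u b]dotvC; ring.
Qed.

(** Cholesky factorization, by induction on the Schur complement of the corner a. If a = 0,
    positivity forces b = 0, and the convention 0^-1 = 0 keeps the formulas valid. *)
Lemma psd_factor n (A : 'M[R]_n) : A^T = A -> psd A -> exists X : 'M[R]_n, X *m X^T = A.
Proof.
elim: n A => [|n IHn] A AT Ap.
  by exists 0; apply/matrixP => -[].
have [a [b [C [CT AE]]]] : exists (a : R) (b : 'rV[R]_n) (C : 'M[R]_n),
    C^T = C /\ A = block_mx a%:M b (b^T) C.
  exists (A 0 0), (@ursubmx _ 1 n 1 n A), (@drsubmx _ 1 n 1 n A); split.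
    by rewrite trmx_drsub AT.
  rewrite trmx_ursub AT; apply: etrans (esym (@submxK R 1 n 1 n A)) _.
  congr block_mx.
  apply/matrixP => i j; rewrite !ord1 !mxE eqxx mulr1n.
  by congr (A _ _); apply/val_inj.
have q x u : 0 <= a * x ^+ 2 + 2 * x * dotv b u + qform C u u.
  by rewrite -qform_block -AE; exact: Ap.
have a0 : 0 <= a.
  have := q 1 0; rewrite qformE mul0mx dotvC.
  by rewrite /dotv !mul0mx !mxE expr1n !mulr1 mulr0 !addr0.
have b0 : a = 0 -> b = 0.
  move=> aE; apply/eqP; rewrite -subr_eq0 subr0; apply/eqP.
  suff bb : dotv b b = 0.
    apply/rowP => k; apply/eqP; rewrite [eqbRHS]mxE -normr_le0.
    by apply: le_trans (enorm_coord _ _) _; rewrite enorm_le// expr0n/= -dotvv bb.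
  apply/eqP; apply: contraT => bb.
  (* With a = 0 the form is affine in x; this x gives it the value -1. *)
  have := q (- (qform C b b + 1) / (2 * dotv b b)) b.
  rewrite aE mul0r add0r (_ : 2 * _ * _ = - (qform C b b + 1)); last by field.
  lra.
pose C' := C - a^-1 *: (b^T *m b).
have C'T : C'^T = C'.
  by rewrite /C' linearB linearZ/= trmx_mul trmxK CT.
have qC' u : qform C' u u = qform C u u - a^-1 * dotv b u ^+ 2.
  rewrite qformE /C' mulmxBr dotvBl -qformE -scalemxAr dotvZl.
  rewrite mulmxA [u *m b^T]mx11_scalar mul_scalar_mx dotvZl -/(dotv u b) (dotvC u b).
  by ring.
have C'p : psd C'.
  move=> u; rewrite qC'.
  have [aE|aN] := eqVneq a 0.
    have := q 0 u; rewrite aE (b0 aE) invr0 !mul0r mulr0 mul0r !add0r.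
    by rewrite subr0.
  have := q (- (dotv b u) / a) u.
  rewrite (_ : a * _ + 2 * _ * _ = - (a^-1 * dotv b u ^+ 2)); last by field.
  by rewrite addrC.
have [Y YE] := IHn _ C'T C'p.
pose s := Num.sqrt a.
have ss : s * s = a by rewrite -expr2 sqr_sqrtr.
have sb : (s * s^-1) *: b = b.
  have [/b0->|aN] := eqVneq a 0; first by rewrite scaler0.
  by rewrite divff ?scale1r// sqrtr_eq0 -ltNge lt_neqAle eq_sym aN.
have sa : s^-1 * s^-1 = a^-1 by rewrite -invfM ss.
exists (block_mx s%:M 0 (s^-1 *: b^T) Y : 'M[R]_(1 + n)).
rewrite AE (@tr_block_mx R 1 n 1 n) (@mulmx_block R 1 n 1 n 1 n).
apply: (f_equal4 (@block_mx R 1 n 1 n)).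
- by rewrite tr_scalar_mx -scalar_mxM ss trmx0 mulmx0 addr0.
- by rewrite mul_scalar_mx linearZ/= trmxK scalerA sb mul0mx addr0.
- by rewrite trmx0 mulmx0 addr0 tr_scalar_mx mul_mx_scalar scalerA -[in RHS]sb linearZ.
- rewrite linearZ/= trmxK -scalemxAl -scalemxAr scalerA sa YE /C'.
  by rewrite addrC subrK.
Qed.

(** The vanishing row sums save one dimension: the minor without the first index is factored in size
    m, and the missing point is minus the sum of the others. *)
Lemma gram_points m n (G : 'M[R]_n) : n = m.+1 -> G^T = G -> psd G ->
  (forall i, \sum_j G i j = 0) ->
  exists xi : 'I_n -> 'rV[R]_m, forall i j, dotv (xi i) (xi j) = G i j.
Proof.
move=> nm; subst n => GT Gp Gs.
have Gsym i j : G i j = G j i by rewrite -[in LHS]GT mxE.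
pose A := \matrix_(i < m, j < m) G (lift ord0 i) (lift ord0 j).
have AT : A^T = A by apply/matrixP => i j; rewrite !mxE Gsym.
have Ap : psd A.
  move=> v; have := Gp (\row_i if unlift ord0 i is Some k then v 0 k else 0).
  rewrite !qform_sum big_ord_recl big1 ?add0r => [|j _]; last first.
    by rewrite mxE unlift_none !mul0r.
  rewrite (_ : \sum_(i < m) _ = \sum_(i < m) \sum_(j < m) v 0 i * A i j * v 0 j)//.
  apply: eq_bigr => i _; rewrite big_ord_recl !mxE unlift_none mulr0 add0r.
  by apply: eq_bigr => j _; rewrite !mxE !liftK.
have [X XE] := psd_factor AT Ap.
have Xd i j : dotv (row i X) (row j X) = G (lift ord0 i) (lift ord0 j).
  have -> : G (lift ord0 i) (lift ord0 j) = A i j by rewrite mxE.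
  by rewrite -XE dotvE [RHS]mxE; apply: eq_bigr => k _; rewrite !mxE.
pose o := - \sum_k row k X.
have oE v : dotv o v = - \sum_k dotv (row k X) v.
  by rewrite /o /dotv mulNmx mxE mulmx_suml summxE.
have G0 i : G i ord0 = - \sum_k G i (lift ord0 k).
  by have := Gs i; rewrite big_ord_recl => /eqP; rewrite addr_eq0 => /eqP.
have oX j : dotv o (row j X) = G ord0 (lift ord0 j).
  rewrite oE Gsym G0; congr (- _); apply: eq_bigr => k _.
  by rewrite Xd Gsym.
exists (fun i => if unlift ord0 i is Some k then row k X else o) => i j.
case: unliftP => [i'|] ->; case: unliftP => [j'|] ->.
- exact: Xd.
- by rewrite dotvC oX Gsym.
- exact: oX.
- rewrite oE G0; congr (- _); apply: eq_bigr => k _.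
  by rewrite dotvC oX.
Qed.

End gram.

(** * The second eigenvalue as a Rayleigh quotient *)

Section rayleigh.
Variable R : realType.

Lemma sorted_spectrum n (A : 'M[R]_n) : sorted <=%R (spectrum A).
Proof.
rewrite /spectrum; have : sorted <%R (rootsR (char_poly A)) by exact: sorted_roots.
rewrite sorted_pairwise; last exact: lt_trans.
rewrite sorted_pairwise; last exact: le_trans.
elim: (rootsR _) => //= x s IHs /andP[xs ss]; rewrite pairwise_cat IHs// andbT.
apply/andP; split.
  apply/allrelP => y z /nseqP[-> _] /flatten_mapP[t ts /nseqP[-> _]].
  by apply: ltW; move/allP : xs => /(_ _ ts).
elim: (mup _ _) => //= k ->; rewrite andbT.
by apply/allP => y /nseqP[->].
Qed.

Lemma mem_spectrum n (A : 'M[R]_n) a : eigenvalue A a -> a \in spectrum A.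
Proof.
rewrite eigenvalue_root_char => ra.
have p0 : char_poly A != 0 by rewrite monic_neq0// char_poly_monic.
apply/flatten_mapP; exists a; first by rewrite -(roots_on_rootsR p0) ra inE.
by rewrite mem_nseq eqxx andbT -XsubC_dvd// dvdp_XsubCl.
Qed.

(** As a smaller a occurs in the sorted list, b does not occupy index 0. *)
Lemma second_smallest_le n (A : 'M[R]_n) a b : eigenvalue A a -> eigenvalue A b ->
  a < b -> second_smallest_eigenvalue A <= b.
Proof.
move=> /mem_spectrum aA /mem_spectrum bA ab; have sA := sorted_spectrum A.
rewrite /second_smallest_eigenvalue.
move: (spectrum A) sA aA bA => s ss aA bA.
have ib : (0 < index b s)%N.
  apply: contraTT ab; rewrite -leqNgt leqn0 => /eqP i0; rewrite -leNgt.
  by apply: (sorted_leq_index le_trans lexx ss) => //; rewrite i0.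
rewrite -[leRHS](nth_index 0 bA).
apply: (sorted_leq_nth le_trans lexx 0 ss) => //; rewrite inE ?index_mem//.
by apply: leq_ltn_trans ib _; rewrite index_mem.
Qed.

Definition ones n : 'rV[R]_n := const_mx 1.

(* The minimum of the Rayleigh quotient on the orthogonal complement of the ones
   vector is a positive eigenvalue, hence at least the second one because 0 is
   another eigenvalue. *)
Theorem rayleigh n (A : 'M[R]_n) (v : 'rV[R]_n) : A^T = A -> ones n *m A = 0 ->
  (forall u, u != 0 -> dotv u (ones n) = 0 -> 0 < qform A u u) ->
  dotv v (ones n) = 0 ->
  second_smallest_eigenvalue A * dotv v v <= qform A v v.
Proof.
move=> AT A1 Apos v1.
have [->|v0] := eqVneq v 0.
  by rewrite qformE mul0mx /dotv !mul0mx !mxE mulr0.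
have pos (u : 'rV[R]_n) : u != 0 -> 0 < dotv u u.
  move=> u0; rewrite dotvv lt_neqAle sqr_ge0 andbT eq_sym sqrf_eq0.
  apply: contra_neq u0 => e0; apply/rowP => k; apply/eqP; rewrite [eqbRHS]mxE.
  by rewrite -normr_le0 -e0 enorm_coord.
pose S := [set u : 'rV[R]_n | dotv u u = 1 /\ dotv u (ones n) = 0].
have cdot (f g : 'rV[R]_n -> 'rV[R]_n) : (forall i, continuous (fun u => f u 0 i)) ->
    (forall i, continuous (fun u => g u 0 i)) ->
    continuous (fun u => dotv (f u) (g u)).
  move=> cf cg; rewrite (_ : (fun u => _) = fun u => \sum_i f u 0 i * g u 0 i).
    apply: (@continuous_big _ _ _ _ _ (@add_continuous R)) => i _ u.
    by apply: (cvgM (cf i u) (cg i u)).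
  by apply/funext => u; exact: dotvE.
have cS : compact S.
  apply: bounded_closed_compact.
    exists 1; split; first exact: num_real.
    move=> M M1 u [u2 _]; apply: le_trans (ltW M1); apply: le_trans (mx_norm_le_enorm u) _.
    by rewrite enorm_le// -dotvv u2 expr1n.
  rewrite (_ : S = (fun u : 'rV[R]_n => dotv u u) @^-1` [set y | y = 1] `&`
    (fun u : 'rV[R]_n => dotv u (ones n)) @^-1` [set y | y = 0])//.
  apply: closedI; apply: closed_comp; try exact: closed_eq; move=> u _.
    by apply: cdot => i; exact: coord_continuous.
  by apply: (cdot id (fun=> ones n)) => i; [exact: coord_continuous|exact: cst_continuous].
have scal (u : 'rV[R]_n) : u != 0 -> dotv u (ones n) = 0 -> S ((enorm u)^-1 *: u).
  move=> u0 u1; split; last by rewrite dotvZl u1 mulr0.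
  have := pos _ u0; rewrite dotvv exprn_even_gt0//= => e0.
  by rewrite dotvZl dotvC dotvZl dotvv expr2 mulKf// mulVf.
have S0 : S !=set0 by exists ((enorm v)^-1 *: v); exact: scal.
have [|c Sc cmin] := @EVT_min_rV R n (fun u => qform A u u) S S0 cS.
  apply: continuous_subspaceT.
  apply: (cdot (fun u => u *m A) id) => i; last exact: coord_continuous.
  rewrite (_ : (fun u : 'rV[R]_n => (u *m A) 0 i) = fun u => \sum_j u 0 j * A j i).
    apply: (@continuous_big _ _ _ _ _ (@add_continuous R)) => j _ u.
    apply: (@continuous_comp _ _ _ (fun u : 'rV[R]_n => u 0 j) (fun y : R => y * A j i)).
      exact: coord_continuous.
    by apply: cvgMl.
  by apply/funext => u; rewrite mxE.
move: Sc; rewrite inE => -[c2 c1].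
set mu := qform A c c in cmin.
have low (u : 'rV[R]_n) : dotv u (ones n) = 0 -> mu * dotv u u <= qform A u u.
  move=> u1; have [->|u0] := eqVneq u 0.
    by rewrite qformE mul0mx /dotv !mul0mx !mxE mulr0.
  have /cmin : (enorm u)^-1 *: u \in S by rewrite inE; exact: scal.
  have e0 : 0 < enorm u ^+ 2 by rewrite -dotvv; exact: pos.
  have -> : qform A ((enorm u)^-1 *: u) ((enorm u)^-1 *: u) =
      qform A u u / enorm u ^+ 2.
    rewrite qformE -scalemxAl dotvZl dotvC dotvZl dotvC -qformE mulrA -invfM -expr2.
    by rewrite mulrC.
  by rewrite ler_pdivlMr// dotvv.
have c0 : c != 0.
  by apply: contra_eq_neq c2 => ->; rewrite /dotv mul0mx mxE eq_sym oner_eq0.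
have mu0 : 0 < mu by exact: Apos.
have A1' : forall u, dotv (u *m A) (ones n) = 0.
  move=> u; rewrite dotvC /dotv trmx_mul AT mulmxA A1 mul0mx mxE//.
(* The residual of the eigenvalue equation at the minimizer c. It is orthogonal to the ones vector,
   hence an admissible direction, and its squared norm k is the first variation along itself. *)
pose g := c *m A - mu *: c.
have g1 : dotv g (ones n) = 0.
  by rewrite /g dotvBl dotvZl A1' c1 mulr0 subr0.
pose k := dotv g g.
have kE : qform A c g - mu * dotv c g = k.
  by rewrite /k {1}/g dotvBl dotvZl qformE.
have k0 : k = 0.
  pose e := qform A g g - mu * dotv g g.
  have e0 : 0 <= e by rewrite subr_ge0 low.
  have H t : 0 <= 2 * t * k + t ^+ 2 * e.
    have := low (c + t *: g); rewrite dotvDl dotvZl c1 g1 mulr0 addr0 => /(_ erefl).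
    rewrite qform_add// -subr_ge0 -/mu.
    have -> : dotv (c + t *: g) (c + t *: g) = 1 + 2 * t * dotv c g + t ^+ 2 * dotv g g.
      rewrite dotvDl dotvZl dotvC dotvDl dotvZl [dotv g (c + _)]dotvC dotvDl dotvZl.
      by rewrite c2 [dotv g c]dotvC; ring.
    rewrite (_ : _ - _ = 2 * t * (qform A c g - mu * dotv c g) + t ^+ 2 * e).
      by rewrite kE.
    by rewrite /e; ring.
  have e1 : 0 < e + 1 by rewrite ltr_wpDl.
  (* A nearly optimal t makes the quadratic negative unless k = 0; e + 1 avoids dividing by a
     possible e = 0. *)
  have := H (- k / (e + 1)).
  rewrite (_ : _ + _ = - (k ^+ 2 * (e + 2) / (e + 1) ^+ 2)); last first.
    by field; rewrite gt_eqF.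
  rewrite oppr_ge0 => h; apply/eqP; rewrite -sqrf_eq0 eq_le sqr_ge0 andbT.
  have h2 : 0 < (e + 2) / (e + 1) ^+ 2 by rewrite divr_gt0 ?exprn_gt0// ltr_wpDl.
  by move: h; rewrite -mulrA pmulr_lle0.
have g0 : g = 0.
  by apply/eqP; apply: contraT => /pos; rewrite -/k k0 ltxx.
have emu : eigenvalue A mu.
  apply/eigenvalueP; exists c => //.
  by apply/eqP; rewrite -subr_eq0 -/g g0.
have n0 : ones n != 0.
  apply: contraNneq v0 => o0; apply/eqP/rowP => i.
  by have /rowP/(_ i)/eqP := o0; rewrite !mxE oner_eq0.
have e0 : eigenvalue A 0.
  by apply/eigenvalueP; exists (ones n) => //; rewrite A1 scale0r.
apply: le_trans (low _ v1); rewrite ler_wpM2r ?(ltW (pos _ v0))//.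
exact: second_smallest_le e0 emu mu0.
Qed.

End rayleigh.

Section existence.
Variables (R : realType) (p : nat) (w : {set 'I_(4 * p)} -> nat).
Hypothesis HG : frakG R w.
Local Notation n := (4 * p)%N.

Definition wt (i j : 'I_n) : R := (wmat HG i j)%:R.
(** The weighted degree 0 + 1 + ... + (n - 1) common to all vertices, which is also the spectral
    threshold in [frakG]. *)
Definition wt_sum : R := n%:R * (n%:R - 1) / 2.

Let n0 : (0 < n)%N := frakG_n0 HG.
Let nR0 : 0 < (n%:R : R). Proof. by rewrite ltr0n. Qed.
Let nR : (n%:R : R) != 0. Proof. by rewrite gt_eqF. Qed.

Lemma wtE i j : wt i j = if i == j then 0 else (w [set i; j]%SET)%:R.
Proof. by rewrite /wt val_wmat; case: ifP. Qed.

Lemma wtC i j : wt i j = wt j i.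
Proof. by rewrite !wtE eq_sym finset.setUC. Qed.

Lemma dotv_ones (u : 'rV[R]_n) : dotv u (ones R n) = \sum_i u 0 i.
Proof. by rewrite dotvE; apply: eq_bigr => i _; rewrite mxE mulr1. Qed.

Lemma sum_ord_natr k : \sum_(i < k) (i%:R : R) = k%:R * (k%:R - 1) / 2.
Proof.
elim: k => [|k IHk]; first by rewrite big_ord0 !mul0r.
by rewrite big_ord_recr/= IHk -natr1; field.
Qed.

Lemma sum_wt i : \sum_j wt i j = wt_sum.
Proof.
rewrite /wt_sum -sum_ord_natr [RHS](reindex_inj (@wmat_inj R p w HG i)).
exact: eq_bigr.
Qed.

Lemma wt_ge1 i j : i != j -> 1 <= wt i j.
Proof.
move=> ij; rewrite wtE (negbTE ij) ler1n.
by have [_ /(_ _ (edge_set2 ij))/andP[] ] := HG.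
Qed.

Lemma laplacian_wt i j : laplacian R w i j = (i == j)%:R * wt_sum - wt i j.
Proof.
rewrite mxE; case: eqVneq => [<-|ij].
  rewrite mul1r [wt i i]wtE eqxx subr0 -(sum_wt i) [RHS](bigD1 i)//=.
  rewrite [wt i i]wtE eqxx add0r; apply: eq_bigr => k ki.
  by rewrite wtE eq_sym (negbTE ki).
by rewrite mul0r sub0r wtE (negbTE ij).
Qed.

Lemma laplacian_sym : (laplacian R w)^T = laplacian R w.
Proof. by apply/matrixP => i j; rewrite mxE !laplacian_wt eq_sym wtC. Qed.

Lemma laplacian_ones : ones R n *m laplacian R w = 0.
Proof.
apply/rowP => j; rewrite !mxE; under eq_bigr do rewrite mxE mul1r laplacian_wt wtC.
rewrite big_split/= sumrN sum_wt (bigD1 j)//= eqxx mul1r big1 ?addr0 ?subrr//.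
by move=> i ij; rewrite (negbTE ij) mul0r.
Qed.

(** The Dirichlet form of a symmetric weight with constant row sums, kept general to serve both the
    coloring and the constant weight 1. *)
Lemma sum_sqr_diff (a : 'I_n -> 'I_n -> R) s (u : 'rV[R]_n) :
  (forall i j, a i j = a j i) -> (forall i, \sum_j a i j = s) ->
  \sum_i \sum_j a i j * (u 0 i - u 0 j) ^+ 2 =
  2 * (s * dotv u u - \sum_i \sum_j u 0 i * a i j * u 0 j).
Proof.
move=> aC aS.
have e1 : \sum_i \sum_j a i j * u 0 i ^+ 2 = s * dotv u u.
  rewrite dotvE mulr_sumr; apply: eq_bigr => i _.
  by rewrite -mulr_suml aS expr2.
have e2 : \sum_i \sum_j a i j * u 0 j ^+ 2 = s * dotv u u.
  rewrite exchange_big/= -e1; apply: eq_bigr => i _; apply: eq_bigr => j _.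
  by rewrite aC.
rewrite mulrBr mulr_natl mulr2n -{1}e1 -{1}e2 mulr_sumr -sumrN -!big_split/=.
apply: eq_bigr => i _; rewrite mulr_sumr -sumrN -!big_split/=.
by apply: eq_bigr => j _; ring.
Qed.

Lemma qform_laplacian (u : 'rV[R]_n) : qform (laplacian R w) u u =
  wt_sum * dotv u u - \sum_i \sum_j u 0 i * wt i j * u 0 j.
Proof.
rewrite qform_sum dotvE mulr_sumr -sumrN -big_split/=; apply: eq_bigr => i _.
have -> : wt_sum * (u 0 i * u 0 i) = \sum_j u 0 i * ((i == j)%:R * wt_sum) * u 0 j.
  rewrite (bigD1 i)//= big1 => [|j ji]; last by rewrite eq_sym (negbTE ji) mul0r mulr0 mul0r.
  by rewrite eqxx mul1r; ring.
rewrite -sumrN -big_split/=; apply: eq_bigr => j _.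
by rewrite laplacian_wt; ring.
Qed.

(** Off the diagonal all weights are at least 1, so the form dominates that of the unweighted
    complete graph, equal to n |u|^2 on the complement of the ones vector. *)
Lemma laplacian_pos (u : 'rV[R]_n) : u != 0 -> dotv u (ones R n) = 0 ->
  0 < qform (laplacian R w) u u.
Proof.
move=> u0 u1.
have uu : 0 < dotv u u.
  rewrite dotvv lt_neqAle sqr_ge0 andbT eq_sym sqrf_eq0.
  apply: contra_neq u0 => e0; apply/rowP => k; apply/eqP; rewrite [eqbRHS]mxE.
  by rewrite -normr_le0 -e0 enorm_coord.
have h1 := sum_sqr_diff u wtC sum_wt.
have s1 : \sum_(j < n) 1 = n%:R :> R by rewrite sumr_const card_ord.
have h2 := @sum_sqr_diff (fun _ _ => 1) n%:R u (fun _ _ => erefl) (fun=> s1).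
rewrite -qform_laplacian in h1.
have s0 : \sum_i u 0 i = 0.
  by rewrite -dotv_ones.
have z : \sum_i \sum_j u 0 i * 1 * u 0 j = 0.
  by rewrite big1// => i _; rewrite -mulr_sumr s0 mulr0.
have {}h2 : \sum_i \sum_j 1 * (u 0 i - u 0 j) ^+ 2 = 2 * (n%:R * dotv u u).
  by rewrite h2 z subr0.
have : \sum_i \sum_j 1 * (u 0 i - u 0 j) ^+ 2 <=
    \sum_i \sum_j wt i j * (u 0 i - u 0 j) ^+ 2.
  apply: ler_sum => i _; apply: ler_sum => j _.
  have [<-|ij] := eqVneq i j; first by rewrite subrr expr0n !mulr0.
  by rewrite ler_wpM2r ?sqr_ge0// wt_ge1.
rewrite h1 h2 => h; have : 0 < n%:R * dotv u u by rewrite mulr_gt0.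
lra.
Qed.

(* The Gram matrix prescribed by the required norms and distances. *)
Definition gram : 'M[R]_n := \matrix_(i, j) ((n%:R - 1) / n%:R - 2 / n%:R * wt i j).

Lemma gram_sym : gram^T = gram.
Proof. by apply/matrixP => i j; rewrite !mxE wtC. Qed.

Lemma gram_sum i : \sum_j gram i j = 0.
Proof.
under eq_bigr do rewrite mxE.
rewrite big_split/= sumrN sumr_const card_ord -[_ *+ n]mulr_natl -mulr_sumr sum_wt.
by rewrite /wt_sum; move: nR; move: (n%:R : R) => k k0; field.
Qed.

Lemma gram_ones : ones R n *m gram = 0.
Proof.
apply/rowP => j; rewrite mxE [RHS]mxE -[RHS](gram_sum j); apply: eq_bigr => i _.
by rewrite mxE mul1r -[in RHS]gram_sym [RHS]mxE.
Qed.

Lemma gram_psd : psd gram.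
Proof.
(* u is the projection of v off the ones vector; the form takes the same value at both since [gram]
   kills that vector, and the spectral bound applies to u. *)
move=> v; pose c := (\sum_i v 0 i) / n%:R; pose u := v - c *: ones R n.
have u1 : dotv u (ones R n) = 0.
  have o1 : dotv (ones R n) (ones R n) = n%:R.
    by rewrite dotvE; under eq_bigr do rewrite !mxE mulr1; rewrite sumr_const card_ord.
  by rewrite dotvBl dotvZl dotv_ones o1 /c divfK// subrr.
have -> : qform gram v v = qform gram u u.
  rewrite (_ : v = u + c *: ones R n); last by rewrite subrK.
  rewrite qform_add ?gram_sym// qformC ?gram_sym// !qformE gram_ones.
  by rewrite /dotv !mul0mx !mxE !mulr0 !addr0.
have s0 : \sum_i u 0 i = 0.
  by rewrite -dotv_ones.
have -> : qform gram u u = 2 / n%:R * (qform (laplacian R w) u u - wt_sum * dotv u u).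
  have e1 : (n%:R - 1) / n%:R * (\sum_i u 0 i) * (\sum_j u 0 j) =
      \sum_i \sum_j (n%:R - 1) / n%:R * u 0 i * u 0 j.
    by rewrite -mulrA mulr_suml mulr_sumr; apply: eq_bigr => i _; rewrite mulrA mulr_sumr.
  have e2 : 2 / n%:R * (\sum_i \sum_j u 0 i * wt i j * u 0 j) =
      \sum_i \sum_j 2 / n%:R * (u 0 i * wt i j * u 0 j).
    by rewrite mulr_sumr; apply: eq_bigr => i _; rewrite mulr_sumr.
  rewrite qform_laplacian addrAC subrr sub0r mulrN e2.
  rewrite -[RHS]add0r -[X in _ = X + _](_ : (n%:R - 1) / n%:R * (\sum_i u 0 i) *
    (\sum_j u 0 j) = 0); last by rewrite s0 mulr0.
  rewrite e1 qform_sum -sumrN -big_split/=; apply: eq_bigr => i _.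
  rewrite -sumrN -big_split/=; apply: eq_bigr => j _.
  by rewrite [gram i j]mxE; ring.
rewrite mulr_ge0 ?divr_ge0// subr_ge0.
apply: le_trans (rayleigh laplacian_sym laplacian_ones laplacian_pos u1).
rewrite ler_wpM2r ?dotvv ?sqr_ge0//.
have [_ _ _] := HG; rewrite natrM natrB//.
Qed.

Lemma exists_associated_points :
  exists xi : 'I_n -> 'rV[R]_(4 * p - 1), associated_points w xi.
Proof.
have nS : n = (n - 1).+1 by move: n0; lia.
have [xi xiE] := gram_points nS gram_sym gram_psd gram_sum.
have gii i : gram i i = (n%:R - 1) / n%:R by rewrite mxE wtE eqxx mulr0 subr0.
exists xi; split => [i|i j ij].
  by rewrite -[LHS]ger0_norm ?enorm_ge0// -sqrtr_sqr -dotvv xiE gii natrB.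
apply/enorm_eq; first by rewrite !mulr_ge0// sqrtr_ge0.
have -> : enorm (xi i - xi j) ^+ 2 = gram i i - gram j i - (gram i j - gram j j).
  rewrite -dotvv dotvBl (dotvC (xi i)) (dotvC (xi j)) 2!dotvBl.
  by rewrite (xiE i i) (xiE j i) (xiE i j) (xiE j j).
have w0 : 0 <= ((w [set i; j]%SET)%:R : R) by [].
have d0 : 0 <= 1 / (n%:R : R) by rewrite divr_ge0// ltW.
rewrite 2!gii [gram j i]mxE [gram i j]mxE [wt j i]wtC wtE (negbTE ij).
rewrite 2!exprMn (sqr_sqrtr w0) (sqr_sqrtr d0).
move: nR (w0); move: (n%:R : R) ((w [set i; j]%SET)%:R : R) => k x k0 _.
by field.
Qed.

End existence.

Theorem theorem5p7 (R : realType) (p : nat) (w : {set 'I_(4 * p)} -> nat)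
    (HG : frakG R w) :
  (exists xi : 'I_(4 * p) -> 'rV[R]_(4 * p - 1), associated_points w xi) /\
  (forall xi : 'I_(4 * p) -> 'rV[R]_(4 * p - 1), associated_points w xi ->
     [/\ forall i : 'I_(4 * p),
           Ssphere xi i =
             [set x | Vtranslate xi i x /\
                enorm (x - sphere_center xi i) = Num.sqrt (1 / (4 * p)%:R)],
         forall (x : ambient R p) (r : R), Sigma xi x -> 0 < r ->
           cone_measure xi (eball x r) = (4 * pi / 3 * r ^+ 3)%:E &
         uniform3 (cone_measure xi)]).
Proof.
split; first exact: exists_associated_points.
move=> xi Hxi; have p0 : (1 <= p)%N by case: HG.
have xn := associated_norm HG Hxi; have xd := associated_dist HG Hxi.
have n0 := frakG_n0 HG.
have SE := SigmaE p0 xn.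
split.
- exact: SsphereE.
- move=> x r; rewrite /cone_measure SE /restriction => -[i _ [z _ <-]] r0.
  exact: (hausdorff3_sheets_ball n0 (@wmat_inj R p w HG) (wmat_diag HG) xn xd).
- rewrite /cone_measure SE.
  exact: (sheets_uniform n0 (@wmat_inj R p w HG) (wmat_diag HG) xn xd).
Qed.
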